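(* Let $s\in(\frac12,1)$ and let $\Omega\subset\mathbb{R}^N$ be a convex open set. Then $$\frac{c_{N,s}}{2}\iint_{\Omega\times\Omega}\frac{(u(x)-u(y))^2}{|x-y|^{N+2s}}\,dx\,dy\ \ge\ \mathfrak{h}_{N,s}\int_\Omega\frac{u^2}{\delta^{2s}}\,dx+a(N,s)|\Omega|^{-\frac{2s}{N}}\int_\Omega u^2\,dx$$ for all $u\in H^s_0(\Omega)$, where $$a(N,s)=\mathfrak{h}_{N,s}\,2^{-2s}(2^{2s}-1)\frac{\sqrt{\pi}\,\Gamma(\frac{N+2s}{2})}{\Gamma(\frac N2)\Gamma(\frac{1+2s}{2})}\left(\frac{N}{|\mathbb{S}^{N-1}|}\right)^{-\frac{2s}{N}}.$$
   Context: $\delta(x)=\mathrm{dist}(x,\partial\Omega)$; $|\Omega|$ is the Lebesgue measure of $\Omega$ and $|\mathbb{S}^{N-1}|$ the surface measure of the unit sphere; $c_{N,s}=2^{2s}\pi^{-N/2}s\,\Gamma(\frac{N+2s}{2})/\Gamma(1-s)$. Let $H^s(\Omega)$ be the space of $u\in L^2(\Omega)$ with $(u(x)-u(y))|x-y|^{-(N+2s)/2}\in L^2(\Omega\times\Omega)$, with norm given by $\|u\|_{H^s(\Omega)}^2=\|u\|_{L^2(\Omega)}^2+\frac{c_{N,s}}{2}\iint_{\Omega\times\Omega}\frac{(u(x)-u(y))^2}{|x-y|^{N+2s}}\,dx\,dy$; $H^s_0(\Omega)$ is the completion of $C_c^\infty(\Omega)$ in $H^s(\Omega)$. The constant is $\mathfrak{h}_{N,s}=c_{N,s}\kappa_{N,2s}$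 with $$\kappa_{N,2s}=\pi^{\frac{N-1}{2}}\frac{\Gamma(\frac{1+2s}{2})}{\Gamma(\frac{N+2s}{2})}\frac{1}{2s}\left[\frac{2^{1-2s}}{\sqrt{\pi}}\Gamma(1-s)\Gamma\Big(\frac{1+2s}{2}\Big)-1\right].$$ *)

(* Defs.v *)
From HB Require Import structures.
From mathcomp Require Import all_boot all_order all_algebra.
From mathcomp Require Import all_classical all_reals all_analysis.
Set Implicit Arguments.
Unset Strict Implicit.
Unset Printing Implicit Defensive.
Import Order.TTheory GRing.Theory Num.Theory.
Import numFieldNormedType.Exports.
Local Open Scope classical_set_scope.
Local Open Scope ring_scope.

(* Borel sigma-algebra of R^n, generated by the coordinates, exactly as the
   library does for n.-tuple T. *)
Section measurable_rV.
Context (R : realType) (n : nat).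

Let coord (i : 'I_n) (v : 'rV[R]_n) : measurableTypeR R := v 0 i.

Let rV_set0 : g_sigma_preimage coord set0.
Proof. exact: sigma_algebra0. Qed.

Let rV_setC A : g_sigma_preimage coord A -> g_sigma_preimage coord (~` A).
Proof. exact: sigma_algebraC. Qed.

Let rV_bigcup (F : (set 'rV[R]_n)^nat) :
  (forall i, g_sigma_preimage coord (F i)) ->
  g_sigma_preimage coord (\bigcup_i (F i)).
Proof. exact: sigma_algebra_bigcup. Qed.

HB.instance Definition _ :=
  @isMeasurable.Build (measure_tuple_display R.-ocitv.-measurable.-sigma)
    'rV[R]_n (g_sigma_preimage coord) rV_set0 rV_setC rV_bigcup.

End measurable_rV.

Section measurable_rV_lemmas.
Context (R : realType).

Lemma measurable_coord n (i : 'I_n) :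
  measurable_fun [set: 'rV[R]_n] (fun v => v 0 i : measurableTypeR R).
Proof.
move=> _ Y mY; rewrite setTI; apply: sub_sigma_algebra => /=.
rewrite -bigcup_seq/=; exists i => /=; first by rewrite mem_index_enum.
by exists Y => //; rewrite setTI.
Qed.

Lemma measurable_fun_rV d (T : measurableType d) n (f : T -> 'rV[R]_n) :
  (forall i, measurable_fun [set: T] (fun x => f x 0 i : measurableTypeR R)) ->
  measurable_fun [set: T] f.
Proof.
move=> mf; suff H : g_sigma_preimage (fun i x => f x 0 i : measurableTypeR R)
    `<=` measurable.
  move=> _ A mA; apply: H.
  rewrite (_ : (fun _ => _) =
    (fun i => (fun v : 'rV[R]_n => v 0 i : measurableTypeR R) \o f))//.
  by rewrite g_sigma_preimage_comp; exists A.
apply: smallest_sub; first exact: sigma_algebra_measurable.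
rewrite -bigcup_seq => A [i _] [B mB <-].
exact: mf.
Qed.

End measurable_rV_lemmas.

(* Lebesgue measure on R^n, by recursion on n, as the image of the product
   measure on R * R^n under (t, v) |-> (t, v_1, ..., v_n). *)
Section lebesgue_rV_succ.
Context (R : realType) (n : nat).
Implicit Types m : {sigma_finite_measure set 'rV[R]_n -> \bar R}.

Definition rV_cons (p : measurableTypeR R * 'rV[R]_n) : 'rV[R]_n.+1 :=
  row_mx (const_mx (p.1 : R) : 'rV[R]_1) p.2.

Definition rV_uncons (v : 'rV[R]_n.+1) : measurableTypeR R * 'rV[R]_n :=
  (v 0 0, \row_j v 0 (lift 0 j)).

Lemma rV_cons0 p : rV_cons p 0 0 = p.1.
Proof.
rewrite /rV_cons mxE; case: splitP => // j _.
by rewrite mxE.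
Qed.

Lemma rV_consS p j : rV_cons p 0 (lift 0 j) = p.2 0 j.
Proof.
rewrite (_ : lift 0 j = rshift 1 j); last exact/val_inj.
by rewrite /rV_cons (row_mxEr (const_mx _ : 'rV_1)).
Qed.

Lemma rV_consK : cancel rV_cons rV_uncons.
Proof.
move=> p; rewrite /rV_uncons rV_cons0 [RHS]surjective_pairing; congr pair.
by apply/rowP => j; rewrite mxE rV_consS.
Qed.

Lemma rV_unconsK : cancel rV_uncons rV_cons.
Proof.
move=> v; apply/rowP => i; case: (unliftP 0 i) => [j|] ->.
  by rewrite rV_consS mxE.
by rewrite rV_cons0.
Qed.

Lemma measurable_rV_cons : measurable_fun [set: _] rV_cons.
Proof.
apply: measurable_fun_rV => i; case: (unliftP 0 i) => [j|] ->.
  under eq_fun do rewrite rV_consS.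
  exact: measurableT_comp (measurable_coord j) measurable_snd.
under eq_fun do rewrite rV_cons0.
exact: measurable_fst.
Qed.

Lemma measurable_rV_uncons : measurable_fun [set: _] rV_uncons.
Proof.
apply: measurable_fun_pair; first exact: measurable_coord.
apply: measurable_fun_rV => i; under eq_fun do rewrite mxE.
exact: measurable_coord.
Qed.

Definition lebesgue_rV_succ m : set 'rV[R]_n.+1 -> \bar R :=
  pushforward (lebesgue_measure \x m)%E rV_cons.

Section measure.
Variable m : {sigma_finite_measure set 'rV[R]_n -> \bar R}.

Let m0 : lebesgue_rV_succ m set0 = 0%E.
Proof. by rewrite /lebesgue_rV_succ /pushforward preimage_set0 measure0. Qed.

Let m_ge0 A : (0 <= lebesgue_rV_succ m A)%E.
Proof. by rewrite /lebesgue_rV_succ /pushforward measure_ge0. Qed.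

Let m_sigma_additive : semi_sigma_additive (lebesgue_rV_succ m).
Proof.
move=> F mF tF mUF; rewrite /lebesgue_rV_succ /pushforward preimage_bigcup.
apply: measure_semi_sigma_additive.
- by move=> k; rewrite -[X in measurable X]setTI; exact: measurable_rV_cons.
- apply/trivIsetP => /= i j _ _ ij; rewrite -preimage_setI.
  by move/trivIsetP : tF => /(_ _ _ _ _ ij) ->//; rewrite preimage_set0.
- rewrite -preimage_bigcup -[X in measurable X]setTI.
  exact: measurable_rV_cons.
Qed.

HB.instance Definition _ := isMeasure.Build _ _ _ (lebesgue_rV_succ m)
  m0 m_ge0 m_sigma_additive.

Let m_sigma_finite : sigma_finite [set: _] (lebesgue_rV_succ m).
Proof.
have /sigma_finiteP[F [TF ndF Foo]] :=
  sigma_finiteT (lebesgue_measure : {sigma_finite_measure set _ -> \bar R}).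
have /sigma_finiteP[G [TG ndG Goo]] := sigma_finiteT m.
exists (fun k => rV_uncons @^-1` (F k `*` G k)).
  rewrite -preimage_bigcup; apply/esym/seteqP; split => // v _ /=.
  have [j _ Fj] : (\bigcup_j F j) (rV_uncons v).1 by rewrite -TF.
  have [k _ Gk] : (\bigcup_j G j) (rV_uncons v).2 by rewrite -TG.
  exists (maxn j k) => //; split.
    by move: (rV_uncons v).1 Fj; exact/subsetPset/ndF/leq_maxl.
  by move: (rV_uncons v).2 Gk; exact/subsetPset/ndG/leq_maxr.
move=> k; have [mF Fk] := Foo k; have [mG Gk] := Goo k; split.
  rewrite -[X in measurable X]setTI; apply: measurable_rV_uncons => //.
  exact: measurableX.
rewrite /lebesgue_rV_succ /pushforward -comp_preimage.
rewrite (_ : _ \o _ = id) ?preimage_id; last exact/funext/rV_consK.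
by rewrite product_measure1E// lte_mul_pinfty// ge0_fin_numE.
Qed.

HB.instance Definition _ := Measure_isSigmaFinite.Build _ _ _
  (lebesgue_rV_succ m) m_sigma_finite.

End measure.
End lebesgue_rV_succ.

Fixpoint lebesgue_rV (R : realType) (n : nat) :
    {sigma_finite_measure set 'rV[R]_n -> \bar R} :=
  if n is n'.+1 then lebesgue_rV_succ (lebesgue_rV R n')
  else \d_(0 : 'rV[R]_0).

Lemma measurable_box (R : realType) (n : nat)
    (A : 'I_n -> set (measurableTypeR R)) : (forall i, measurable (A i)) ->
  measurable [set v : 'rV[R]_n | forall i, A i (v 0 i)].
Proof.
move=> mA; rewrite (_ : [set v | _] =
  \big[setI/setT]_(i < n) ((fun v : 'rV[R]_n => v 0 i) @^-1` A i)).
  apply: bigsetI_measurable => i _; rewrite -[X in measurable X]setTI.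
  exact: measurable_coord.
rewrite -bigcap_seq; apply/seteqP; split => v /= Av i; first by move=> _; exact: Av.
by apply: (Av i) => /=; rewrite mem_index_enum.
Qed.

Lemma lebesgue_rV_box (R : realType) (n : nat)
    (A : 'I_n -> set (measurableTypeR R)) : (forall i, measurable (A i)) ->
  lebesgue_rV R n [set v | forall i, A i (v 0 i)] =
  (\prod_(i < n) lebesgue_measure (A i))%E.
Proof.
elim: n A => [|n IH] A mA.
  by rewrite big_ord0 /= diracE mem_set//=; case.
rewrite big_ord_recl -IH// -product_measure1E//; last first.
  by apply: (@measurable_box R n (fun i => A (lift ord0 i))) => i; exact: mA.
rewrite /= /lebesgue_rV_succ /pushforward; congr (_ _).
apply/seteqP; split => -[t v] /=.
  move=> Av; split => [|i /=]; first by have := Av 0; rewrite rV_cons0.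
  by have := Av (lift 0 i); rewrite rV_consS.
move=> [At Av] i; case: (unliftP 0 i) => [j|] ->.
  by rewrite rV_consS; exact: Av.
by rewrite rV_cons0.
Qed.

Section euclidean.
Context {R : realType} {N : nat}.
Implicit Types (x v : 'rV[R]_N) (A Omega : set 'rV[R]_N).

(* The library's norm on 'rV[R]_N is the sup norm; it induces the same
   topology, but distances must be Euclidean. *)
Definition enorm x : R := Num.sqrt (\sum_(i < N) x 0 i ^+ 2).

Definition boundary A : set 'rV[R]_N := closure A `\` interior A.

(* dist(x, boundary of Omega); it is +oo when the boundary is empty. *)
Definition delta Omega x : \bar R :=
  ereal_inf [set (enorm (x - y))%:E | y in boundary Omega].

Definition unit_sphere : set 'rV[R]_N := [set w | enorm w = 1].

(* Surface measure on the unit sphere, through polar coordinates: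
   sigma(A) = N * |{r w : 0 < r <= 1, w in A}|. *)
Definition surface_measure A : \bar R :=
  (N%:R%:E * lebesgue_rV R N
    [set x | exists r w, [/\ (0 < r <= 1)%R, A w & x = (r *: w)%R]])%E.

Definition partials (f : 'rV[R]_N -> R) (l : seq 'I_N) : 'rV[R]_N -> R :=
  foldr (fun i g => 'D_(delta_mx 0 i) g) f l.

Definition smooth (f : 'rV[R]_N -> R) : Prop :=
  forall l : seq 'I_N, continuous (partials f l) /\
    forall (i : 'I_N) x, derivable (partials f l) x (delta_mx 0 i).

Definition support (f : 'rV[R]_N -> R) : set 'rV[R]_N :=
  closure [set x | f x != 0].

(* Elements of C_c^oo(Omega), extended by 0 to R^N. *)
Definition Cc_smooth Omega (f : 'rV[R]_N -> R) : Prop :=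
  [/\ smooth f, compact (support f) & support f `<=` Omega].

End euclidean.

Definition square_integrable d (T : measurableType d) (R : realType)
    (mu : {measure set T -> \bar R}) (D : set T) (f : T -> R) : Prop :=
  measurable_fun D f /\ (\int[mu]_(x in D) (f x ^+ 2)%:E < +oo)%E.

Section constants.
Context {R : realType}.
Implicit Types (s : R) (N : nat).

(* Used only for x > 0. *)
Definition Gamma (x : R) : R :=
  (\int[lebesgue_measure]_(t in `]0, +oo[) (t `^ (x - 1) * expR (- t)))%R.

Definition cNs N s : R :=
  2 `^ (2 * s) * pi `^ (- (N%:R / 2)) * s *
  Gamma ((N%:R + 2 * s) / 2) / Gamma (1 - s).

Definition kappa N s : R :=
  pi `^ ((N%:R - 1) / 2) *
  (Gamma ((1 + 2 * s) / 2) / Gamma ((N%:R + 2 * s) / 2)) *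
  (2 * s)^-1 *
  (2 `^ (1 - 2 * s) / Num.sqrt pi * Gamma (1 - s) * Gamma ((1 + 2 * s) / 2)
   - 1).

Definition hNs N s : R := cNs N s * kappa N s.

Definition sphere_area N : R :=
  fine (surface_measure (@unit_sphere R N)).

Definition aNs N s : R :=
  hNs N s * 2 `^ (- (2 * s)) * (2 `^ (2 * s) - 1) *
  (Num.sqrt pi * Gamma ((N%:R + 2 * s) / 2) /
   (Gamma (N%:R / 2) * Gamma ((1 + 2 * s) / 2))) *
  (N%:R / sphere_area N) `^ (- (2 * s / N%:R)).

End constants.

Section fractional_sobolev.
Context {R : realType} {N : nat}.
Implicit Types (s : R) (Omega : set 'rV[R]_N) (u : 'rV[R]_N -> R).

Local Notation leb := (lebesgue_rV R N).

Definition seminorm2 s Omega u : \bar R :=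
  (\int[leb \x leb]_(z in Omega `*` Omega)
    ((u z.1 - u z.2) ^+ 2 / enorm (z.1 - z.2) `^ (N%:R + 2 * s))%:E)%E.

(* Functions on Omega are represented by total functions, whose values outside
   Omega play no role. *)
Definition Hs s Omega u : Prop :=
  square_integrable leb Omega u /\
  square_integrable (leb \x leb)%E (Omega `*` Omega)
    (fun z => (u z.1 - u z.2) *
              enorm (z.1 - z.2) `^ (- ((N%:R + 2 * s) / 2))).

Definition Hs_norm s Omega u : \bar R :=
  ((\int[leb]_(x in Omega) (u x ^+ 2)%:E +
    (cNs N s / 2)%:E * seminorm2 s Omega u) `^ 2^-1)%E.

(* Closure of C_c^oo(Omega) in the complete space H^s(Omega). *)
Definition Hs0 s Omega u : Prop :=
  Hs s Omega u /\
  forall e : R, 0 < e -> exists phi : 'rV[R]_N -> R,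
    Cc_smooth Omega phi /\
    (Hs_norm s Omega (fun x => u x - phi x)%R < e%:E)%E.

End fractional_sobolev.

(* Main.v *)
Require Import Defs.
From HB Require Import structures.
From mathcomp Require Import all_boot all_order all_algebra.
From mathcomp Require Import all_classical all_reals all_analysis.
From mathcomp Require Import measurable_realfun simple_functions.
From mathcomp Require Import ring lra.

(* Write [al = 2 s].  Averaging over the direction [h] against the Gaussian [exp (- |h|^2)] replaces polar
   coordinates: up to the factor [Gamma ((N + al) / 2)], the energy is the average over [h] of the energies
   along the lines parallel to [h], and likewise for the measure of [Omega] and for integrals over the sphere.

   On a line, [Omega] is a chord.  For [x] in [Omega], let [P] and [Q] be the gauges of [Omega - x] at [h] and
   [- h], so that [x + t h] lies in [Omega] iff [- 1 / Q < t < 1 / P].  With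
   [rho = ((1 - P t) (1 + Q t))^((al - 1) / 2)], the ratio of the values of a ground state at [x + t h] and [x],
   the inequality [2 a b <= rho a^2 + b^2 / rho] bounds the energy below by the integral of [u^2] against a
   multiple of [(P + Q)^al]; the integrals over [t] are computed after a Moebius change of variable.

   Finally [(P + Q)^al >= max (P, Q)^al + (2^al - 1) min (P, Q)^al].  A supporting hyperplane at a nearest
   boundary point bounds [max (P, Q)] below and yields the term in [delta]; Jensen's inequality, in the form of a
   tangent line inequality, bounds the average of [min (P, Q)^al] below through the average of [P^-N + Q^-N],
   a multiple of the volume of [Omega].  Bounded convex sets suffice for functions with compact support, and general
   functions follow by density. *)

Import Order.TTheory GRing.Theory Num.Theory.
Import numFieldNormedType.Exports.
Set Implicit Arguments.
Unset Strict Implicit.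
Unset Printing Implicit Defensive.
Local Open Scope classical_set_scope.
Local Open Scope ring_scope.

(** * Changes of variables *)

(** The kernel |t|^(-1 - al) is not integrable at 0, so the squares in the ground state inequality
    cannot be integrated separately. They are cut off near the diagonal, where each integral grows
    like e^(-al), and the difference survives as e tends to 0. For the divergences to match, the
    cut-off must be unchanged when the two end points of a segment are exchanged; the Moebius
    coordinate provides this. The exponent (al - 1) / 2 is the one for which the integral on an
    arbitrary chord becomes, in that coordinate, the integral on (-1, 1) seen from its midpoint.

    Space is never sliced into lines: x ranges over the whole space, t over the reals, and
    exchanging end points is the measure-preserving map (x, t) -> (x + t h, - t). Gaussian averages
    need only dilations and Tonelli, and no integration over the sphere.

    Finite exit times in every direction require a bounded set. Hence the gauges belong to a bounded
    convex part of the domain, while distance and volume refer to the whole domain; both comparisons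
    go in the favorable direction. *)

Section real_line.
Context {R : realType}.
Local Notation mu := (@lebesgue_measure R).
Local Open Scope ereal_scope.

(** The image of Lebesgue measure under the translation agrees with it on half-open intervals, which
    determine it. *)
Lemma ge0_integral_shift (f : R -> \bar R) (c : R) :
  measurable_fun [set: R] f -> (forall x, 0 <= f x) ->
  \int[mu]_x f (x + c)%R = \int[mu]_x f x.
Proof.
move=> mf f0.
have mphi : measurable_fun [set: R]
    (fun x : measurableTypeR R => (x + c)%R : measurableTypeR R).
  exact: measurable_funD.
rewrite -[RHS](_ : \int[pushforward mu (fun x : measurableTypeR R => (x + c)%R : measurableTypeR R)]_x f x = _).
  by rewrite ge0_integral_pushforward//=.
apply: eq_measure_integral => A mA _.
apply/esym/lebesgue_measure_unique => //= _ [[a b]] _ <-.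
rewrite /pushforward.
rewrite (_ : _ @^-1` _ = `](a - c)%R, (b - c)%R]%classic); last first.
  by apply/seteqP; split => x /=; rewrite !in_itv/= ltrBlDr lerBrDr.
by rewrite /= !lebesgue_measure_itv/= !lte_fin ltrD2r -!EFinD opprB addrA subrK.
Qed.

Lemma ge0_integral_scale (f : R -> \bar R) (c : R) : (c != 0)%R ->
  measurable_fun [set: R] f -> (forall x, 0 <= f x) ->
  \int[mu]_x f (c * x)%R = `|c|^-1%:E * \int[mu]_x f x.
Proof.
(* A negative factor would reverse half-open intervals; composing with the reflection x -> - x makes
   it positive. *)
wlog c0 : f c / (0 < c)%R => [hw|_ mf f0].
  move=> c0 mf f0; have [cp|] := ltP 0%R c; first exact: hw.
  rewrite le_eqVlt (negbTE c0)/= => cn.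
  have mfN : measurable_fun [set: R] (fun x : R => f (- x)%R).
    by apply: measurableT_comp => //; exact: measurable_funN.
  transitivity (\int[mu]_x (fun x => f (- x)%R) (- c * x)%R).
    by apply: eq_integral => x _; rewrite mulNr opprK.
  rewrite (hw (fun x => f (- x)%R) (- c)%R) ?oppr_gt0 ?oppr_eq0// normrN; congr (_ * _).
  rewrite -[RHS](_ : \int[pushforward mu (fun x : measurableTypeR R => (- x)%R : measurableTypeR R)]_x f x = _).
    by rewrite ge0_integral_pushforward//=; exact: measurable_funN.
  apply: eq_measure_integral => [|mN A mA _]; first exact: measurable_funN.
  exact: lebesgue_measureN.
have mphi : measurable_fun [set: R]
    (fun x : measurableTypeR R => (c * x)%R : measurableTypeR R).
  exact: measurable_funM.
have c1 : (0 <= c)%R by exact: ltW.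
rewrite -[RHS](_ : \int[pushforward mu (fun x : measurableTypeR R => (c * x)%R : measurableTypeR R)]_x f x = _).
  by rewrite ge0_integral_pushforward//=.
suff -> : \int[mu]_x f x = c%:E *
    \int[pushforward mu (fun x : measurableTypeR R => (c * x)%R : measurableTypeR R)]_x f x.
  by rewrite muleA -EFinM gtr0_norm// mulVf ?mul1e// gt_eqF.
apply/esym.
apply: etrans; first by apply/esym; apply: (ge0_integral_mscale _ measurableT (NngNum c1)).
apply: eq_measure_integral => A mA _.
apply/esym/lebesgue_measure_unique => //= _ [[a b]] _ <-.
rewrite /mscale/= /pushforward.
rewrite (_ : _ @^-1` _ = `](a / c)%R, (b / c)%R]%classic); last first.
  by apply/seteqP; split => x /=; rewrite !in_itv/= ltr_pdivrMr// ler_pdivlMr// ![(x * _)%R]mulrC.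
rewrite /= !lebesgue_measure_itv/= !lte_fin ltr_pM2r ?invr_gt0//.
case: ifPn => // ab; rewrite ?mule0// -!EFinD -EFinM mulrBr !(mulrC c) !divfK// gt_eqF//.
Qed.

End real_line.

(** * Translations and dilations of R^n *)

Section euclidean_space.
Context {R : realType}.
Local Notation mu := (@lebesgue_measure R).
Local Open Scope ereal_scope.

Lemma measurable_rV_add n (k : 'rV[R]_n) : measurable_fun [set: 'rV[R]_n] (fun x => (x + k)%R).
Proof.
apply: measurable_fun_rV => i; under eq_fun do rewrite mxE.
by apply: measurable_funD => //; exact: measurable_coord.
Qed.

Lemma measurable_rV_scale n (t : R) : measurable_fun [set: 'rV[R]_n] (fun x => (t *: x)%R).
Proof.
apply: measurable_fun_rV => i; under eq_fun do rewrite mxE.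
by apply: measurable_funM => //; exact: measurable_coord.
Qed.

Lemma ge0_integral_rV_cons n (f : 'rV[R]_n.+1 -> \bar R) :
  measurable_fun [set: _] f -> (forall x, 0 <= f x) ->
  \int[lebesgue_rV R n.+1]_x f x =
  \int[mu]_t \int[lebesgue_rV R n]_v f (rV_cons (t, v)).
Proof.
move=> mf f0.
rewrite -(@fubini_tonelli1 _ _ _ _ _ mu (lebesgue_rV R n) (fun p => f (rV_cons p)))//; last first.
  by apply: measurableT_comp => //; exact: measurable_rV_cons.
rewrite -(@ge0_integral_pushforward _ _ _ _ _ _ (@measurable_rV_cons R n) _ setT)//.
Qed.

(** Induction on the dimension: Tonelli splits off the first coordinate, to which the
    one-dimensional case applies. *)
Lemma ge0_integral_rV_shift n (f : 'rV[R]_n -> \bar R) (k : 'rV[R]_n) :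
  measurable_fun [set: _] f -> (forall x, 0 <= f x) ->
  \int[lebesgue_rV R n]_x f (x + k)%R = \int[lebesgue_rV R n]_x f x.
Proof.
elim: n f k => [|n IH] f k mf f0.
  by apply: eq_integral => x _; congr f; apply/rowP; case.
have mcons t : measurable_fun setT (fun v : 'rV[R]_n => f (rV_cons (t, v))).
  apply: measurableT_comp => //; apply: measurableT_comp => //; exact: measurable_rV_cons.
rewrite ge0_integral_rV_cons//; last first.
  by apply: measurableT_comp => //; exact: measurable_rV_add.
have E t v : f (rV_cons (t, v) + k)%R =
    f (rV_cons ((t + k 0 0)%R, (v + \row_j k 0 (lift 0 j))%R)).
  congr f; apply/rowP => i; case: (unliftP 0%R i) => [j|] ->.
    by rewrite [LHS]mxE !rV_consS !mxE.
  by rewrite [LHS]mxE !rV_cons0.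
transitivity (\int[mu]_t (fun t => \int[lebesgue_rV R n]_v f (rV_cons (t, v))) (t + k 0 0)%R).
  apply: eq_integral => t _.
  under eq_integral do rewrite E.
  by rewrite (IH (fun v => f (rV_cons ((t + k 0 0)%R, v)))).
rewrite (ge0_integral_shift (f := fun t => \int[lebesgue_rV R n]_v f (rV_cons (t, v)))).
- by rewrite ge0_integral_rV_cons.
- apply: (@measurable_fun_fubini_tonelli_F _ _ _ _ _ _ (fun p => f (rV_cons p))) => //.
  by apply: measurableT_comp => //; exact: measurable_rV_cons.
- by move=> t; apply: integral_ge0.
Qed.

Lemma ge0_integral_rV_scale n (f : 'rV[R]_n -> \bar R) (c : R) : (c != 0)%R ->
  measurable_fun [set: _] f -> (forall x, 0 <= f x) ->
  \int[lebesgue_rV R n]_x f (c *: x)%R = (`|c| ^- n)%:E * \int[lebesgue_rV R n]_x f x.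
Proof.
move=> c0; elim: n f => [|n IH] f mf f0.
  rewrite expr0 invr1 mul1e.
  by apply: eq_integral => x _; congr f; apply/rowP; case.
have mcons t : measurable_fun setT (fun v : 'rV[R]_n => f (rV_cons (t, v))).
  apply: measurableT_comp => //; apply: measurableT_comp => //; exact: measurable_rV_cons.
have mint : measurable_fun [set: R] (fun t : R => \int[lebesgue_rV R n]_v f (rV_cons (t, v))).
  apply: (@measurable_fun_fubini_tonelli_F _ _ _ _ _ _ (fun p => f (rV_cons p))) => //.
  by apply: measurableT_comp => //; exact: measurable_rV_cons.
rewrite ge0_integral_rV_cons//; last first.
  by apply: measurableT_comp => //; exact: measurable_rV_scale.
have E t v : f (c *: rV_cons (t, v))%R = f (rV_cons ((c * t)%R, (c *: v)%R)).
  congr f; apply/rowP => i; case: (unliftP 0%R i) => [j|] ->.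
    by rewrite [LHS]mxE !rV_consS !mxE.
  by rewrite [LHS]mxE !rV_cons0.
transitivity (\int[mu]_t ((`|c| ^- n)%:E * (fun t => \int[lebesgue_rV R n]_v f (rV_cons (t, v))) (c * t)%R)).
  apply: eq_integral => t _.
  under eq_integral do rewrite E.
  by rewrite (IH (fun v => f (rV_cons ((c * t)%R, v)))).
rewrite ge0_integralZl//; last 2 first.
- have mc : measurable_fun [set: R] (fun t : R => c * t)%R by exact: measurable_funM.
  exact: (measurableT_comp mint mc).
- by move=> t _; apply: integral_ge0.
rewrite (ge0_integral_scale (f := fun t => \int[lebesgue_rV R n]_v f (rV_cons (t, v))) c0); last 2 first.
- by [].
- by move=> t; apply: integral_ge0.
by rewrite muleA -EFinM -invfM -exprSr ge0_integral_rV_cons.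
Qed.

End euclidean_space.

Section substitution.
Context {R : realType}.
Local Notation mu := (@lebesgue_measure R).

(* Substitution on an interval that is exhausted by compact intervals, where
   neither integrand needs to extend continuously to the end points. *)
Lemma ge0_substitution_exhaustion (I J : set R) (a b : nat -> R) (F f G : R -> R) :
  (forall n, a n <= b n) ->
  {homo a : m n / (m <= n)%N >-> n <= m} ->
  {homo b : m n / (m <= n)%N >-> m <= n} ->
  I = \bigcup_n `[a n, b n]%classic -> J = \bigcup_n `[F (a n), F (b n)]%classic ->
  open I -> open J ->
  {in I &, {homo F : x y / x < y}} ->
  {in I, forall x, is_derive x (1 : R) F (f x)} ->
  {in I, continuous f} -> {in J, continuous G} ->
  {in I, forall x, 0 <= f x} -> {in J, forall y, 0 <= G y} ->
  (\int[mu]_(y in J) (G y)%:E = \int[mu]_(x in I) (G (F x) * f x)%:E)%E.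
Proof.
move=> ab na nb IE JE oI oJ Finc dF cf cG f0 G0.
have abI n : `[a n, b n]%classic `<=` I by rewrite IE => x xn; exists n.
have abJ n : `[F (a n), F (b n)]%classic `<=` J by rewrite JE => x xn; exists n.
have Fle : {in I &, {homo F : x y / x <= y}}.
  by move=> x y xI yI; rewrite le_eqVlt => /predU1P[->//|/Finc/ltW]; exact.
have aI n : a n \in I by apply/mem_set/(abI n); rewrite /= in_itv/= lexx ab.
have bI n : b n \in I by apply/mem_set/(abI n); rewrite /= in_itv/= lexx ab.
have cF : {in I, continuous F}.
  move=> x xI; apply: differentiable_continuous; apply/derivable1_diffP.
  by have [] := dF x xI.
have FJ x : I x -> J (F x).
  move=> xI; move: (xI); rewrite IE => -[n _ /=]; rewrite in_itv/= => /andP[ax xb].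
  by apply: (abJ n); rewrite /= in_itv/= !Fle// inE.
have mI : measurable I by exact: open_measurable.
have mJ : measurable J by exact: open_measurable.
have mG : measurable_fun J (EFin \o G).
  apply/measurable_EFinP; exact: open_continuous_measurable_fun.
have cGF : {in I, continuous (fun x => G (F x) * f x)}.
  move=> x xI; apply: cvgM; last exact: cf.
  apply: continuous_comp; first exact: cF.
  by apply: cG; rewrite inE; apply: FJ; rewrite -inE.
have mGF : measurable_fun I (EFin \o (fun x => G (F x) * f x)).
  by apply/measurable_EFinP; exact: open_continuous_measurable_fun.
have H n : (\int[mu]_(y in `[F (a n), F (b n)]) (G y)%:E =
     \int[mu]_(x in `[a n, b n]) (G (F x) * f x)%:E)%E.
  have := ab n; rewrite le_eqVlt => /predU1P[<-|abn].
    by rewrite !set_itv1 !integral_set1.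
  have dE x : x \in I -> (F^`())%classic x = f x.
    by move=> xI; rewrite derive1E; have [_] := dF x xI.
  have nearI x : I x -> \near x, I x.
    by move=> Ix; apply: open_nbhs_nbhs; split.
  have cF' x : x \in I -> (F^`())%classic y @[y --> x] --> f x.
    move=> xI; apply: cvg_trans (cf x xI); apply: near_eq_cvg.
    near=> y; rewrite dE// inE; near: y; apply: nearI; by rewrite -inE.
  rewrite (@integration_by_substitution_increasing _ F G)//.
  - apply: eq_integral => x; rewrite inE/= => xab.
    rewrite !fctE dE// inE; exact: abI xab.
  - by move=> x y xI yI; apply: Finc; rewrite inE; apply: abI; eassumption.
  - move=> x xab; have xI : x \in I.
      by rewrite inE; apply: (abI n); exact: subset_itv_oo_cc xab.
    by rewrite /continuous_at dE//; exact: cF'.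
  - by apply/cvg_ex; exists (f (a n)); apply: cvg_at_right_filter; exact: cF'.
  - by apply/cvg_ex; exists (f (b n)); apply: cvg_at_left_filter; exact: cF'.
  - split.
    + move=> x xab; have xI : x \in I.
        by rewrite inE; apply: (abI n); exact: subset_itv_oo_cc xab.
      by have [] := dF x xI.
    + by apply: cvg_at_right_filter; exact: cF.
    + by apply: cvg_at_left_filter; exact: cF.
  - apply: continuous_in_subspaceT => y yab; apply: cG.
    by rewrite inE; apply: (abJ n); rewrite -inE.
have cvgl : (\int[mu]_(y in `[F (a n), F (b n)]) (G y)%:E)%E @[n --> \oo] -->
    (\int[mu]_(y in J) (G y)%:E)%E.
  rewrite JE; apply: ge0_nondecreasing_set_cvg_integral => //.
  - move=> m n mn; apply/subsetPset => y /=; rewrite !in_itv/= => /andP[Fay yFb].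
    by rewrite (le_trans _ Fay) ?(le_trans yFb)// Fle ?na ?nb.
  - by move=> n; apply: measurable_funS mG => //; exact: abJ.
  - by move=> n y /abJ Jy; rewrite lee_fin G0// inE.
have cvgr : (\int[mu]_(x in `[a n, b n]) (G (F x) * f x)%:E)%E @[n --> \oo] -->
    (\int[mu]_(x in I) (G (F x) * f x)%:E)%E.
  rewrite IE; apply: ge0_nondecreasing_set_cvg_integral => //.
  - move=> m n mn; apply/subsetPset => y /=; rewrite !in_itv/= => /andP[ay yb].
    by rewrite (le_trans _ ay) ?(le_trans yb)// ?na ?nb.
  - by move=> n; apply: measurable_funS mGF => //; exact: abI.
  - move=> n x /abI Ix; rewrite lee_fin mulr_ge0// ?f0 ?G0// inE//; exact: FJ.
rewrite (_ : (fun n => _) = (fun n => \int[mu]_(x in `[a n, b n]) (G (F x) * f x)%:E)%E) in cvgl.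
  by apply: (cvg_unique _ cvgl cvgr).
by apply/funext => n; exact: H.
Unshelve. all: end_near. Qed.

End substitution.

(** * Gamma integrals *)

Section power_calculus.
Context {R : realType}.
Local Notation mu := (@lebesgue_measure R).

Lemma is_derive_continuous (f : R -> R) (x d : R) :
  is_derive x (1 : R) f d -> {for x, continuous f}.
Proof.
by move=> [+ _] => /derivable1_diffP; exact: differentiable_continuous.
Qed.

Lemma is_derive1Z (k : R) (f : R -> R) (x d : R) :
  is_derive x (1 : R) f d -> is_derive x (1 : R) (fun t => k * f t) (k * d).
Proof. by move=> fd; have := is_deriveZ k fd. Qed.

Lemma powR_continuous (c x : R) : 0 < x -> {for x, continuous (fun t : R => t `^ c)}.
Proof. by move=> x0; apply: is_derive_continuous; exact: is_derive1_powR. Qed.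

Lemma powR_addl_continuous (a c x : R) : 0 < a + x ->
  {for x, continuous (fun t : R => (a + t) `^ c)}.
Proof.
move=> x0; apply: (@continuous_comp _ _ _ (fun t => a + t) (fun t : R => t `^ c)).
  by apply: cvgD; [exact: cvg_cst|exact: cvg_id].
exact: powR_continuous.
Qed.

Lemma powRE (x c : R) : 0 < x -> x `^ c = expR (c * ln x).
Proof. by move=> x0; rewrite /powR gt_eqF. Qed.

Lemma powRV (x c : R) : 0 < x -> x^-1 `^ c = (x `^ c)^-1.
Proof. by move=> x0; rewrite !powRE ?invr_gt0// lnV// mulrN expRN. Qed.

Lemma ltr_powR (c : R) : 0 < c -> {in [pred x : R | 0 < x] &, {homo (fun t : R => t `^ c) : x y / x < y}}.
Proof.
move=> c0 x y; rewrite !inE => x0 y0 xy.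
by rewrite gt0_ltr_powR// nnegrE ltW.
Qed.

(** The exhaustion behind the substitutions on the half-line. The exponent [c] lets the same family
    serve as the image of the case c = 1 under t -> t^c. *)
Lemma itv0y_bigcup_harmonic (c : R) : 0 < c ->
  `]0, +oo[%classic = \bigcup_n `[(n.+1%:R^-1 : R) `^ c, n.+1%:R `^ c]%classic.
Proof.
move=> c0; apply/seteqP; split=> [y /=|y [n _] /=].
  rewrite !in_itv/= andbT => y0.
  (* The index is taken from z + 1 / z, which dominates both z and 1 / z. *)
  pose z := y `^ c^-1.
  have z0 : 0 < z by rewrite powR_gt0.
  have zc : z `^ c = y by rewrite -powRrM mulVf ?gt_eqF// powRr1// ltW.
  exists (Num.truncn (z + z^-1)) => //=.
  have h : z + z^-1 <= (Num.truncn (z + z^-1)).+1%:R by apply/ltW; exact: truncnS_gt.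
  have zi : 0 < z^-1 by rewrite invr_gt0.
  rewrite in_itv/= -zc; apply/andP; split; apply: ge0_ler_powR; rewrite ?nnegrE ?(ltW c0)// ?(ltW z0)//.
    rewrite -[leRHS]invrK lef_pV2 ?posrE//.
    by apply: le_trans h; rewrite lerDr ltW.
  by apply: le_trans h; rewrite lerDl ltW.
rewrite !in_itv/= andbT => /andP[+ _]; apply: lt_le_trans.
by rewrite powR_gt0// invr_gt0.
Qed.

Lemma ge0_substitution_powR_gt0 (c : R) (G : R -> R) : 0 < c ->
  {in `]0, +oo[%classic, continuous G} -> {in `]0, +oo[%classic, forall y, 0 <= G y} ->
  (\int[mu]_(y in `]0%R, +oo[) (G y)%:E =
   \int[mu]_(x in `]0%R, +oo[) (G (x `^ c) * (c * x `^ (c - 1)))%:E)%E.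
Proof.
move=> c0 cG G0.
apply: (ge0_substitution_exhaustion (a := fun n => n.+1%:R^-1) (b := fun n => n.+1%:R)
  (f := fun x => c * x `^ (c - 1))) => //.
- by move=> n; rewrite (@le_trans _ _ 1)// ?invf_le1// ler1n.
- by move=> m n mn; rewrite lef_pV2 ?posrE// ler_nat ltnS.
- by move=> m n mn; rewrite ler_nat ltnS.
- rewrite (itv0y_bigcup_harmonic ltr01); apply: eq_bigcupr => n _.
  by rewrite !powRr1.
- exact: itv0y_bigcup_harmonic.
- move=> x y; rewrite !inE/= !in_itv/= !andbT => x0 y0; apply: ltr_powR => //; exact: x0.
- by move=> x; rewrite inE/= in_itv/= andbT => x0; exact: is_derive1_powR.
- move=> x; rewrite inE/= in_itv/= andbT => x0.
  by apply: cvgM; [exact: cvg_cst|exact: powR_continuous].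
- by move=> x; rewrite inE/= in_itv/= andbT => x0; rewrite mulr_ge0// ?powR_ge0// ltW.
Qed.

(** Inversion is decreasing on the positive half-line, whereas [ge0_substitution_exhaustion] wants
    an increasing map. So x -> - 1 / x is used on the negative half-line, and the sign is removed by
    reflecting the measure. *)
Lemma ge0_substitution_inv (G : R -> R) :
  {in `]0, +oo[%classic, continuous G} -> {in `]0, +oo[%classic, forall y, 0 <= G y} ->
  (\int[mu]_(y in `]0%R, +oo[) (G y)%:E =
   \int[mu]_(x in `]0%R, +oo[) (G x^-1 * x ^- 2)%:E)%E.
Proof.
move=> cG G0.
have key : (\int[mu]_(y in `]0%R, +oo[) (G y)%:E =
   \int[mu]_(x in `]-oo, 0%R[) (G (- x)^-1 * x ^- 2)%:E)%E.
  apply: (ge0_substitution_exhaustion (I := `]-oo, 0[%classic)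
    (a := fun n => - n.+1%:R) (b := fun n => - n.+1%:R^-1)
    (F := fun x => (- x)^-1) (f := fun x => x ^- 2)) => //.
  - by move=> n; rewrite lerN2 (@le_trans _ _ 1)// ?invf_le1// ler1n.
  - by move=> m n mn; rewrite lerN2 ler_nat ltnS.
  - by move=> m n mn; rewrite lerN2 lef_pV2 ?posrE// ler_nat ltnS.
  - apply/seteqP; split=> [x /=|x [n _] /=]; rewrite !in_itv/=.
      rewrite -oppr_gt0 => x0.
      have : (`]0, +oo[%classic : set R) (- x) by rewrite /= in_itv/= x0.
      rewrite (itv0y_bigcup_harmonic ltr01) => -[n _ /=]; rewrite !powRr1// in_itv/= => /andP[h1 h2].
      by exists n => //=; rewrite in_itv/= lerNl h2 lerNr h1.
    by move=> /andP[_ h]; apply: le_lt_trans h _; rewrite oppr_lt0 invr_gt0.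
  - rewrite (itv0y_bigcup_harmonic ltr01); apply: eq_bigcupr => n _.
    by rewrite !powRr1// !opprK invrK.
  - move=> x y; rewrite !inE/= !in_itv/= => x0 y0 xy.
    by rewrite ltf_pV2 ?posrE ?oppr_gt0// ltrN2.
  - move=> x; rewrite inE/= in_itv/= => x0.
    have nx : - x != 0 by rewrite oppr_eq0 lt_eqF.
    have dN : is_derive x (1 : R) (-%R : R -> R) (-1) := is_deriveN (is_derive_id x (1 : R)).
    have := is_deriveV nx dN.
    by rewrite /GRing.scale/= mulrN1 opprK sqrrN.
  - move=> x; rewrite inE/= in_itv/= => x0.
    by apply: cvgV; [rewrite expf_neq0// lt_eqF|exact: exprn_continuous].
  - by move=> x _; rewrite invr_ge0 sqr_ge0.
rewrite key -[RHS](_ : (\int[pushforward mu (-%R : measurableTypeR R -> measurableTypeR R)]_(x in `]0%R, +oo[) (G x^-1 * x ^- 2)%:E)%E = _); last first.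
  by apply: eq_measure_integral => A mA _; exact: lebesgue_measureN.
rewrite ge0_integral_pushforward//=.
- rewrite (_ : (-%R : measurableTypeR R -> measurableTypeR R) @^-1` `]0, +oo[%classic = `]-oo, 0[%classic).
    by apply: eq_integral => x _; rewrite sqrrN.
  by apply/seteqP; split => x /=; rewrite !in_itv/= andbT oppr_gt0.
- apply/measurable_EFinP; apply: open_continuous_measurable_fun; first exact: interval_open.
  move=> x; rewrite inE/= in_itv/= andbT => x0.
  apply: cvgM.
    apply: (@continuous_comp _ _ _ (@GRing.inv R) G); first by apply: inv_continuous; rewrite gt_eqF.
    by apply: cG; rewrite inE/= in_itv/= invr_gt0 x0.
  by apply: cvgV; [rewrite expf_neq0// gt_eqF|exact: exprn_continuous].
- move=> x; rewrite inE/= in_itv/= andbT => x0.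
  by rewrite lee_fin mulr_ge0 ?invr_ge0 ?sqr_ge0// G0// inE/= in_itv/= invr_gt0 x0.
Qed.

Lemma ge0_integral_even (f : R -> R) : measurable_fun [set: R] f -> (forall t, 0 <= f t) ->
  (\int[mu]_t (f `|t|)%:E = 2%:E * \int[mu]_(t in `]0%R, +oo[) (f t)%:E)%E.
Proof.
move=> mf f0.
have mfa : measurable_fun [set: R] (fun t : R => f `|t|).
  by apply: measurableT_comp => //; exact: normr_measurable.
have mN : measurable_fun [set: R] (fun t : R => f (- t)).
  by apply: measurableT_comp => //; exact: measurable_funN.
pose g t := (f t * \1_(`]0, +oo[%classic : set R) t)%:E.
have mg : measurable_fun [set: R] g.
  apply/measurable_EFinP; apply: measurable_funM => //.
have g0 t : (0 <= g t)%E by rewrite lee_fin mulr_ge0.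
have gE : (\int[mu]_(t in `]0%R, +oo[) (f t)%:E = \int[mu]_t g t)%E.
  rewrite integral_mkcond; apply: eq_integral => t _.
  by rewrite patchE /g indicE; case: ifP => _; rewrite ?mulr1 ?mulr0.
rewrite gE.
transitivity (\int[mu]_t (g t + g (-1 * t)%R))%E.
  (* At the origin both half-line indicators vanish while f 0 need not, so the point is removed from
     both integrals. *)
  rewrite -(integral_setD1 (r := 0)); last 2 first.
  - exact: measurableD.
  - by apply/measurable_EFinP; exact: measurable_funS mfa.
  rewrite -[RHS](integral_setD1 (r := 0)); last 2 first.
  - exact: measurableD.
  - apply: (@measurable_funS _ _ _ _ setT) => //; apply: emeasurable_funD => //.
    apply: measurableT_comp => //; exact: measurable_funM.
  apply: eq_integral => t; rewrite inE => -[_ /= /eqP t0].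
  rewrite /g -EFinD !indicE !mem_setE !in_itv/= !andbT mulN1r oppr_gt0.
  have [tp|tn|tz] := ltgtP t 0; last by rewrite tz eqxx in t0.
    by rewrite ltr0_norm// mulr0 mulr1 add0r.
  by rewrite gtr0_norm// mulr0 mulr1 addr0.
rewrite ge0_integralD//; last first.
  by apply: measurableT_comp => //; exact: measurable_funM.
rewrite (ge0_integral_scale (f := g)) ?oppr_eq0// normrN1 invr1 mul1e.
by rewrite -[in LHS](mul1e (integral _ _ _)) -ge0_muleDl.
Qed.

End power_calculus.

(** * The Gamma function *)

Section gamma_function.
Context {R : realType}.
Local Notation mu := (@lebesgue_measure R).
Implicit Types x : R.

(** Extension by 0 to the whole line, so that dilations and Tonelli apply without a domain of
    integration. *)
Definition gamma_fun (x t : R) : R := \1_(`]0, +oo[%classic : set R) t * (t `^ (x - 1) * expR (- t)).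

Lemma gamma_fun_ge0 x t : 0 <= gamma_fun x t.
Proof. by rewrite !mulr_ge0// ?powR_ge0 ?expR_ge0. Qed.

Lemma gamma_fun_gt0 x t : 0 < t -> gamma_fun x t = t `^ (x - 1) * expR (- t).
Proof.
by move=> t0; rewrite /gamma_fun indicE mem_set ?mul1r//= in_itv/= t0.
Qed.

Lemma gamma_fun_le0 x t : t <= 0 -> gamma_fun x t = 0.
Proof.
move=> t0; rewrite /gamma_fun indicE memNset ?mul0r//= in_itv/= andbT.
by apply/negP; rewrite -leNgt.
Qed.

Lemma measurable_gamma_fun x : measurable_fun [set: R] (gamma_fun x).
Proof.
apply: measurable_funM => //; apply: measurable_funM; first exact: measurable_powR.
by apply: measurableT_comp => //; exact: measurable_funN.
Qed.

Lemma integral_gamma_funE x :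
  (\int[mu]_(t in `]0%R, +oo[) (t `^ (x - 1) * expR (- t))%:E = \int[mu]_t (gamma_fun x t)%:E)%E.
Proof.
rewrite integral_mkcond; apply: eq_integral => t _.
rewrite patchE /gamma_fun indicE mem_setE in_itv/= andbT.
by case: (0 < t); rewrite ?mul1r ?mul0r.
Qed.

(** [Gamma] is a real-valued integral, hence the finite part of an extended one; convergence is what
    identifies the two. The integrand is dominated by a multiple of t^(x - 1) (1 + t)^(- (x + 1)),
    which has an explicit antiderivative. *)
Lemma integral_gamma_fun_lty x : 0 < x -> (\int[mu]_t (gamma_fun x t)%:E < +oo)%E.
Proof.
move=> x0; rewrite -integral_gamma_funE.
(* This is (t / (1 + t))^x / x, written so that the limit at infinity is immediate. *)
pose F (t : R) := x^-1 * (1 + t^-1) `^ (- x).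
pose f (t : R) := t `^ (x - 1) * (1 + t) `^ (- (x + 1)).
have f0 t : 0 <= f t by rewrite mulr_ge0 ?powR_ge0.
have cf (t : R) : 0 < t -> {for t, continuous f}.
  move=> t0; apply: cvgM; first exact: powR_continuous.
  by apply: powR_addl_continuous; rewrite addr_gt0.
have dF (t : R) : 0 < t -> is_derive t (1 : R) F (f t).
  move=> t0.
  have dV : is_derive t (1 : R) (fun t : R => 1 + t^-1) (- t ^- 2).
    have H := @is_deriveV R id t 1 1 (lt0r_neq0 t0) (is_derive_id t (1:R)).
    by apply: (is_derive_eq (is_deriveD (is_derive_cst (1 : R) t (1 : R)) H)); rewrite add0r /GRing.scale/= mulr1.
  have t1 : 0 < 1 + t^-1 by rewrite addr_gt0// invr_gt0.
  have := is_derive1Z x^-1 (is_derive1_comp (g := fun t => 1 + t^-1) (is_derive1_powR (- x) t1) dV).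
  move=> H; apply: (is_derive_eq H); rewrite /f.
  transitivity ((1 + t^-1) `^ (- x - 1) * t ^- 2); first by field; rewrite !gt_eqF.
  have -> : 1 + t^-1 = (1 + t) / t by field; rewrite gt_eqF.
  have t2 : 0 < 1 + t by rewrite addr_gt0.
  rewrite powRM ?invr_ge0 ?ltW// powRV// -[t ^+ 2]powR_mulrn ?ltW// !powRE//.
  by rewrite -!expRN -!expRD; congr expR; ring.
have H a : 0 < a -> (\int[mu]_(t in `[a, +oo[) (f t)%:E <= x^-1%:E)%E.
  move=> a0; have ta t : a <= t -> 0 < t by exact: lt_le_trans.
  have Fcvg : F t @[t --> +oo] --> x^-1.
    have -> : x^-1 = x^-1 * 1 `^ (- x) by rewrite powR1 mulr1.
    apply: cvgM; first exact: cvg_cst.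
    have H : {for (1 : R), continuous (fun y : R => y `^ (- x))} := powR_continuous ltr01.
    apply: (continuous_cvg _ H).
    rewrite -[X in _ --> X]addr0; apply: cvgD; first exact: cvg_cst.
    apply/cvgrPdist_le => e e0; near=> y.
    have y0 : 0 < y by near: y; exact: nbhs_pinfty_gt.
    rewrite sub0r normrN ger0_norm ?invr_ge0 ?(ltW y0)// invf_ple ?posrE//.
  rewrite (@ge0_continuous_FTC2y _ f F a x^-1) => //.
  - by rewrite -EFinD lee_fin gerBl mulr_ge0 ?powR_ge0// invr_ge0 ltW.
  - apply: continuous_in_subspaceT => t; rewrite inE/= in_itv/= andbT => /ta; exact: cf.
  - by move=> t /ltW/ta/dF[].
  - by apply: cvg_at_right_filter; apply: is_derive_continuous; exact: dF.
  - move=> t; rewrite in_itv/= andbT => /ltW/ta t0; rewrite derive1E; exact: (@derive_val _ _ _ _ _ _ _ (dF t t0)).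
have mf : measurable_fun (`]0, +oo[%classic : set R) (EFin \o f).
  apply/measurable_EFinP; apply: open_continuous_measurable_fun; first exact: interval_open.
  by move=> t; rewrite inE/= in_itv/= andbT; exact: cf.
have HI : (\int[mu]_(t in `]0%R, +oo[) (f t)%:E <= x^-1%:E)%E.
  have E : (`]0, +oo[%classic : set R) = \bigcup_n `[n.+1%:R^-1, +oo[%classic.
    apply/seteqP; split => [t|t [n _]] /=; rewrite !in_itv/= !andbT => ht.
      have : (`]0, +oo[%classic : set R) t by rewrite /= in_itv/= ht.
      rewrite (itv0y_bigcup_harmonic ltr01) => -[n _ /=]; rewrite !powRr1// in_itv/= => /andP[h1 h2].
      by exists n => //=; rewrite in_itv/= h1.
    by apply: lt_le_trans ht; rewrite invr_gt0.
  have sub n : (`[n.+1%:R^-1, +oo[%classic : set R) `<=` `]0, +oo[%classic.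
    by rewrite E => y yn; exists n.
  have cvgl : (\int[mu]_(t in `[(n.+1%:R^-1)%R, +oo[) (f t)%:E)%E @[n --> \oo] -->
      (\int[mu]_(t in `]0%R, +oo[) (f t)%:E)%E.
    rewrite E; apply: ge0_nondecreasing_set_cvg_integral => //.
    - move=> m n mn; apply/subsetPset => t /=; rewrite !in_itv/= !andbT; apply: le_trans.
      by rewrite lef_pV2 ?posrE// ler_nat ltnS.
    - by move=> n; apply: measurable_funS mf.
    - by move=> n t _; rewrite lee_fin.
  by apply: (cvge_to_le cvgl); apply: nearW => n; apply: H; rewrite invr_gt0.
(* From 1 + t <= (x + 1) (1 + t / (x + 1)) <= (x + 1) exp (t / (x + 1)), raised to the power x +
   1. *)
pose C := (x + 1) `^ (x + 1).
have x1 : 0 < x + 1 by rewrite addr_gt0.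
have bound (t : R) : 0 < t -> t `^ (x - 1) * expR (- t) <= C * f t.
  move=> t0; rewrite /f mulrCA ler_wpM2l ?powR_ge0//.
  have t1 : 0 < 1 + t by rewrite addr_gt0.
  rewrite powRN ler_pdivlMr ?powR_gt0// expRN mulrC ler_pdivrMr ?expR_gt0//.
  have -> : C * expR t = ((x + 1) * expR (t / (x + 1))) `^ (x + 1).
    rewrite powRM ?expR_ge0 ?(ltW x1)//; congr (_ * _).
    by rewrite powRE ?expR_gt0// expRK mulrCA divff ?mulr1// gt_eqF.
  apply: ge0_ler_powR; rewrite ?nnegrE ?(mulr_ge0 (ltW x1)) ?expR_ge0 ?(ltW x1) ?(ltW t1)//.
  apply: (@le_trans _ _ ((x + 1) * (1 + t / (x + 1)))).
    by rewrite mulrDr mulr1 mulrCA divff ?mulr1 ?gt_eqF// lerD2r lerDr ltW.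
  by rewrite ler_wpM2l ?(ltW x1)//; exact: expR_ge1Dx.
apply: (@le_lt_trans _ _ (C%:E * x^-1%:E)%E); last by rewrite -EFinM ltry.
apply: (@le_trans _ _ (C%:E * \int[mu]_(t in `]0%R, +oo[) (f t)%:E)%E); last first.
  by apply: lee_wpmul2l => //; rewrite lee_fin powR_ge0.
rewrite -ge0_integralZl//; last 2 first.
- by move=> t _; rewrite lee_fin.
- by rewrite lee_fin powR_ge0.
apply: ge0_le_integral => //.
- by move=> t _; rewrite lee_fin mulr_ge0 ?powR_ge0 ?expR_ge0.
- apply/measurable_EFinP; apply: measurable_funM; apply: measurable_funTS; first exact: measurable_powR.
  by apply: measurableT_comp => //; exact: measurable_funN.
- exact: measurable_funeM.
- by move=> t /=; rewrite in_itv/= andbT => /bound; rewrite -EFinM lee_fin.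
Unshelve. all: end_near. Qed.

Lemma integral_gamma_fun x : 0 < x -> (\int[mu]_t (gamma_fun x t)%:E = (Gamma x)%:E)%E.
Proof.
move=> x0; rewrite -integral_gamma_funE /Gamma /Rintegral fineK//.
rewrite ge0_fin_numE ?integral_gamma_funE ?integral_gamma_fun_lty//.
by apply: integral_ge0 => t _; rewrite lee_fin gamma_fun_ge0.
Qed.

Lemma Gamma_gt0 x : 0 < x -> 0 < Gamma x.
Proof.
move=> x0; rewrite -lte_fin -integral_gamma_fun//.
(* A lower bound of the integrand on [1, 2], where 0 <= ln t <= ln 2 and t <= 2, whatever the sign
   of x - 1. *)
pose c : R := expR (- `|x - 1| * ln 2 - 2).
have h t : t \in (`[1, 2]%classic : set R) -> (c%:E <= (gamma_fun x t)%:E)%E.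
  rewrite inE/= in_itv/= => /andP[t1 t2]; have t0 : 0 < t by apply: lt_le_trans t1.
  rewrite gamma_fun_gt0// powRE// -expRD lee_fin ler_expR lerD// ?lerN2//.
  apply: (@le_trans _ _ (- `|(x - 1) * ln t|)); last by rewrite lerNl ler_normr lexx orbT.
  rewrite normrM mulNr lerN2 ler_wpM2l// ger0_norm ?ln_ge0// ler_ln ?posrE//.
apply: (@lt_le_trans _ _ (\int[mu]_(t in `[1%R, 2%R]) c%:E)%E).
  rewrite integral_cst//= lebesgue_measure_itv/= lte_fin ltr1n -EFinB -EFinM lte_fin mulr_gt0 ?expR_gt0// subr_gt0 ltr1n.
apply: (@le_trans _ _ (\int[mu]_(t in `[1%R, 2%R]) (gamma_fun x t)%:E)%E).
  apply: ge0_le_integral => //.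
  - by move=> t _; rewrite lee_fin expR_ge0.
  - by apply/measurable_EFinP; apply: measurable_funTS; exact: measurable_gamma_fun.
  - by move=> t tI; apply: h; rewrite inE.
apply: ge0_subset_integral => //.
  by apply/measurable_EFinP; exact: measurable_gamma_fun.
by move=> t _; rewrite lee_fin gamma_fun_ge0.
Qed.

(* Integrate over [y] first after the scaling [x = y r] of the inner variable in the product
   of the two integrals. *)
Lemma Gamma_mul (a b : R) : 0 < a -> 0 < b ->
  (((Gamma a * Gamma b)%:E = (Gamma (a + b))%:E *
   \int[mu]_(r in `]0%R, +oo[) (r `^ (a - 1) * (1 + r) `^ (- (a + b)))%:E))%E.
Proof.
move=> a0 b0; have ab0 : 0 < a + b by rewrite addr_gt0.
have mg c : measurable_fun [set: R] (EFin \o gamma_fun c).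
  by apply/measurable_EFinP; exact: measurable_gamma_fun.
have g0 c t : (0 <= (gamma_fun c t)%:E)%E by rewrite lee_fin gamma_fun_ge0.
have mgy y : measurable_fun [set: R] (fun r : R => gamma_fun a (y * r)).
  apply: measurableT_comp; first exact: measurable_gamma_fun.
  exact: measurable_funM.
rewrite EFinM -(integral_gamma_fun b0) -ge0_integralZl//; last 2 first.
- exact: mg.
- by rewrite lee_fin ltW// Gamma_gt0.
(* The factor [p.1] is the Jacobian of the scaling; the absolute value only makes nonnegativity
   immediate. *)
pose f (p : R * R) : \bar R := `|gamma_fun b p.1 * p.1 * gamma_fun a (p.1 * p.2)|%:E.
transitivity (\int[mu]_y \int[mu]_r f (y, r))%E.
  apply: eq_integral => y _; rewrite /f/=.
  have [y0|y0] := ltP 0 y; last first.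
    rewrite gamma_fun_le0// mule0; apply/esym.
    by under eq_integral do rewrite !mul0r normr0; rewrite integral0.
  have gb : 0 <= gamma_fun b y * y by rewrite mulr_ge0 ?gamma_fun_ge0 ?ltW.
  under eq_integral do rewrite (ger0_norm (mulr_ge0 gb (gamma_fun_ge0 _ _))) EFinM.
  rewrite ge0_integralZl ?lee_fin//; last by apply/measurable_EFinP; exact: mgy.
  rewrite (ge0_integral_scale (f := EFin \o gamma_fun a) (lt0r_neq0 y0))//= integral_gamma_fun//.
  by rewrite gtr0_norm// -!EFinM mulrA mulfK ?gt_eqF// mulrC.
rewrite (@fubini_tonelli _ _ _ _ _ mu mu f); last 2 first.
- apply/measurable_EFinP; apply: measurableT_comp; first exact: normr_measurable.
  apply: measurable_funM; first apply: measurable_funM => //.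
    by apply: measurableT_comp => //; exact: measurable_gamma_fun.
  apply: measurableT_comp; first exact: measurable_gamma_fun.
  exact: measurable_funM.
- by move=> p; rewrite lee_fin.
rewrite muleC -ge0_integralZr//; last 3 first.
- apply/measurable_EFinP; apply: open_continuous_measurable_fun; first exact: interval_open.
  move=> t; rewrite inE/= in_itv/= andbT => t0.
  apply: cvgM; first exact: powR_continuous.
  by apply: powR_addl_continuous; rewrite addr_gt0.
- by move=> r _; rewrite lee_fin mulr_ge0 ?powR_ge0.
- by rewrite lee_fin ltW// Gamma_gt0.
rewrite [RHS]integral_mkcond; apply: eq_integral => r _.
rewrite patchE mem_setE in_itv/= andbT.
case: ifPn => [r0|]; last first.
  rewrite -leNgt => r0; rewrite -[RHS](integral0 mu setT); apply: eq_integral => y _.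
  rewrite /f/=; have [y0|y0] := ltP 0 y; last by rewrite gamma_fun_le0// !mul0r normr0.
  by rewrite [X in _ * X]gamma_fun_le0 ?mulr0 ?normr0// pmulr_rle0.
have r1 : 0 < 1 + r by rewrite addr_gt0.
transitivity (\int[mu]_y ((r `^ (a - 1) * (1 + r) `^ (- (a + b) + 1))%:E *
    (gamma_fun (a + b) ((1 + r) * y))%:E))%E.
  apply: eq_integral => y _; rewrite /f/=.
  have [y0|y0] := ltP 0 y; last first.
    by rewrite (gamma_fun_le0 b y0) !mul0r normr0 (@gamma_fun_le0 (a + b)) ?mule0 ?pmulr_rle0.
  rewrite ger0_norm ?(mulr_ge0 (mulr_ge0 _ (ltW y0)))  ?gamma_fun_ge0// -EFinM; congr EFin.
  rewrite !gamma_fun_gt0 ?mulr_gt0// (mulrAC _ _ y) [y `^ (b - 1) * y]mulrC mulr_powRB1 ?(ltW y0)//.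
  rewrite !powRE ?mulr_gt0// !lnM ?posrE//.
  by rewrite -!expRD; congr expR; ring.
rewrite ge0_integralZl//; last 2 first.
- apply/measurable_EFinP; apply: measurableT_comp; first exact: measurable_gamma_fun.
  exact: measurable_funM.
- by rewrite lee_fin mulr_ge0 ?powR_ge0.
rewrite (ge0_integral_scale (f := EFin \o gamma_fun (a + b)) (lt0r_neq0 r1))//= integral_gamma_fun//.
rewrite gtr0_norm// -!EFinM; congr EFin.
have -> : (1 + r) `^ (- (a + b) + 1) = (1 + r) `^ (- (a + b)) * (1 + r).
  by rewrite powRD ?powRr1 ?(ltW r1)// (gt_eqF r1) implybT.
field.
by rewrite gt_eqF.
Qed.

Lemma Gamma1 : Gamma (1 : R) = 1.
Proof.
apply: EFin_inj; rewrite -integral_gamma_fun// -integral_gamma_funE.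
rewrite integral_itv_obnd_cbnd; last first.
  apply/measurable_EFinP; apply: measurable_funTS; apply: measurable_funM; first exact: measurable_powR.
  by apply: measurableT_comp => //; exact: measurable_funN.
under eq_integral do rewrite subrr powRr0 mul1r.
have dE (t : R) : is_derive t (1 : R) (fun t => - expR (- t)) (expR (- t)).
  have dN : is_derive t (1 : R) (-%R : R -> R) (-1) := is_deriveN (is_derive_id t (1 : R)).
  have := is_derive1_comp (is_derive_expR (- t)) dN.
  by move=> H; have := is_deriveN H; rewrite mulrN1 opprK.
rewrite (@ge0_continuous_FTC2y _ (fun t => expR (- t)) (fun t => - expR (- t)) 0 0) => //.
- by rewrite oppr0 expR0 -EFinB sub0r opprK.
- apply: continuous_subspaceT => t.
  apply: (@continuous_comp _ _ _ (-%R) (@expR R)); [exact: opp_continuous|exact: continuous_expR].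
- by rewrite -[X in _ --> X]oppr0; apply: cvgN; exact: cvgr_expR.
- by apply: cvg_at_right_filter; exact: is_derive_continuous (dE 0).
- by move=> t _; rewrite derive1E; exact: (@derive_val _ _ _ _ _ _ _ (dE t)).
Qed.

(** Evenness reduces the integral to the half-line, where the substitution of t^2 turns the
    exponential into the Gaussian. *)
Lemma Gamma_square (b : R) : -1 < b ->
  (\int[mu]_t (`|t| `^ b * gauss_fun t)%:E = (Gamma ((b + 1) / 2))%:E)%E.
Proof.
move=> b0; have b1 : 0 < (b + 1) / 2 by rewrite divr_gt0// -ltrBlDr sub0r.
have mgf : measurable_fun [set: R] (fun t : R => t `^ b * gauss_fun t).
  by apply: measurable_funM; [exact: measurable_powR|exact: measurable_gauss_fun].
transitivity (\int[mu]_t ((fun t => t `^ b * gauss_fun t) `|t|)%:E)%E.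
  by apply: eq_integral => t _; rewrite /gauss_fun real_normK ?num_real.
rewrite (ge0_integral_even mgf); last by move=> t; rewrite mulr_ge0 ?powR_ge0 ?gauss_fun_ge0.
rewrite -integral_gamma_fun// -integral_gamma_funE.
rewrite [RHS](@ge0_substitution_powR_gt0 _ 2)//; last 2 first.
- move=> t; rewrite inE/= in_itv/= andbT => t0.
  apply: cvgM; first exact: powR_continuous.
  apply: (@continuous_comp _ _ _ (-%R) (@expR R)); [exact: opp_continuous|exact: continuous_expR].
- by move=> t _; rewrite mulr_ge0 ?powR_ge0 ?expR_ge0.
rewrite -ge0_integralZl//; last 2 first.
- by apply/measurable_EFinP; exact: measurable_funTS.
- by move=> t _; rewrite lee_fin mulr_ge0 ?powR_ge0 ?gauss_fun_ge0.
apply: eq_integral => t; rewrite inE/= in_itv/= andbT => t0.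
rewrite -EFinM; congr EFin; rewrite /gauss_fun powR_mulrn ?ltW// -!(mulrCA 2).
rewrite -(powR_mulrn _ (ltW t0)); congr (2 * _).
rewrite mulrAC; congr (_ * _).
by rewrite -powRrM -powRD ?(gt_eqF t0) ?implybT//; apply: (congr1 (powR t)); field.
Qed.

Lemma Gamma_half : Gamma (2^-1 : R) = Num.sqrt pi.
Proof.
apply: EFin_inj; rewrite -integralT_gauss.
have := @Gamma_square 0; rewrite oppr_lt0 ltr01 add0r div1r => <- //.
by apply: eq_integral => t _; rewrite powRr0 mul1r.
Qed.

(** The case a = 1, b = 1 / 2 of [Gamma_mul]: the remaining integral, of (1 + t)^(- 3 / 2), equals
    2. *)
Lemma Gamma_three_halves : Gamma (3 / 2 : R) = Num.sqrt pi / 2.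
Proof.
have := @Gamma_mul 1 2^-1; rewrite Gamma1 mul1r Gamma_half invr_gt0 ltr0n ltr01 => /(_ isT isT).
have -> : (1 + 2^-1 : R) = 3 / 2 by field.
have cf (t : R) : 0 <= t -> {for t, continuous (fun t : R => (1 + t) `^ (- (3 / 2)))}.
  by move=> t0; apply: powR_addl_continuous; rewrite (lt_le_trans ltr01)// lerDl.
under eq_integral do rewrite subrr powRr0 mul1r.
rewrite integral_itv_obnd_cbnd; last first.
  apply/measurable_EFinP; apply: measurable_funTS.
  apply: (measurableT_comp (measurable_powR _)); exact: measurable_funD.
have dF (t : R) : 0 <= t -> is_derive t (1 : R) (fun t => - 2 * (1 + t) `^ (- 2^-1)) ((1 + t) `^ (- (3 / 2))).
  move=> t0.
  have t1 : 0 < 1 + t by rewrite (lt_le_trans ltr01)// lerDl.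
  have dV : is_derive t (1 : R) (fun t : R => 1 + t) 1.
    by apply: (is_derive_eq (is_deriveD (is_derive_cst (1 : R) t (1 : R)) (is_derive_id t (1 : R)))); rewrite add0r.
  have := is_derive1Z (- 2) (is_derive1_comp (g := fun t => 1 + t) (is_derive1_powR (- 2^-1) t1) dV).
  move=> H; apply: (is_derive_eq H); rewrite mulr1 mulrA mulrNN divff// mul1r.
  by congr (_ `^ _); field.
rewrite (@ge0_continuous_FTC2y _ (fun t => (1 + t) `^ (- (3 / 2))) (fun t => - 2 * (1 + t) `^ (- 2^-1)) 0 0) => //.
- rewrite addr0 powR1 mulr1 sub0e -EFinN opprK -EFinM => -[->].
  by rewrite mulfK.
- by move=> t _; exact: powR_ge0.
- apply: continuous_in_subspaceT => t; rewrite inE/= in_itv/= andbT; exact: cf.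
- rewrite -[X in _ --> X](mulr0 (-2)); apply: cvgM; first exact: cvg_cst.
  apply/cvgrPdist_le => e e0; near=> x.
  have x0 : 0 < x by near: x; exact: nbhs_pinfty_gt.
  rewrite sub0r normrN ger0_norm ?powR_ge0//.
  have -> : e = (e ^- 2) `^ (- 2^-1).
    by rewrite powRN -powRV ?invr_gt0 ?exprn_gt0// invrK powR12_sqrt ?sqr_ge0// sqrtr_sqr gtr0_norm.
  rewrite !powRN lef_pV2 ?posrE ?powR_gt0 ?invr_gt0 ?exprn_gt0 ?addr_gt0//.
  apply: ge0_ler_powR; rewrite ?nnegrE ?invr_ge0 ?sqr_ge0 ?addr_ge0 ?(ltW x0)//.
  apply: (@le_trans _ _ x); last by rewrite lerDr.
  by near: x; apply: nbhs_pinfty_ge; rewrite num_real.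
- by move=> t /ltW/dF[].
- by apply: cvg_at_right_filter; exact: (is_derive_continuous (dF 0 (lexx 0))).
- move=> t; rewrite in_itv/= andbT => /ltW t0; rewrite derive1E; exact: (@derive_val _ _ _ _ _ _ _ (dF t t0)).
Unshelve. all: end_near. Qed.

End gamma_function.

(** * One-dimensional kernels on a chord *)

Section chord_integrals.
Context {R : realType}.
Local Notation mu := (@lebesgue_measure R).

Lemma normr_powR_continuous (c : R) : 0 < c -> continuous (fun x : R => `|x| `^ c).
Proof.
move=> c0 x; have [->|x0] := eqVneq x 0.
  rewrite /continuous_at normr0 powR0 ?gt_eqF//.
  apply/cvgrPdist_le => e e0; near=> y.
  rewrite sub0r normrN ger0_norm ?powR_ge0//.
  have -> : e = (e `^ c^-1) `^ c by rewrite -powRrM mulVf ?gt_eqF// powRr1 ?(ltW e0).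
  apply: ge0_ler_powR; rewrite ?nnegrE ?powR_ge0 ?(ltW c0)//.
  rewrite -normrN -sub0r; near: y; apply: cvgr_dist_le; last by rewrite powR_gt0.
  exact: cvg_id.
apply: (@continuous_comp _ _ _ (fun x : R => `|x|) (fun t : R => t `^ c)).
  exact: norm_continuous.
by apply: powR_continuous; rewrite normr_gt0.
Unshelve. all: end_near. Qed.

Lemma integral_powR_itv (al a b : R) : 0 < al -> 0 < a -> a < b ->
  (\int[mu]_(t in `]a, b[) (t `^ (- (1 + al)))%:E = ((a `^ (- al) - b `^ (- al)) / al)%:E)%E.
Proof.
move=> al0 a0 ab.
have ta t : a <= t -> 0 < t by exact: lt_le_trans.
have dF (t : R) : 0 < t ->
    is_derive t (1 : R) (fun t => - al^-1 * t `^ (- al)) (t `^ (- (1 + al))).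
  move=> t0; have H := is_derive1Z (- al^-1) (is_derive1_powR (- al) t0).
  apply: (is_derive_eq H).
  transitivity (t `^ (- al - 1)); first by field; rewrite gt_eqF.
  by congr (_ `^ _); ring.
rewrite -(integral_itv_bndoo true false); last first.
  by apply/measurable_EFinP; apply: measurable_funTS; exact: measurable_powR.
rewrite (@continuous_FTC2 _ _ (fun t => - al^-1 * t `^ (- al)))//.
- by rewrite -EFinB; congr EFin; field; rewrite gt_eqF.
- apply: continuous_in_subspaceT => t; rewrite inE/= in_itv/= => /andP[/ta t0 _].
  exact: powR_continuous.
- split.
  + by move=> t; rewrite in_itv/= => /andP[/ltW/ta t0 _]; have [] := dF t t0.
  + by apply: cvg_at_right_filter; exact: (is_derive_continuous (dF a a0)).
  + by apply: cvg_at_left_filter; exact: (is_derive_continuous (dF b (lt_trans a0 ab))).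
- move=> t; rewrite in_itv/= => /andP[/ltW/ta t0 _].
  by rewrite derive1E; exact: (@derive_val _ _ _ _ _ _ _ (dF t t0)).
Qed.

(** The kernel times the ground state ratio on the chord (-1, 1) seen from its midpoint, that is for
    P = Q = 1. The absolute value keeps it continuous across the end point 1. *)
Definition chord_kernel (al z : R) := z `^ (- (1 + al)) * `|1 - z ^+ 2| `^ ((al - 1) / 2).

Lemma one_subr_sqr_continuous (c : R) : 0 < c -> continuous (fun z : R => `|1 - z ^+ 2| `^ c).
Proof.
move=> c0 z.
apply: (@continuous_comp _ _ _ (fun z : R => 1 - z ^+ 2) (fun x : R => `|x| `^ c)).
  by apply: cvgB; [exact: cvg_cst|exact: exprn_continuous].
exact: normr_powR_continuous.
Qed.

Lemma chord_kernel_continuous (al z : R) : 1 < al -> 0 < z ->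
  {for z, continuous (chord_kernel al)}.
Proof.
move=> al1 z0; apply: cvgM; first exact: powR_continuous.
by apply: one_subr_sqr_continuous; rewrite divr_gt0// subr_gt0.
Qed.

Lemma chord_kernel_ge0 (al z : R) : 0 <= chord_kernel al z.
Proof. by rewrite mulr_ge0 ?powR_ge0. Qed.

(* The Moebius map [z |-> z / (m - c z)], with [m = (P + Q) / 2] and [c = (Q - P) / 2],
   sends [-1, 0, 1] to [-1 / Q, 0, 1 / P]. *)
Lemma integral_chord_ground_state (al P Q e : R) : 1 < al -> 0 < P -> 0 < Q -> 0 < e < 1 ->
  let m := (P + Q) / 2 in let c := (Q - P) / 2 in
  (\int[mu]_(t in `](e / (m - c * e))%R, P^-1%R[)
     (t `^ (- (1 + al)) * `|(1 - P * t) * (1 + Q * t)| `^ ((al - 1) / 2))%:E =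
   (m `^ al)%:E * \int[mu]_(z in `[e, 1%R]) (chord_kernel al z)%:E)%E.
Proof.
move=> al1 P0 Q0 /andP[e0 e1] m c.
have m0 : 0 < m by rewrite divr_gt0// addr_gt0.
have al10 : 0 < (al - 1) / 2 by rewrite divr_gt0// subr_gt0.
(* Here m - c z = (P (1 + z) + Q (1 - z)) / 2. *)
have D z : 0 <= z -> z <= 1 -> 0 < m - c * z.
  by move=> z0 z1; rewrite /m /c; nra.
have De := D e (ltW e0) (ltW e1).
pose F z := z / (m - c * z).
have F1 : F 1 = P^-1.
  by rewrite /F mulr1 /m /c div1r; congr (_^-1); field.
have Fe : F e = e / (m - c * e) by [].
have Finc x y : 0 <= x -> y <= 1 -> x < y -> F x < F y.
  move=> x0 y1 xy; have x1 : x <= 1 by rewrite (le_trans (ltW xy)).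
  have y0 : 0 <= y by rewrite (le_trans x0 (ltW xy)).
  rewrite /F ltr_pdivrMr ?D// mulrAC ltr_pdivlMr ?D//.
  rewrite -subr_gt0 (_ : _ - _ = (y - x) * m); last by ring.
  by rewrite mulr_gt0// subr_gt0.
pose G (t : R) := t `^ (- (1 + al)) * `|(1 - P * t) * (1 + Q * t)| `^ ((al - 1) / 2).
have cG (t : R) : 0 < t -> {for t, continuous G}.
  move=> t0; apply: cvgM; first exact: powR_continuous.
  apply: (@continuous_comp _ _ _ (fun t : R => (1 - P * t) * (1 + Q * t)) (fun x : R => `|x| `^ ((al - 1) / 2))).
    apply: cvgM.
      by apply: cvgB; [exact: cvg_cst|apply: cvgM; [exact: cvg_cst|exact: cvg_id]].
    by apply: cvgD; [exact: cvg_cst|apply: cvgM; [exact: cvg_cst|exact: cvg_id]].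
  exact: normr_powR_continuous.
have mG : measurable_fun [set: R] G.
  apply: measurable_funM; first exact: measurable_powR.
  apply: (measurableT_comp (measurable_powR _)); apply: measurableT_comp; first exact: normr_measurable.
  apply: measurable_funM.
    by apply: measurable_funB => //; exact: measurable_funM.
  by apply: measurable_funD => //; exact: measurable_funM.
pose f z := m * (m - c * z) ^- 2.
have dF (z : R) : 0 <= z -> z <= 1 -> is_derive z (1 : R) F (f z).
  move=> z0 z1; have Dz := D z z0 z1.
  have dc : is_derive z (1 : R) (fun z => c * z) (c * 1) := is_derive1Z c (is_derive_id z (1 : R)).
  have d1 : is_derive z (1 : R) (fun z => m - c * z) (- c).
    by apply: (is_derive_eq (is_deriveB (is_derive_cst (m : R) z (1 : R)) dc)); rewrite mulr1 sub0r.
  have d2 := @is_deriveV _ (fun z => m - c * z) z _ _ (lt0r_neq0 Dz) d1.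
  apply: (is_derive_eq (is_deriveM (is_derive_id z (1 : R)) d2)).
  by rewrite /f /GRing.scale/=; field; rewrite gt_eqF.
have cf (z : R) : 0 <= z -> z <= 1 -> {for z, continuous f}.
  move=> z0 z1; have Dz := D z z0 z1.
  apply: cvgM; first exact: cvg_cst.
  apply: cvgV; first by rewrite expf_neq0// gt_eqF.
  apply: (@continuous_comp _ _ _ (fun z : R => m - c * z) (fun y : R => y ^+ 2)); last exact: exprn_continuous.
  by apply: cvgB; [exact: cvg_cst|apply: cvgM; [exact: cvg_cst|exact: cvg_id]].
have dE (z : R) : 0 <= z -> z <= 1 -> (F^`())%classic z = f z.
  by move=> z0 z1; rewrite derive1E; exact: (@derive_val _ _ _ _ _ _ _ (dF z z0 z1)).
rewrite -(integral_itv_bndoo true false); last by apply/measurable_EFinP; apply: measurable_funTS.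
rewrite -Fe -F1.
rewrite (@integration_by_substitution_increasing _ F G)//; last 6 first.
- move=> x y; rewrite !in_itv/= => /andP[ex _] /andP[_ y1]; apply: Finc => //.
  by rewrite (le_trans (ltW e0)).
- move=> z; rewrite in_itv/= => /andP[ez z1].
  have z0 : 0 < z by rewrite (lt_trans e0).
  rewrite /continuous_at dE ?(ltW z0) ?(ltW z1)//.
  apply: cvg_trans (cf z (ltW z0) (ltW z1)); apply: near_eq_cvg.
  near=> y; rewrite dE//.
    by apply/ltW; near: y; exact: lt_nbhsr.
  by apply/ltW; near: y; exact: lt_nbhsl.
- apply/cvg_ex; exists (f e).
  apply: cvg_trans (cvg_at_right_filter (cf e (ltW e0) (ltW e1))); apply: near_eq_cvg.
  near=> y; rewrite dE//.
    by rewrite (le_trans (ltW e0))//.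
  by apply/ltW; near: y; exact: nbhs_right_lt.
- apply/cvg_ex; exists (f 1).
  apply: cvg_trans (cvg_at_left_filter (cf 1 ler01 (lexx 1))); apply: near_eq_cvg.
  near=> y; rewrite dE//.
  by apply/ltW; near: y; exact: nbhs_left_gt.
- split.
  + move=> z; rewrite in_itv/= => /andP[ez z1].
    by have [] := dF z (ltW (lt_trans e0 ez)) (ltW z1).
  + by apply: cvg_at_right_filter; exact: (is_derive_continuous (dF e (ltW e0) (ltW e1))).
  + by apply: cvg_at_left_filter; exact: (is_derive_continuous (dF 1 ler01 (lexx 1))).
- apply: continuous_in_subspaceT => t; rewrite inE/= in_itv/= => /andP[Ft _]; apply: cG.
  by apply: lt_le_trans Ft; rewrite divr_gt0.
rewrite -ge0_integralZl//; last 3 first.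
- apply/measurable_EFinP; apply: measurable_funTS; apply: measurable_funM; first exact: measurable_powR.
  apply: continuous_measurable_fun; exact: one_subr_sqr_continuous.
- by move=> z _; rewrite lee_fin chord_kernel_ge0.
- by rewrite lee_fin powR_ge0.
apply: eq_integral => z; rewrite inE/= in_itv/= => /andP[ez z1].
have z0 : 0 < z by rewrite (lt_le_trans e0).
have Dz := D z (ltW z0) z1.
rewrite -EFinM; congr EFin.
rewrite !fctE dE ?(ltW z0)// /G /f /chord_kernel.
have -> : (1 - P * F z) * (1 + Q * F z) = (m / (m - c * z)) ^+ 2 * (1 - z ^+ 2).
  rewrite /F; have e1' : P = m - c by rewrite /m /c; field.
  have e2' : Q = m + c by rewrite /m /c; field.
  by rewrite e1' e2'; field; rewrite gt_eqF.
rewrite normrM [`|_ ^+ 2|]ger0_norm ?sqr_ge0// (@powRM _ ((m / (m - c * z)) ^+ 2)) ?sqr_ge0//.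
(* The powers of m - c z cancel: 1 + al from the kernel, - (al - 1) from the ground state and - 2
   from the Jacobian. This is what singles out the exponent (al - 1) / 2. *)
set w := `|1 - z ^+ 2| `^ _.
transitivity ((F z `^ (- (1 + al)) * ((m / (m - c * z)) ^+ 2) `^ ((al - 1) / 2) *
    (m `^ 1 * (m - c * z) ^- 2)) * w); first by rewrite (powRr1 (ltW m0)); ring.
  rewrite [RHS]mulrA; congr (_ * _).
  rewrite -powR_invn ?(ltW Dz)//.
  clearbody m; have md0 : 0 < m / (m - c * z) by rewrite divr_gt0.
  rewrite -(powR_mulrn 2 (ltW md0)) -powRrM /F !powRE ?divr_gt0//.
  rewrite !lnM ?posrE ?invr_gt0// !lnV ?posrE// -!expRD; congr expR; by field.
exact: ltW.
Unshelve. all: end_near. Qed.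


(** What integration by parts leaves of [chord_kernel]: z^2 times that kernel, integrable at 0
    because al < 2. *)
Definition chord_remainder (al z : R) := z `^ (1 - al) * `|1 - z ^+ 2| `^ ((al - 1) / 2).

Lemma chord_remainder_ge0 (al z : R) : 0 <= chord_remainder al z.
Proof. by rewrite mulr_ge0 ?powR_ge0. Qed.

Lemma chord_remainder_continuous (al z : R) : 1 < al -> 0 < z ->
  {for z, continuous (chord_remainder al)}.
Proof.
move=> al1 z0; apply: cvgM; first exact: powR_continuous.
by apply: one_subr_sqr_continuous; rewrite divr_gt0// subr_gt0.
Qed.

Lemma measurable_chord_kernel (al : R) : 1 < al -> measurable_fun [set: R] (chord_kernel al).
Proof.
move=> al1; apply: measurable_funM; first exact: measurable_powR.
by apply: continuous_measurable_fun; apply: one_subr_sqr_continuous; rewrite divr_gt0// subr_gt0.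
Qed.

Lemma measurable_chord_remainder (al : R) : 1 < al -> measurable_fun [set: R] (chord_remainder al).
Proof.
move=> al1; apply: measurable_funM; first exact: measurable_powR.
by apply: continuous_measurable_fun; apply: one_subr_sqr_continuous; rewrite divr_gt0// subr_gt0.
Qed.

(* [- z^(- al) (1 - z^2)^((al + 1) / 2)] is an antiderivative of
   [al * chord_kernel al + chord_remainder al]. *)
Lemma integral_chord_kernel (al e : R) : 1 < al -> 0 < e < 1 ->
  (al%:E * \int[mu]_(z in `[e, 1%R]) (chord_kernel al z)%:E +
   \int[mu]_(z in `[e, 1%R]) (chord_remainder al z)%:E =
   (e `^ (- al) * (1 - e ^+ 2) `^ ((al + 1) / 2))%:E)%E.
Proof.
move=> al1 /andP[e0 e1].
have al10 : 0 < (al - 1) / 2 by rewrite divr_gt0// subr_gt0.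
have al11 : 0 < (al + 1) / 2 by rewrite divr_gt0// addr_gt0// (lt_trans ltr01).
have al0 : 0 <= al by rewrite (le_trans ler01) ?ltW.
rewrite -ge0_integralZl//; last 2 first.
- by apply/measurable_EFinP; apply: measurable_funTS; exact: measurable_chord_kernel.
- by move=> z _; rewrite lee_fin chord_kernel_ge0.
rewrite -ge0_integralD//; last 4 first.
- by move=> z _; rewrite mule_ge0 ?lee_fin ?chord_kernel_ge0.
- apply: measurable_funeM.
  by apply/measurable_EFinP; apply: measurable_funTS; exact: measurable_chord_kernel.
- by move=> z _; rewrite lee_fin chord_remainder_ge0.
- by apply/measurable_EFinP; apply: measurable_funTS; exact: measurable_chord_remainder.
under eq_integral do rewrite -EFinM -EFinD.
(* [F] is continuous at the end point 1, [F'] is the form to which the chain rule applies; they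
   agree on ]0, 1[. *)
pose F z := - (z `^ (- al) * `|1 - z ^+ 2| `^ ((al + 1) / 2)).
pose F' z := - (z `^ (- al) * (1 - z ^+ 2) `^ ((al + 1) / 2)).
pose f z := al * chord_kernel al z + chord_remainder al z.
have dF' (z : R) : 0 < z -> z < 1 -> is_derive z (1 : R) F' (f z).
  move=> z0 z1; have Dz : 0 < 1 - z ^+ 2 by nra.
  have d1 : is_derive z (1 : R) (fun z => 1 - z ^+ 2) (- (2 * z)).
    have d2 : is_derive z (1 : R) (fun z => z ^+ 2) (2 * z).
      by apply: (is_derive_eq (is_deriveM (is_derive_id z (1 : R)) (is_derive_id z (1 : R)))); rewrite /GRing.scale/=; ring.
    by apply: (is_derive_eq (is_deriveB (is_derive_cst (1 : R) z (1 : R)) d2)); rewrite sub0r.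
  have d3 := is_derive1_comp (g := fun z => 1 - z ^+ 2) (is_derive1_powR ((al + 1) / 2) Dz) d1.
  have d4 := is_deriveN (is_deriveM (is_derive1_powR (- al) z0) d3).
  apply: (is_derive_eq d4).
  rewrite /f /chord_kernel /chord_remainder /GRing.scale/= ger0_norm ?(ltW Dz)//.
  have -> : (al + 1) / 2 - 1 = (al - 1) / 2 by field.
  have -> : (al + 1) / 2 = (al - 1) / 2 + 1 by field.
  have -> : - al - 1 = - (1 + al) by ring.
  have -> : (1 - z ^+ 2) `^ ((al - 1) / 2 + 1) = (1 - z ^+ 2) `^ ((al - 1) / 2) * (1 - z ^+ 2).
    by rewrite powRD ?powRr1 ?(ltW Dz)// (gt_eqF Dz) implybT.
  have -> : z `^ (1 - al) = z `^ (- (1 + al)) * z ^+ 2.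
    rewrite -powR_mulrn ?(ltW z0)// -powRD ?(gt_eqF z0) ?implybT//; congr (_ `^ _).
    by ring.
  have -> : z `^ (- al) = z `^ (- (1 + al)) * z.
    rewrite -[X in _ * X](powRr1 (ltW z0)) -powRD ?(gt_eqF z0) ?implybT//; congr (_ `^ _).
    by ring.
  by field.
have nearF (z : R) : 0 < z -> z < 1 -> \forall y \near z, F' y = F y.
  move=> z0 z1; near=> y.
  have y0 : 0 < y by near: y; exact: lt_nbhsr.
  have y1 : y < 1 by near: y; exact: lt_nbhsl.
  by rewrite /F' /F ger0_norm//; nra.
have dF (z : R) : 0 < z -> z < 1 -> is_derive z (1 : R) F (f z).
  move=> z0 z1; exact: (near_eq_is_derive (nearF z z0 z1) (dF' z z0 z1)).
have cF (z : R) : 0 < z -> {for z, continuous F}.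
  move=> z0; apply: cvgN; apply: cvgM; first exact: powR_continuous.
  exact: one_subr_sqr_continuous.
rewrite (@continuous_FTC2 _ f F)//.
- rewrite /F expr1n subrr normr0 powR0 ?gt_eqF// mulr0 oppr0 sub0e -EFinN opprK.
  by rewrite ger0_norm//; nra.
- apply: continuous_in_subspaceT => z; rewrite inE/= in_itv/= => /andP[ez _].
  have z0 := lt_le_trans e0 ez.
  apply: cvgD; last exact: chord_remainder_continuous.
  by apply: cvgM; [exact: cvg_cst|exact: chord_kernel_continuous].
- split.
  + move=> z; rewrite in_itv/= => /andP[ez z1].
    by have [] := dF z (lt_trans e0 ez) z1.
  + by apply: cvg_at_right_filter; exact: cF.
  + by apply: cvg_at_left_filter; exact: cF.
- move=> z; rewrite in_itv/= => /andP[ez z1].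
  by rewrite derive1E; exact: (@derive_val _ _ _ _ _ _ _ (dF z (lt_trans e0 ez) z1)).
Unshelve. all: end_near. Qed.

(** With r = z^2 / (1 - z^2) this is the beta integral of [Gamma_mul] for the parameters 1 - al / 2
    and (1 + al) / 2, whose sum is 3 / 2. *)
Lemma integral_chord_remainder (al : R) : 1 < al -> al < 2 ->
  (2%:E * \int[mu]_(z in `]0%R, 1%R[) (chord_remainder al z)%:E =
   (Gamma (1 - al / 2) * Gamma ((1 + al) / 2) / Gamma (3 / 2))%:E)%E.
Proof.
move=> al1 al2.
have a0 : 0 < 1 - al / 2 by rewrite subr_gt0 ltr_pdivrMr// mul1r.
have b0 : 0 < (1 + al) / 2 by rewrite divr_gt0// addr_gt0// (lt_trans ltr01).
have G32 : Gamma (3 / 2 : R) != 0 by rewrite gt_eqF// Gamma_gt0.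
have := Gamma_mul a0 b0.
have -> : 1 - al / 2 + (1 + al) / 2 = 3 / 2 by field.
set J := integral _ _ _ => H.
have -> : (2%:E * \int[mu]_(z in `]0%R, 1%R[) (chord_remainder al z)%:E)%E = J; last first.
  rewrite mulrC EFinM H muleA -EFinM mulVf// mul1e//.
have N0 n : 0 < n.+2%:R :> R by [].
have Ni n : 0 < (n.+2%:R^-1 : R) < 1 by rewrite invr_gt0 N0 invf_lt1// ltr1n.
have s1 n : Num.sqrt (n.+2%:R^-1) ^+ 2 = n.+2%:R^-1 :> R by rewrite sqr_sqrtr// ltW//; case/andP: (Ni n).
have s2 n : Num.sqrt (1 - n.+2%:R^-1) ^+ 2 = 1 - n.+2%:R^-1 :> R.
  by rewrite sqr_sqrtr// subr_ge0 ltW//; case/andP: (Ni n).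
(* The end points are chosen so that their images are 1 / (n + 1) and n + 1, the exhaustion of
   [itv0y_bigcup_harmonic]. *)
rewrite /J [RHS](ge0_substitution_exhaustion (I := `]0, 1[%classic)
  (a := fun n => Num.sqrt (n.+2%:R^-1)) (b := fun n => Num.sqrt (1 - n.+2%:R^-1))
  (F := fun z => z ^+ 2 / (1 - z ^+ 2)) (f := fun z => 2 * z * (1 - z ^+ 2) ^- 2)) => //.
- rewrite -ge0_integralZl//; last 2 first.
  + by apply/measurable_EFinP; apply: measurable_funTS; exact: measurable_chord_remainder.
  + by move=> z _; rewrite lee_fin chord_remainder_ge0.
  apply: eq_integral => z; rewrite inE/= in_itv/= => /andP[z0 z1].
  have Dz : 0 < 1 - z ^+ 2 by nra.
  rewrite -EFinM; congr EFin; rewrite /chord_remainder ger0_norm ?(ltW Dz)//.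
  have -> : 1 + z ^+ 2 / (1 - z ^+ 2) = (1 - z ^+ 2)^-1 by field; rewrite gt_eqF.
  transitivity (2 * ((z ^+ 2 / (1 - z ^+ 2)) `^ (1 - al / 2 - 1) *
      (1 - z ^+ 2)^-1 `^ (- (3 / 2)) * (z * (1 - z ^+ 2) ^- 2))); last by ring.
  congr (2 * _).
  rewrite -[X in _ = _ * (X * _)](powRr1 (ltW z0)) -powR_invn ?(ltW Dz)//.
  move: Dz; set v := 1 - z ^+ 2 => Dz; rewrite -(powR_mulrn 2 (ltW z0)).
  rewrite !powRE ?divr_gt0 ?invr_gt0 ?expR_gt0// !lnM ?posrE ?invr_gt0 ?expR_gt0// !lnV ?posrE// expRK.
  by rewrite -!expRD; congr expR; field.
- move=> n; rewrite ler_wsqrtr// lerBrDr.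
  have h : n.+2%:R^-1 <= 2^-1 :> R by rewrite lef_pV2 ?posrE// ler_nat.
  by move: (n.+2%:R^-1 : R) h => y h; lra.
- by move=> m n mn; rewrite ler_wsqrtr// lef_pV2 ?posrE// ler_nat !ltnS.
- by move=> m n mn; rewrite ler_wsqrtr// lerB// lef_pV2 ?posrE// ler_nat !ltnS.
- apply/seteqP; split=> [z /=|z [n _] /=]; rewrite !in_itv/= => /andP[h1 h2].
    have Dz : 0 < 1 - z ^+ 2 by nra.
    pose w := z ^- 2 + (1 - z ^+ 2)^-1.
    have wn : w <= (Num.truncn w).+2%:R by rewrite -addn1 natrD ler_wpDr// ltW// truncnS_gt.
    have z2 : 0 < z ^- 2 by rewrite invr_gt0 exprn_gt0.
    have D2 : 0 < (1 - z ^+ 2)^-1 by rewrite invr_gt0.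
    exists (Num.truncn w) => //=; rewrite in_itv/=; apply/andP; split.
      rewrite -[leRHS](gtr0_norm h1) -sqrtr_sqr ler_wsqrtr// invf_ple ?posrE ?exprn_gt0//.
      by apply: le_trans wn; rewrite lerDl ltW.
    rewrite -[leLHS](gtr0_norm h1) -sqrtr_sqr ler_wsqrtr// lerBrDr -lerBrDl.
    by rewrite invf_ple ?posrE// (le_trans _ wn)// lerDr ltW.
  apply/andP; split.
    by apply: lt_le_trans h1; rewrite sqrtr_gt0; case/andP: (Ni n).
  apply: le_lt_trans h2 _; rewrite -[ltRHS]sqrtr1 ltr_sqrt// ltrBlDr ltrDl.
- rewrite (itv0y_bigcup_harmonic ltr01); apply: eq_bigcupr => n _.
  rewrite !powRr1// s1 s2.
  have n1 : (n.+1%:R : R) != 0 by [].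
  have -> : n.+2%:R = n.+1%:R + 1 :> R by rewrite -natr1.
  have n2 := lt0r_neq0 (N0 n); rewrite -natr1 in n2.
  move: (n.+1%:R : R) n1 n2 => k k0 k1.
  have -> : (k + 1)^-1 / (1 - (k + 1)^-1) = k^-1 by field; rewrite ?k0 ?k1 ?addrK ?k0.
  have -> : 1 - (1 - (k + 1)^-1) = (k + 1)^-1 by ring.
  by rewrite invrK mulrBl mul1r mulVf// addrK.
- move=> x y; rewrite !inE/= !in_itv/= => /andP[x0 x1] /andP[y0 y1] xy.
  have Dx : 0 < 1 - x ^+ 2 by nra.
  have Dy : 0 < 1 - y ^+ 2 by nra.
  rewrite ltr_pdivrMr// mulrAC ltr_pdivlMr//.
  have : x ^+ 2 < y ^+ 2 by rewrite ltr_pXn2r// ?nnegrE ltW.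
  by move: (x ^+ 2) (y ^+ 2) => a b; rewrite !mulrBr; lra.
- move=> z; rewrite inE/= in_itv/= => /andP[z0 z1].
  have Dz : 0 < 1 - z ^+ 2 by nra.
  have d2 : is_derive z (1 : R) (fun z => z ^+ 2) (2 * z).
    by apply: (is_derive_eq (is_deriveM (is_derive_id z (1 : R)) (is_derive_id z (1 : R)))); rewrite /GRing.scale/=; ring.
  have d1 : is_derive z (1 : R) (fun z => 1 - z ^+ 2) (- (2 * z)).
    by apply: (is_derive_eq (is_deriveB (is_derive_cst (1 : R) z (1 : R)) d2)); rewrite sub0r.
  have d3 := @is_deriveV _ (fun z => 1 - z ^+ 2) z _ _ (lt0r_neq0 Dz) d1.
  apply: (is_derive_eq (is_deriveM d2 d3)).
  by rewrite /GRing.scale/=; field; rewrite gt_eqF.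
- move=> z; rewrite inE/= in_itv/= => /andP[z0 z1].
  have Dz : 0 < 1 - z ^+ 2 by nra.
  apply: cvgM; first by apply: cvgM; [exact: cvg_cst|exact: cvg_id].
  apply: cvgV; first by rewrite expf_neq0// gt_eqF.
  apply: (@continuous_comp _ _ _ (fun z : R => 1 - z ^+ 2) (fun y : R => y ^+ 2)); last exact: exprn_continuous.
  by apply: cvgB; [exact: cvg_cst|exact: exprn_continuous].
- move=> r; rewrite inE/= in_itv/= andbT => r0.
  apply: cvgM; first exact: powR_continuous.
  by apply: powR_addl_continuous; rewrite addr_gt0.
- move=> z; rewrite inE/= in_itv/= => /andP[z0 z1].
  by rewrite divr_ge0 ?sqr_ge0// mulr_ge0// ltW.
- by move=> r _; rewrite mulr_ge0 ?powR_ge0.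
Qed.

End chord_integrals.

(** * Gauges of open convex sets *)

Section euclidean_topology.
Context {R : realType} {N : nat}.
Implicit Types (x y h v : 'rV[R]_N) (A : set 'rV[R]_N).

Lemma open_rVP A x : open A -> A x ->
  exists2 r : R, 0 < r & forall v, (forall i, `|v 0 i| < r) -> A (x + v).
Proof.
move=> oA Ax; have /nbhs_ballP[r /= r0 rA] : nbhs x A by apply: open_nbhs_nbhs; split.
exists r => // v vr; apply: rA; split => // i j; rewrite ord1 /ball/= mxE.
by rewrite opprD addNKr normrN.
Qed.

Lemma nbhs_rV A x (r : R) : 0 < r -> (forall v, (forall i, `|v 0 i| < r) -> A (x + v)) -> nbhs x A.
Proof.
move=> r0 rA; apply/nbhs_ballP; exists r => //= y xy.
rewrite -[y](subrK x) addrC; apply: rA => i.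
by have [_ /(_ 0 i)] := xy; rewrite /ball/= !mxE distrC.
Qed.

(** The sigma-algebra is generated by the coordinates, so an open set is written as a countable
    union of open cubes with rational centers and radii 1 / (n + 1). *)
Lemma open_rV_measurable A : open A -> measurable A.
Proof.
move=> oA.
pose B (p : 'rV[rat]_N * nat) := [set v : 'rV[R]_N | forall i, `|v 0 i - ratr (p.1 0 i)| < p.2.+1%:R^-1].
pose C (p : 'rV[rat]_N * nat) := if pselect (B p `<=` A) then B p else set0.
have -> : A = \bigcup_p C p.
  apply/seteqP; split=> [x Ax|x [p _]]; last first.
    by rewrite /C; case: pselect => // BA /BA.
  have [r r0 rA] := open_rVP oA Ax.
  (* The factor 2 accounts for the detour through the rational center near x. *)
  have [n nr] : exists n, n.+1%:R^-1 * 2 < r.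
    exists (Num.truncn (2 / r)); rewrite mulrC ltr_pdivrMr// -ltr_pdivrMl// mulrC.
    exact: truncnS_gt.
  have n0 : 0 < n.+1%:R^-1 :> R by rewrite invr_gt0.
  have /choice[c cP] : forall i, exists q : rat, `|x 0 i - ratr q| < n.+1%:R^-1.
    move=> i; move: (n.+1%:R^-1 : R) n0 => e e0.
    have : x 0 i - e < x 0 i + e by lra.
    move=> /rat_in_itvoo[q]; rewrite in_itv/= => /andP[h1 h2].
    by exists q; rewrite distrC ltr_norml; apply/andP; split; lra.
  exists (\row_i c i, n) => //; rewrite /C; case: pselect => [BA|BA] /=.
    by move=> i; rewrite mxE; exact: cP.
  apply: BA => v /= Bv; rewrite -[v](subrK x) addrC; apply: rA => i.
  apply: le_lt_trans nr; rewrite !mxE.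
  have := Bv i; rewrite mxE => h1; have h2 := cP i.
  have -> : v 0 i - x 0 i = (v 0 i - ratr (c i)) - (x 0 i - ratr (c i)) by ring.
  by rewrite (le_trans (ler_normB _ _))// mulr2n mulrDr !mulr1 lerD// ltW.
apply: countable_bigcupT_measurable => [|p]; first exact: countableP.
rewrite /C; case: pselect => BA /=; last exact: measurable0.
have -> : B p = [set v | forall i, [set t : R | `|t - ratr (p.1 0 i)| < p.2.+1%:R^-1] (v 0 i)] by [].
apply: (@measurable_box R N (fun i => [set t : R | `|t - ratr (p.1 0 i)| < p.2.+1%:R^-1])) => i.
have -> : [set t : R | `|t - ratr (p.1 0 i)| < p.2.+1%:R^-1] =
    `](ratr (p.1 0 i) - p.2.+1%:R^-1), (ratr (p.1 0 i) + p.2.+1%:R^-1)[%classic.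
  by apply/seteqP; split => t /=; rewrite in_itv/= ltr_distl.
exact: measurable_itv.
Qed.

Lemma continuous_rV_measurable (f : 'rV[R]_N -> R) : continuous f -> measurable_fun [set: 'rV[R]_N] f.
Proof.
move=> /continuousP cf; apply: (measurability _ (RGenOpens.measurableE R)) => _ [_ [a [b ->]] <-].
rewrite setTI; apply: open_rV_measurable; apply: cf; exact: interval_open.
Qed.

Lemma enorm_ge0 x : 0 <= enorm x. Proof. exact: sqrtr_ge0. Qed.

Lemma sqr_enorm x : enorm x ^+ 2 = \sum_(i < N) x 0 i ^+ 2.
Proof. by rewrite sqr_sqrtr// sumr_ge0// => i _; exact: sqr_ge0. Qed.

Lemma le_coord_enorm x i : `|x 0 i| <= enorm x.
Proof.
rewrite -sqrtr_sqr ler_wsqrtr// (bigD1 i)//= lerDl.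
by apply: sumr_ge0 => j _; exact: sqr_ge0.
Qed.

Lemma enormZ (t : R) x : enorm (t *: x) = `|t| * enorm x.
Proof.
rewrite /enorm -sqrtr_sqr -sqrtrM ?sqr_ge0// mulr_sumr; congr Num.sqrt.
by apply: eq_bigr => i _; rewrite mxE exprMn.
Qed.

Lemma enormN x : enorm (- x) = enorm x.
Proof. by rewrite -scaleN1r enormZ normrN1 mul1r. Qed.

Lemma enorm_eq0 x : (enorm x == 0) = (x == 0).
Proof.
apply/eqP/eqP => [x0|->].
  by apply/rowP => i; rewrite mxE; apply/eqP; rewrite -normr_le0 -x0 le_coord_enorm.
by rewrite /enorm big1 ?sqrtr0// => i _; rewrite mxE expr0n.
Qed.

Lemma enorm_gt0 x : (0 < enorm x) = (x != 0).
Proof. by rewrite lt_neqAle enorm_ge0 andbT eq_sym enorm_eq0. Qed.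

Lemma enorm_continuous : continuous (@enorm R N).
Proof.
move=> x; apply: (@continuous_comp _ _ _ (fun x : 'rV[R]_N => \sum_(i < N) x 0 i ^+ 2) (@Num.sqrt R)); last first.
  exact: sqrt_continuous.
move: x; elim: (index_enum 'I_N) => [|i s IH] x.
  rewrite (_ : (fun x => _) = cst (0 : R)); first exact: cst_continuous.
  by apply/funext => y; rewrite big_nil.
rewrite (_ : (fun x => _) = (fun x : 'rV[R]_N => x 0 i ^+ 2 + \sum_(i <- s) x 0 i ^+ 2)); last first.
  by apply/funext => y; rewrite big_cons.
have ci : {for x, continuous (fun x : 'rV[R]_N => x 0 i ^+ 2)}.
  apply: (@continuous_comp _ _ _ (fun x : 'rV[R]_N => x 0 i) (fun t : R => t ^+ 2)).
    exact: coord_continuous.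
  exact: exprn_continuous.
exact: continuousD ci (IH x).
Qed.

Lemma measurable_enorm : measurable_fun [set: 'rV[R]_N] (@enorm R N).
Proof. exact: continuous_rV_measurable enorm_continuous. Qed.

Lemma measurable_rV_add_fun d (T : measurableType d) (f g : T -> 'rV[R]_N) :
  measurable_fun [set: T] f -> measurable_fun [set: T] g ->
  measurable_fun [set: T] (fun z => f z + g z).
Proof.
move=> mf mg; apply: measurable_fun_rV => i; under eq_fun do rewrite mxE.
by apply: measurable_funD; [exact: measurableT_comp (measurable_coord i) mf|
  exact: measurableT_comp (measurable_coord i) mg].
Qed.

Lemma measurable_rV_scale_fun d (T : measurableType d) (f : T -> R) (g : T -> 'rV[R]_N) :
  measurable_fun [set: T] f -> measurable_fun [set: T] g ->
  measurable_fun [set: T] (fun z => f z *: g z).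
Proof.
move=> mf mg; apply: measurable_fun_rV => i; under eq_fun do rewrite mxE.
by apply: measurable_funM => //; exact: measurableT_comp (measurable_coord i) mg.
Qed.

Lemma measurable_rV_opp_fun d (T : measurableType d) (g : T -> 'rV[R]_N) :
  measurable_fun [set: T] g -> measurable_fun [set: T] (fun z => - g z).
Proof.
move=> mg; under eq_fun do rewrite -scaleN1r.
exact: measurable_rV_scale_fun.
Qed.

End euclidean_topology.

(** * Gauges as reciprocal exit times *)

Section gauge.
Context {R : realType} {N : nat}.
Implicit Types (x y h v : 'rV[R]_N) (O : set 'rV[R]_N).

(** The Minkowski gauge of O - x. For x in an open convex O its reciprocal is the exit time of the
    ray x + t h, and a ray that never leaves O has gauge 0. *)
Definition gauge O x h : R := inf [set q : R | 0 < q /\ O (x + q^-1 *: h)].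

Lemma gauge_ge0 O x h : 0 <= gauge O x h.
Proof.
rewrite /gauge; have [->|/set0P ne] := eqVneq [set q : R | 0 < q /\ O (x + q^-1 *: h)] set0.
  by rewrite inf0.
by apply: lb_le_inf => // q [/ltW].
Qed.

Lemma open_line O x h : open O -> O x ->
  exists2 r : R, 0 < r & forall t, `|t| < r -> O (x + t *: h).
Proof.
move=> oO Ox; have [r r0 rO] := open_rVP oO Ox.
have e0 := enorm_ge0 h.
have e1 : 0 < enorm h + 1 by rewrite (le_lt_trans e0)// ltrDl.
exists (r / (enorm h + 1)); first by rewrite divr_gt0.
move=> t tr; apply: rO => i; rewrite mxE normrM.
move: tr; rewrite ltr_pdivlMr//; apply: le_lt_trans.
by rewrite ler_wpM2l// (le_trans (le_coord_enorm _ _))// lerDl.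
Qed.

Lemma convex_setP O : convex_set O -> forall x y (l : R), 0 <= l <= 1 -> O x -> O y ->
  O (l *: x + (1 - l) *: y).
Proof.
move=> cO x y l /andP[l0 l1] Ox Oy.
by have := cO x y (Itv01 l0 l1) (mem_set Ox) (mem_set Oy); rewrite inE.
Qed.

Lemma convex_set_star O : convex_set O ->
  forall x h (s t : R), 0 <= s <= t -> O x -> O (x + t *: h) -> O (x + s *: h).
Proof.
move=> cO x h s t /andP[s0 st] Ox Oxt.
have [t0|t0] := leP t 0.
  have -> : s = 0 by apply/eqP; rewrite eq_le s0 andbT (le_trans st t0).
  by rewrite scale0r addr0.
have l01 : 0 <= s / t <= 1 by rewrite divr_ge0 ?(ltW t0)//= ler_pdivrMr// mul1r.
have := convex_setP cO l01 Oxt Ox.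
by rewrite scalerDr scalerA divfK ?gt_eqF// scalerBl scale1r addrC addrA subrK.
Qed.

(** Convexity fills in the segment from x to a later point of the ray; openness lets a point of O be
    pushed further, which makes the inequality strict. *)
Lemma gauge_lt1P O x h (t : R) : open O -> convex_set O -> O x -> 0 < t ->
  (gauge O x h * t < 1) <-> O (x + t *: h).
Proof.
move=> oO cO Ox t0; have [r r0 rO] := open_line h oO Ox.
have hin : has_inf [set q : R | 0 < q /\ O (x + q^-1 *: h)].
  split; last by exists 0 => q [/ltW].
  exists (2 / r); split; first by rewrite divr_gt0.
  apply: rO; rewrite invf_div gtr0_norm ?divr_gt0// ltr_pdivrMr// mulr_natr mulr2n.
  by rewrite ltrDl.
split.
  rewrite -ltr_pdivlMr// div1r => /inf_lt => /(_ hin.1)[q [q0 Oq] qt].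
  apply: (convex_set_star cO _ Ox Oq); rewrite (ltW t0)/=.
  by rewrite -[leLHS]invrK lef_pV2 ?posrE ?invr_gt0// ltW.
move=> Oxt; have [e e0 eO] := open_line h oO Oxt.
rewrite -ltr_pdivlMr// div1r.
apply: (@le_lt_trans _ _ ((t + e / 2)^-1)); last first.
  by rewrite ltf_pV2 ?posrE ?addr_gt0 ?divr_gt0// ltrDl divr_gt0.
apply: inf_lbound; first by exists 0 => q [/ltW].
split; first by rewrite invr_gt0 addr_gt0// divr_gt0.
rewrite invrK scalerDl addrA; apply: eO.
by rewrite gtr0_norm ?divr_gt0// ltr_pdivrMr// ltr_pMr// ltr1n.
Qed.

Lemma gauge_lineP O x h (t : R) : open O -> convex_set O -> O x ->
  O (x + t *: h) <-> (gauge O x h * t < 1 /\ 0 < 1 + gauge O x (- h) * t).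
Proof.
move=> oO cO Ox; have g1 := gauge_ge0 O x h; have g2 := gauge_ge0 O x (- h).
have [t0|t0|->] := ltgtP t 0.
- have tn : 0 < - t by rewrite oppr_gt0.
  rewrite -[t *: h]opprK -scaleNr -scalerN -(gauge_lt1P (- h) oO cO Ox tn).
  split=> [gt|[_]]; last by rewrite mulrN; lra.
  split; last by move: gt; rewrite mulrN; lra.
  by apply: le_lt_trans ltr01; rewrite mulr_ge0_le0// ltW.
- rewrite -(gauge_lt1P h oO cO Ox t0); split=> [gt|[]//]; split=> //.
  by rewrite ltr_wpDr// mulr_ge0 ?(ltW t0).
- by rewrite scale0r !mulr0 !addr0.
Qed.

Lemma eq_gauge (p q : R) : 0 <= p -> 0 <= q ->
  (forall s, 0 < s -> (p * s < 1) <-> (q * s < 1)) -> p = q.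
Proof.
move=> p0 q0 pq; have [||//] := ltgtP p q => lt; exfalso.
- have q1 : 0 < q by apply: le_lt_trans lt.
  have qi : 0 < q^-1 by rewrite invr_gt0.
  have := (pq _ qi).1; rewrite ltr_pdivrMr// mul1r => /(_ lt).
  by rewrite divff ?ltxx// gt_eqF.
- have p1 : 0 < p by apply: le_lt_trans lt.
  have qi : 0 < p^-1 by rewrite invr_gt0.
  have := (pq _ qi).2; rewrite ltr_pdivrMr// mul1r => /(_ lt).
  by rewrite divff ?ltxx// gt_eqF.
Qed.

(** The exit time 1 / P, counted from x + t h, becomes 1 / P - t. *)
Lemma gauge_shift O x h (t : R) : open O -> convex_set O -> O x -> O (x + t *: h) ->
  gauge O (x + t *: h) h = gauge O x h / (1 - gauge O x h * t).
Proof.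
move=> oO cO Ox Oxt; have g1 := gauge_ge0 O x h; have g2 := gauge_ge0 O x (- h).
have [h1 h2] := (gauge_lineP h t oO cO Ox).1 Oxt.
have D : 0 < 1 - gauge O x h * t by lra.
apply: eq_gauge; [exact: gauge_ge0|by rewrite divr_ge0// ltW|] => s s0.
rewrite (gauge_lt1P h oO cO Oxt s0) -addrA -scalerDl (gauge_lineP h _ oO cO Ox).
rewrite mulrAC ltr_pdivrMr// mul1r.
split=> [[h3 _]|h3]; first by move: h3; rewrite mulrDr; lra.
split; first by rewrite mulrDr; lra.
by rewrite mulrDr addrA ltr_wpDr// mulr_ge0 ?(ltW s0).
Qed.

Lemma gauge_shift_opp O x h (t : R) : open O -> convex_set O -> O x -> O (x + t *: h) ->
  gauge O (x + t *: h) (- h) = gauge O x (- h) / (1 + gauge O x (- h) * t).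
Proof.
move=> oO cO Ox Oxt.
have E : x + t *: h = x + (- t) *: (- h) by rewrite scaleNr scalerN opprK.
by rewrite E gauge_shift//; [rewrite mulrN opprK|rewrite -E].
Qed.

Lemma gauge_le O x h (r : R) : open O -> convex_set O -> 0 < r ->
  (forall v, (forall i, `|v 0 i| < r) -> O (x + v)) -> gauge O x h <= enorm h / r.
Proof.
move=> oO cO r0 rO; rewrite leNgt; apply/negP => lt.
have Ox : O x by rewrite -[x]addr0; apply: rO => i; rewrite mxE normr0.
have g0 : 0 < gauge O x h by apply: le_lt_trans lt; rewrite divr_ge0 ?enorm_ge0// ltW.
have gi : 0 < (gauge O x h)^-1 by rewrite invr_gt0.
have : ~ O (x + (gauge O x h)^-1 *: h).
  by rewrite -(gauge_lt1P h oO cO Ox gi) divff ?ltxx// gt_eqF.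
apply; apply: rO => i; rewrite mxE normrM gtr0_norm// ltr_pdivrMl//.
apply: (@le_lt_trans _ _ (enorm h)); first exact: le_coord_enorm.
by rewrite -ltr_pdivrMr.
Qed.

Lemma gauge_gt0 O x h (M : R) : open O -> convex_set O -> O x ->
  (forall y, O y -> forall i, `|y 0 i| < M) -> h != 0 -> 0 < gauge O x h.
Proof.
move=> oO cO Ox bO h0; rewrite lt_neqAle gauge_ge0 andbT eq_sym; apply/eqP => g0.
have [i hi] : exists i, h 0 i != 0.
  apply/existsP; rewrite -negb_forall; apply: contra h0 => /forallP h0.
  by apply/eqP/rowP => i; rewrite mxE; exact/eqP.
have M0 : 0 < M by apply: le_lt_trans (bO x Ox i).
(* At this time coordinate i has moved by 2 M, hence out of ]- M, M[. *)
have t0 : 0 < 2 * M / `|h 0 i| by rewrite divr_gt0 ?mulr_gt0// normr_gt0.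
have := (gauge_lt1P h oO cO Ox t0).1; rewrite g0 mul0r ltr01 => /(_ isT) /bO /(_ i).
rewrite !mxE; have := bO x Ox i => xM.
have : `|2 * M / `|h 0 i| * h 0 i| = 2 * M.
  by rewrite normrM (gtr0_norm t0) divfK// normr_eq0.
move: (2 * M / `|h 0 i| * h 0 i) => y yM yx.
have : `|y| <= `|x 0 i + y| + `|x 0 i|.
  by rewrite -[in leLHS](addrK (x 0 i) y) [y + _]addrC; exact: ler_normB.
lra.
Qed.

(** For r > 0 the gauge is below r iff some rational time beyond 1 / r stays in O, or no positive
    rational time does, the infimum of the empty set being 0. Rational times suffice because O is
    open. *)
Lemma measurable_gauge O : open O ->
  measurable_fun [set: 'rV[R]_N * 'rV[R]_N] (fun p => gauge O p.1 p.2).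
Proof.
move=> oO; have mO := open_rV_measurable oO.
pose T (t : rat) := [set p : 'rV[R]_N * 'rV[R]_N | O (p.1 + ratr t *: p.2)].
have mT t : measurable (T t).
  rewrite -[T t]setTI.
  have mf : measurable_fun [set: 'rV[R]_N * 'rV[R]_N] (fun p => p.1 + ratr t *: p.2).
    apply: measurable_rV_add_fun => //; exact: measurable_rV_scale_fun.
  exact: mf.
have lb0 x h : has_lbound [set q : R | 0 < q /\ O (x + q^-1 *: h)] by exists 0 => q [/ltW].
have approx x h (q : R) (a : R) : 0 < q -> O (x + q^-1 *: h) -> a < q^-1 ->
    exists2 t : rat, a < ratr t & (0 < t)%R /\ O (x + ratr t *: h).
  move=> q0 Oq aq; have [e e0 eO] := open_line h oO Oq.
  have : q^-1 < q^-1 + e by rewrite ltrDl.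
  move=> /rat_in_itvoo[t]; rewrite in_itv/= => /andP[h1 h2].
  exists t; first exact: lt_trans h1.
  have t0 : 0 < (ratr t : R) by apply: lt_trans h1; rewrite invr_gt0.
  split; first by rewrite ltr0q in t0.
  have := eO (ratr t - q^-1); rewrite scalerBl -addrA [q^-1 *: h + _]addrC subrK; apply.
  by rewrite gtr0_norm ?subr_gt0// ltrBlDl.
apply: (measurability _ (RGenInftyO.measurableE R)) => _ [_ [r ->] <-].
rewrite setTI.
have [r0|r0] := leP r 0.
  rewrite (_ : _ @^-1` _ = set0)//; apply/seteqP; split => // -[x h] /=.
  by rewrite in_itv/= => /lt_le_trans /(_ r0); rewrite ltNge gauge_ge0.
rewrite (_ : _ @^-1` _ = ~` (\bigcup_(t in [set t | 0 < t]) T t) `|`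
   \bigcup_(t in [set t : rat | r^-1 < ratr t]) T t).
  apply: measurableU.
    by apply: measurableC; rewrite bigcup_mkcond; apply: bigcupT_measurable_rat => t; case: ifP.
  by rewrite bigcup_mkcond; apply: bigcupT_measurable_rat => t; case: ifP.
apply/seteqP; split => -[x h] /=; rewrite in_itv/=.
  move=> gr; have [|/set0P[q [q0 Oq]]] := eqVneq [set q : R | 0 < q /\ O (x + q^-1 *: h)] set0.
    move=> E; left => -[t t0 Tt].
    have : [set q : R | 0 < q /\ O (x + q^-1 *: h)] (ratr t)^-1.
      by split; [rewrite invr_gt0 ltr0q|rewrite invrK].
    by rewrite E.
  right; have [|q' [q'0 Oq'] q'r] := inf_lt _ gr; first by exists q.
  have [|t tr [t0 Ot]] := approx x h q' r^-1 q'0 Oq'; first by rewrite ltf_pV2 ?posrE.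
  by exists t.
move=> [nT|[t tr Tt]].
  rewrite /gauge (_ : mkset _ = set0) ?inf0//.
  apply/seteqP; split => // q [q0 Oq]; apply: nT.
  have [|t _ [t0 Ot]] := approx x h q 0 q0 Oq; first by rewrite invr_gt0.
  by exists t.
have t0 : 0 < (ratr t : R) by apply: lt_trans tr; rewrite invr_gt0.
apply: (@le_lt_trans _ _ (ratr t)^-1).
  apply: inf_lbound => //; split; first by rewrite invr_gt0.
  by rewrite invrK.
by rewrite -[ltRHS]invrK ltf_pV2 ?posrE ?invr_gt0.
Qed.

End gauge.

(** * Truncated integrals over the two halves of a chord *)

Section chord.
Context {R : realType}.
Local Notation mu := (@lebesgue_measure R).
Implicit Types (al P Q e t : R).

(* In the coordinate [z] of [integral_chord_ground_state] below, this is [e < |z| < 1]: unlike a bound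
   on [|t|], it is symmetric in the two end points [x] and [x + t h]. *)
Definition chord_far P Q e t : bool :=
  [&& 0 < 1 - P * t, 0 < 1 + Q * t & e * (1 + (Q - P) / 2 * t) < (P + Q) / 2 * `|t|].

(** The positive half of the truncated chord; its end points are the Moebius images of e and 1. *)
Definition chord_half P Q e : set R :=
  `](e / ((P + Q) / 2 - (Q - P) / 2 * e)), P^-1[%classic.

Lemma chord_half_gt0 P Q e t : 0 < P -> 0 < Q -> 0 < e < 1 -> chord_half P Q e t -> 0 < t.
Proof.
move=> P0 Q0 /andP[e0 e1]; rewrite /chord_half/= in_itv/= => /andP[+ _].
apply: lt_trans; rewrite divr_gt0//; nra.
Qed.

Lemma chord_farE P Q e t : 0 < P -> 0 < Q -> 0 < e < 1 -> 0 < t ->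
  chord_far P Q e t = (t \in chord_half P Q e).
Proof.
move=> P0 Q0 /andP[e0 e1] t0; rewrite /chord_far /chord_half mem_setE in_itv/=.
rewrite (gtr0_norm t0).
have D : 0 < (P + Q) / 2 - (Q - P) / 2 * e by nra.
have -> : 0 < 1 + Q * t by rewrite addr_gt0// mulr_gt0.
rewrite andTb andbC; congr (_ && _); last first.
  by rewrite subr_gt0 -[P^-1]mul1r ltr_pdivlMr// mulrC.
by rewrite ltr_pdivrMr//; apply/idP/idP; lra.
Qed.

Lemma chord_farN P Q e t : chord_far P Q e (- t) = chord_far Q P e t.
Proof.
rewrite /chord_far normrN andbCA; congr [&& _, _ & _].
- by congr (_ < _); ring.
- by congr (_ < _); ring.
- by congr (_ < _); [congr (_ * _); ring|congr (_ * _); ring].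
Qed.

Lemma measurable_chord_far d (T : measurableType d) (P Q t : T -> R) e :
  measurable_fun [set: T] P -> measurable_fun [set: T] Q -> measurable_fun [set: T] t ->
  measurable_fun [set: T] (fun z => chord_far (P z) (Q z) e (t z)).
Proof.
move=> mP mQ mt; apply: measurable_and; first apply: measurable_fun_ltr => //.
  by apply: measurable_funB => //; exact: measurable_funM.
apply: measurable_and; first apply: measurable_fun_ltr => //.
  by apply: measurable_funD => //; exact: measurable_funM.
apply: measurable_fun_ltr.
  apply: measurable_funM => //; apply: measurable_funD => //; apply: measurable_funM => //.
  by apply: measurable_funM => //; exact: measurable_funB.
apply: measurable_funM; first by apply: measurable_funM => //; exact: measurable_funD.
by apply: measurableT_comp => //; exact: normr_measurable.
Qed.

Lemma measurable_bool_natr d (T : measurableType d) (b : T -> bool) :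
  measurable_fun [set: T] b -> measurable_fun [set: T] (fun z => (b z)%:R : R).
Proof.
move=> mb; rewrite (_ : (fun z => _) = (fun z => if b z then 1 else 0 : R)).
  exact: measurable_fun_ifT.
by apply/funext => z; case: (b z).
Qed.

Lemma integral_chord_far P Q e (g : R -> R) : 0 < P -> 0 < Q -> 0 < e < 1 ->
  measurable_fun [set: R] g -> (forall t, 0 <= g t) ->
  (\int[mu]_t ((chord_far P Q e t)%:R * g t)%:E =
   \int[mu]_(t in chord_half P Q e) (g t)%:E +
   \int[mu]_(t in chord_half Q P e) (g (- t))%:E)%E.
Proof.
move=> P0 Q0 e01 mg g0.
have mA : measurable (chord_half P Q e) by exact: measurable_itv.
have mB : measurable (chord_half Q P e) by exact: measurable_itv.
have mgN : measurable_fun [set: R] (fun t => g (- t)).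
  by apply: measurableT_comp => //; exact: measurable_funN.
pose f1 t := (g t * \1_(chord_half P Q e) t)%:E.
pose f2 t := (g (- t) * \1_(chord_half Q P e) t)%:E.
have mf1 : measurable_fun [set: R] f1 by apply/measurable_EFinP; exact: measurable_funM.
have mf2 : measurable_fun [set: R] f2 by apply/measurable_EFinP; exact: measurable_funM.
have f10 t : (0 <= f1 t)%E by rewrite lee_fin mulr_ge0.
have f20 t : (0 <= f2 t)%E by rewrite lee_fin mulr_ge0.
have indE (A : set R) (f : R -> R) :
    (\int[mu]_(t in A) (f t)%:E = \int[mu]_t (f t * \1_A t)%:E)%E.
  rewrite integral_mkcond; apply: eq_integral => t _.
  by rewrite patchE indicE; case: ifP => _; rewrite ?mulr1 ?mulr0.
rewrite (indE (chord_half P Q e)) (indE (chord_half Q P e) (fun t => g (- t))).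
have -> : (\int[mu]_t (g (- t) * \1_(chord_half Q P e) t)%:E = \int[mu]_t f2 (-1 * t)%R)%E.
  by rewrite (ge0_integral_scale (f := f2)) ?oppr_eq0// normrN1 invr1 mul1e.
rewrite -ge0_integralD//; last 2 first.
- by move=> t _; exact: f10.
- by apply: measurableT_comp => //; exact: measurable_funM.
apply: eq_integral => t _; rewrite /f2 -EFinD; congr EFin.
rewrite mulN1r opprK !indicE.
have nA s : s <= 0 -> (s \in chord_half P Q e) = false.
  by move=> s0; apply/negP => /set_mem/(chord_half_gt0 P0 Q0 e01); rewrite ltNge s0.
have nB s : s <= 0 -> (s \in chord_half Q P e) = false.
  by move=> s0; apply/negP => /set_mem/(chord_half_gt0 Q0 P0 e01); rewrite ltNge s0.
have [t0|t0|->] := ltgtP t 0.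
- rewrite nA ?(ltW t0)// mulr0 add0r -chord_farE ?oppr_gt0// chord_farN mulrC//.
- by rewrite (nB (- t)) ?oppr_le0 ?(ltW t0)// mulr0 addr0 -chord_farE// mulrC.
- rewrite oppr0 nA ?nB// !mulr0 addr0 /chord_far normr0 !mulr0.
  case/andP: e01 => e0 _; rewrite (_ : (e * (1 + 0) < 0) = false) ?andbF ?mul0r//.
  by apply/negbTE; rewrite -leNgt addr0 mulr1 ltW.
Qed.

Lemma powR_midpoint al (u v : R) : 1 <= al -> 0 <= u -> 0 <= v ->
  2 * ((u + v) / 2) `^ al <= u `^ al + v `^ al.
Proof.
move=> al1 u0 v0.
have h : 0 <= (2^-1 : R) by rewrite invr_ge0.
have h1 : 2^-1 <= (1 : R) by rewrite invf_le1// ler1n.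
have ui : u \in (`[0, +oo[%classic : set R) by rewrite inE/= in_itv/= u0.
have vi : v \in (`[0, +oo[%classic : set R) by rewrite inE/= in_itv/= v0.
have := @convex_powR R al al1 (Itv01 h h1) u v ui vi.
rewrite convRE [X in X `^ _ <= _]convRE/= /unstable.onem.
have -> : 2^-1 * u + (1 - 2^-1) * v = (u + v) / 2 by field.
move: (_ `^ al) (u `^ al) (v `^ al) => a b c; lra.
Qed.

(** The shares u / (u + v) and v / (u + v) lie in [0, 1], where raising to the power al does not
    increase them. *)
Lemma powR_superadditive al (u v : R) : 1 <= al -> 0 < u -> 0 < v ->
  u `^ al + v `^ al <= (u + v) `^ al.
Proof.
move=> al1 u0 v0; have w0 : 0 < u + v by rewrite addr_gt0.
have H (a : R) : 0 < a -> a <= u + v -> a `^ al <= a / (u + v) * (u + v) `^ al.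
  move=> a0 aw; rewrite -{1}(divfK (lt0r_neq0 w0) a) powRM ?divr_ge0 ?(ltW a0) ?(ltW w0)//.
  rewrite ler_wpM2r ?powR_ge0// ge1r_powR// divr_gt0//=.
  by rewrite ler_pdivrMr// mul1r.
apply: (le_trans (lerD (H u u0 _) (H v v0 _))); rewrite ?lerDl ?lerDr ?(ltW u0) ?(ltW v0)//.
by rewrite -mulrDl -mulrDl divff ?mul1r ?gt_eqF.
Qed.

(** With m and c as in [integral_chord_ground_state], al times the integral is e^(- al) ((m - c
    e)^al + (m + c e)^al) - P^al - Q^al. Convexity bounds the bracket below by 2 m^al,
    superadditivity bounds P^al + Q^al by (2 m)^al. The chord then enters only through m^al, as it
    does in the ground state integral. *)
Lemma integral_chord_far_powR_ge al P Q e : 1 < al -> 0 < P -> 0 < Q -> 0 < e < 1 ->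
  (((((P + Q) / 2) `^ al * ((2 * e `^ (- al) - 2 `^ al) / al))%:E <=
    \int[mu]_t ((chord_far P Q e t)%:R * `|t| `^ (- (1 + al)))%:E))%E.
Proof.
move=> al1 P0 Q0 e01; case/andP: (e01) => e0 e1.
have al0 : 0 < al by rewrite (lt_trans ltr01).
have mk : measurable_fun [set: R] (fun t : R => `|t| `^ (- (1 + al))).
  by apply: (measurableT_comp (measurable_powR _)); exact: normr_measurable.
rewrite integral_chord_far//.
set m := (P + Q) / 2.
have D1 : 0 < (P + Q) / 2 - (Q - P) / 2 * e by nra.
have D2 : 0 < (Q + P) / 2 - (P - Q) / 2 * e by nra.
have lt1 : e / ((P + Q) / 2 - (Q - P) / 2 * e) < P^-1.
  by rewrite ltr_pdivrMr// mulrC ltr_pdivlMr//; nra.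
have lt2 : e / ((Q + P) / 2 - (P - Q) / 2 * e) < Q^-1.
  by rewrite ltr_pdivrMr// mulrC ltr_pdivlMr//; nra.
have -> : (\int[mu]_(t in chord_half P Q e) (`|t| `^ (- (1 + al)))%:E =
    \int[mu]_(t in chord_half P Q e) (t `^ (- (1 + al)))%:E)%E.
  by apply: eq_integral => t /set_mem /(chord_half_gt0 P0 Q0 e01) t0; rewrite gtr0_norm.
have -> : (\int[mu]_(t in chord_half Q P e) (`|- t| `^ (- (1 + al)))%:E =
    \int[mu]_(t in chord_half Q P e) (t `^ (- (1 + al)))%:E)%E.
  by apply: eq_integral => t /set_mem /(chord_half_gt0 Q0 P0 e01) t0; rewrite normrN gtr0_norm.
rewrite !integral_powR_itv ?divr_gt0// -EFinD lee_fin -mulrDl mulrA ler_wpM2r ?invr_ge0 ?(ltW al0)//.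
have E (a : R) : 0 < a -> (e / a) `^ (- al) = e `^ (- al) * a `^ al.
  by move=> a0; rewrite powRM ?invr_ge0 ?(ltW e0) ?(ltW a0)// powRV// [a `^ (- al)]powRN invrK.
rewrite !E// !powRN !powRV// !invrK.
have h1 := @powR_midpoint al _ _ (ltW al1) (ltW D1) (ltW D2).
have h2 := @powR_superadditive al P Q (ltW al1) P0 Q0.
have Em : ((P + Q) / 2 - (Q - P) / 2 * e + ((Q + P) / 2 - (P - Q) / 2 * e)) / 2 = m.
  by rewrite /m; field.
rewrite Em in h1.
have PQ : (P + Q) `^ al = m `^ al * 2 `^ al.
  by rewrite -powRM ?divr_ge0 ?addr_ge0 ?(ltW P0) ?(ltW Q0)// /m divfK.
rewrite PQ in h2.
have ei : 0 <= e `^ (- al) by exact: powR_ge0.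
have := ler_wpM2l ei h1.
rewrite powRN in ei *; move: h2; rewrite -/m.
move: (_ `^ al) (_ `^ al) (P `^ al) (Q `^ al) (m `^ al).
move=> a b p q c' h2 h3; lra.
Qed.

Lemma integral_chord_far_ground_state al P Q e : 1 < al -> 0 < P -> 0 < Q -> 0 < e < 1 ->
  (\int[mu]_t ((chord_far P Q e t)%:R *
      (`|t| `^ (- (1 + al)) * `|(1 - P * t) * (1 + Q * t)| `^ ((al - 1) / 2)))%:E =
   ((2 * ((P + Q) / 2) `^ al)%:E * \int[mu]_(z in `[e, 1%R]) (chord_kernel al z)%:E))%E.
Proof.
move=> al1 P0 Q0 e01.
have mk : measurable_fun [set: R]
    (fun t : R => `|t| `^ (- (1 + al)) * `|(1 - P * t) * (1 + Q * t)| `^ ((al - 1) / 2)).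
  apply: measurable_funM.
    by apply: (measurableT_comp (measurable_powR _)); exact: normr_measurable.
  apply: (measurableT_comp (measurable_powR _)); apply: measurableT_comp; first exact: normr_measurable.
  apply: measurable_funM.
    by apply: measurable_funB => //; exact: measurable_funM.
  by apply: measurable_funD => //; exact: measurable_funM.
rewrite integral_chord_far//.
have E1 := @integral_chord_ground_state R al P Q e al1 P0 Q0 e01.
have E2 := @integral_chord_ground_state R al Q P e al1 Q0 P0 e01.
cbv zeta in E1, E2.
have -> : (\int[mu]_(t in chord_half P Q e)
    (`|t| `^ (- (1 + al)) * `|(1 - P * t) * (1 + Q * t)| `^ ((al - 1) / 2))%:E =
    ((((P + Q) / 2) `^ al)%:E * \int[mu]_(z in `[e, 1%R]) (chord_kernel al z)%:E))%E.
  rewrite -E1; apply: eq_integral => t /set_mem /(chord_half_gt0 P0 Q0 e01) t0.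
  by rewrite gtr0_norm.
have -> : (\int[mu]_(t in chord_half Q P e)
    (`|- t| `^ (- (1 + al)) * `|(1 - P * (- t)) * (1 + Q * (- t))| `^ ((al - 1) / 2))%:E =
    ((((Q + P) / 2) `^ al)%:E * \int[mu]_(z in `[e, 1%R]) (chord_kernel al z)%:E))%E.
  rewrite -E2; apply: eq_integral => t /set_mem /(chord_half_gt0 Q0 P0 e01) t0.
  by rewrite normrN (gtr0_norm t0); congr (_ * `|_| `^ _)%:E; ring.
rewrite [Q + P]addrC -ge0_muleDl ?lee_fin ?powR_ge0// -EFinD.
by rewrite mulr_natl mulr2n.
Qed.

End chord.

(** * The Hardy inequality along a fixed direction *)

Lemma ereal_scale_fin_num {R : realType} (M D : \bar R) (c : R) : 0 < c ->
  M = (c^-1%:E * D)%E -> (D < +oo)%E -> (0 <= M)%E ->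
  exists2 m, D = (c * m)%:E & M = m%:E.
Proof.
move=> c0 ->; case: D => [d| |] // _ M0; last first.
  by move: M0; rewrite gt0_muleNy// lte_fin invr_gt0.
by exists (c^-1 * d) => //; rewrite mulrA mulfV ?mul1r// gt_eqF.
Qed.

Section hardy_direction.
Context {R : realType} {N : nat}.
Local Notation mu := (@lebesgue_measure R).
Local Notation leb := (lebesgue_rV R N).
Implicit Types (O : set 'rV[R]_N) (h x : 'rV[R]_N) (phi : 'rV[R]_N -> R).

(** The coefficient of (P + Q)^al that remains once the terms e^(- al) have cancelled. The Gamma
    quotient is twice the integral of [chord_remainder], and the - 1 stems from the term 2^al in
    [integral_chord_far_powR_ge]. *)
Definition hardy1 (al : R) : R :=
  (2 `^ (- al) * (Gamma (1 - al / 2) * Gamma ((1 + al) / 2) / Gamma (3 / 2)) - 1) / al.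

(** For fixed t the exchange of end points is a translation in x, followed by a reflection in t. *)
Lemma ge0_integral_swap h (f : 'rV[R]_N * R -> R) :
  measurable_fun [set: 'rV[R]_N * R] f -> (forall z, 0 <= f z) ->
  (\int[leb]_x \int[mu]_t (f (x + t *: h, - t))%:E = \int[leb]_x \int[mu]_t (f (x, t))%:E)%E.
Proof.
move=> mf f0.
have mF : measurable_fun [set: 'rV[R]_N * R] (EFin \o f) by exact/measurable_EFinP.
have mg : measurable_fun [set: 'rV[R]_N * R] (fun z => (f (z.1 + z.2 *: h, - z.2))%:E).
  apply/measurable_EFinP; apply: measurableT_comp => //.
  apply: measurable_fun_pair; last exact: measurable_funN.
  apply: measurable_rV_add_fun => //; exact: measurable_rV_scale_fun.
have g0 z : (0 <= (f (z.1 + z.2 *: h, - z.2))%:E)%E by rewrite lee_fin.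
have F0 z : (0 <= (EFin \o f) z)%E by rewrite lee_fin.
have T1 := @fubini_tonelli _ _ _ _ _ leb mu _ mg g0.
have T2 := @fubini_tonelli _ _ _ _ _ leb mu _ mF F0.
rewrite T1/= T2/=.
have msec t : measurable_fun [set: 'rV[R]_N] (fun x => (f (x, t))%:E).
  exact: (measurableT_comp mF (pair2_measurable t)).
transitivity (\int[mu]_t (fun t => \int[leb]_x (f (x, t))%:E) (-1 * t)%R)%E.
  apply: eq_integral => t _; rewrite mulN1r.
  exact: (ge0_integral_rV_shift (t *: h) (msec (- t)) (fun x => F0 (x, - t))).
rewrite (ge0_integral_scale (f := fun t => \int[leb]_x (f (x, t))%:E)%E).
- by rewrite normrN1 invr1 mul1e.
- by rewrite oppr_eq0.
- exact: (measurable_fun_fubini_tonelli_G (m1 := leb) (EFin \o f) mF F0).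
- by move=> t; apply: integral_ge0 => x _; exact: (F0 (x, t)).
Qed.

Section fixed_direction.
Variables (O : set 'rV[R]_N) (h : 'rV[R]_N) (phi : 'rV[R]_N -> R) (al : R).
Hypotheses (oO : open O) (cO : convex_set O).
Hypotheses (hP : forall x, O x -> 0 < gauge O x h) (hQ : forall x, O x -> 0 < gauge O x (- h)).
Hypotheses (mphi : measurable_fun [set: 'rV[R]_N] phi) (al1 : 1 < al) (al2 : al < 2).

Let P x := gauge O x h.
Let Q x := gauge O x (- h).
Let far e (z : 'rV[R]_N * R) : R := \1_O z.1 * (chord_far (P z.1) (Q z.1) e z.2)%:R.
Let rho (z : 'rV[R]_N * R) : R := `|(1 - P z.1 * z.2) * (1 + Q z.1 * z.2)| `^ ((al - 1) / 2).
Let sw (z : 'rV[R]_N * R) := (z.1 + z.2 *: h, - z.2).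

Let farE e z : O z.1 -> far e z = (chord_far (P z.1) (Q z.1) e z.2)%:R.
Proof. by move=> Oz; rewrite /far indicE mem_set// mul1r. Qed.

(** Seen from the other end point, 1 - P t and 1 + Q t turn into their inverses, so [rho] is
    inverted. Both sides of the cut-off inequality are divided by (1 - P t) (1 + Q t), so it
    persists. *)
Let far_swap1 e z : O z.1 -> chord_far (P z.1) (Q z.1) e z.2 ->
  [/\ O (sw z).1, chord_far (P (sw z).1) (Q (sw z).1) e (sw z).2 & rho (sw z) = (rho z)^-1].
Proof.
case: z => x t /= Ox /and3P[h1 h2 h3].
have Oxt : O (x + t *: h).
  by apply/(gauge_lineP h t oO cO Ox); split=> //; rewrite -subr_gt0.
rewrite /sw/= /P /Q gauge_shift// gauge_shift_opp//.
rewrite -/(P x) -/(Q x) in h1 h2 h3 *.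
have E1 : 1 - P x / (1 - P x * t) * - t = (1 - P x * t)^-1 by field; rewrite gt_eqF.
have E2 : 1 + Q x / (1 + Q x * t) * - t = (1 + Q x * t)^-1 by field; rewrite gt_eqF.
split=> //.
- rewrite /chord_far E1 E2 !invr_gt0 h1 h2 /= normrN.
  have -> : e * (1 + (Q x / (1 + Q x * t) - P x / (1 - P x * t)) / 2 * - t) =
    e * (1 + (Q x - P x) / 2 * t) / ((1 - P x * t) * (1 + Q x * t)).
    by field; rewrite !gt_eqF.
  have -> : (P x / (1 - P x * t) + Q x / (1 + Q x * t)) / 2 * `|t| =
    (P x + Q x) / 2 * `|t| / ((1 - P x * t) * (1 + Q x * t)).
    by field; rewrite !gt_eqF.
  by rewrite ltr_pM2r// invr_gt0 mulr_gt0.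
- rewrite /rho/= /P /Q gauge_shift// gauge_shift_opp//.
  rewrite -/(P x) -/(Q x) E1 E2 -invfM normfV powRV// normr_gt0.
  by rewrite mulf_neq0 ?gt_eqF.
Qed.

Let swK z : sw (sw z) = z.
Proof. by case: z => x t; rewrite /sw/= opprK scaleNr addrK. Qed.

Let far_swap e z : far e (sw z) = far e z.
Proof.
(* Since [far] takes the values 0 and 1 and [sw] is an involution, one implication is enough. *)
have H w : far e w != 0 -> far e (sw w) = 1 /\ far e w = 1.
  rewrite /far !indicE; case: (boolP (w.1 \in O)) => [/set_mem Ow|_]; last by rewrite mul0r eqxx.
  rewrite mul1r; case: (boolP (chord_far _ _ _ _)) => [cw _|_]; last by rewrite eqxx.
  by have [Os -> _] := far_swap1 Ow cw; rewrite mem_set// mulr1.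
have [z0|/H[-> ->]//] := eqVneq (far e z) 0.
have [->//|/H[]] := eqVneq (far e (sw z)) 0.
by rewrite swK z0 => /esym/eqP; rewrite oner_eq0.
Qed.

Let far_rho_swap e z : far e z * rho (sw z) = far e z * (rho z)^-1.
Proof.
rewrite /far !indicE; case: (boolP (z.1 \in O)) => [/set_mem Oz|_]; last by rewrite !mul0r.
rewrite mul1r; case: (boolP (chord_far _ _ _ _)) => [cz|_]; last by rewrite !mul0r.
by have [_ _ ->] := far_swap1 Oz cz.
Qed.

Let far_ge0 e z : 0 <= far e z.
Proof. by rewrite mulr_ge0. Qed.

Let rho_gt0 e z : far e z != 0 -> 0 < rho z.
Proof.
rewrite /far indicE; case: (boolP (z.1 \in O)) => [/set_mem Oz|_]; last by rewrite mul0r eqxx.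
rewrite mul1r; case: (boolP (chord_far _ _ _ _)) => [/and3P[h1 h2 _] _|_]; last by rewrite eqxx.
by rewrite powR_gt0// normr_gt0 mulf_neq0 ?gt_eqF.
Qed.

Let mO : measurable O := open_rV_measurable oO.

Let mP : measurable_fun [set: 'rV[R]_N * R] (fun z => P z.1).
Proof.
have mg := measurable_gauge oO.
apply: (measurableT_comp mg (g := fun z : 'rV[R]_N * R => (z.1, h))).
by apply: measurable_fun_pair.
Qed.

Let mQ : measurable_fun [set: 'rV[R]_N * R] (fun z => Q z.1).
Proof.
have mg := measurable_gauge oO.
apply: (measurableT_comp mg (g := fun z : 'rV[R]_N * R => (z.1, - h))).
by apply: measurable_fun_pair.
Qed.

Let mfar e : measurable_fun [set: 'rV[R]_N * R] (far e).
Proof.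
have m1 : measurable_fun [set: 'rV[R]_N] (\1_O : _ -> R) by exact: measurable_indic.
apply: measurable_funM; first exact: (measurableT_comp m1 measurable_fst).
by apply: measurable_bool_natr; exact: measurable_chord_far.
Qed.

Let mrho : measurable_fun [set: 'rV[R]_N * R] rho.
Proof.
apply: (measurableT_comp (measurable_powR _)); apply: measurableT_comp; first exact: normr_measurable.
apply: measurable_funM.
  by apply: measurable_funB => //; exact: measurable_funM.
by apply: measurable_funD => //; exact: measurable_funM.
Qed.

Let ker (z : 'rV[R]_N * R) : R := `|z.2| `^ (- (1 + al)).

Let mker : measurable_fun [set: 'rV[R]_N * R] ker.
Proof.
by apply: (measurableT_comp (measurable_powR _)); apply: measurableT_comp => //; exact: normr_measurable.
Qed.

Let ker_swap z : ker (sw z) = ker z.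
Proof. by rewrite /ker/= normrN. Qed.

Let msw : measurable_fun [set: 'rV[R]_N * R] sw.
Proof.
apply: measurable_fun_pair; last exact: measurable_funN.
apply: measurable_rV_add_fun => //; exact: measurable_rV_scale_fun.
Qed.

Definition energy_dir : \bar R := (\int[leb]_x \int[mu]_t
  (\1_O x * \1_O (x + t *: h) * (phi x - phi (x + t *: h)) ^+ 2 * `|t| `^ (- (1 + al)))%:E)%E.

Definition mass_dir : \bar R := (\int[leb]_x
  (\1_O x * (phi x ^+ 2 * (gauge O x h + gauge O x (- h)) `^ al))%:E)%E.

Let A (e : R) := (\int[leb]_x \int[mu]_t (far e (x, t) * ker (x, t) * phi x ^+ 2)%:E)%E.
Let B (e : R) := (\int[leb]_x \int[mu]_t (far e (x, t) * ker (x, t) * phi x ^+ 2 * rho (x, t))%:E)%E.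

Let mint (f : 'rV[R]_N * R -> R) : measurable_fun [set: 'rV[R]_N * R] f -> (forall z, 0 <= f z) ->
  measurable_fun [set: 'rV[R]_N] (fun x => \int[mu]_t (f (x, t))%:E)%E.
Proof.
move=> mf f0; apply: (measurable_fun_fubini_tonelli_F (m2 := mu) (EFin \o f)).
  exact/measurable_EFinP.
by move=> z; rewrite lee_fin.
Qed.

Let integral2D (f g : 'rV[R]_N * R -> R) : measurable_fun [set: 'rV[R]_N * R] f ->
  measurable_fun [set: 'rV[R]_N * R] g -> (forall z, 0 <= f z) -> (forall z, 0 <= g z) ->
  (\int[leb]_x \int[mu]_t (f (x, t) + g (x, t))%:E =
   \int[leb]_x \int[mu]_t (f (x, t))%:E + \int[leb]_x \int[mu]_t (g (x, t))%:E)%E.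
Proof.
move=> mf mg f0 g0.
have msec (k : 'rV[R]_N * R -> R) : measurable_fun [set: 'rV[R]_N * R] k ->
    forall x, measurable_fun [set: R] (fun t => (k (x, t))%:E).
  by move=> mk x; apply/measurable_EFinP; exact: (measurableT_comp mk (pair1_measurable x)).
transitivity (\int[leb]_x (\int[mu]_t (f (x, t))%:E + \int[mu]_t (g (x, t))%:E))%E.
  apply: eq_integral => x _; under eq_integral do rewrite EFinD.
  rewrite ge0_integralD//.
  - by move=> t _; rewrite lee_fin.
  - exact: msec.
  - by move=> t _; rewrite lee_fin.
  - exact: msec.
rewrite ge0_integralD//.
- by move=> x _; apply: integral_ge0 => t _; rewrite lee_fin.
- exact: mint.
- by move=> x _; apply: integral_ge0 => t _; rewrite lee_fin.
- exact: mint.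
Qed.

(** Symmetrizes an integral, so that a pointwise inequality between both end points can be applied
    under it. *)
Let twice (f : 'rV[R]_N * R -> R) : measurable_fun [set: 'rV[R]_N * R] f -> (forall z, 0 <= f z) ->
  (\int[leb]_x \int[mu]_t (f (x, t) + f (sw (x, t)))%:E =
    2%:E * \int[leb]_x \int[mu]_t (f (x, t))%:E)%E.
Proof.
move=> mf f0.
have mfs : measurable_fun [set: 'rV[R]_N * R] (f \o sw) by exact: measurableT_comp.
rewrite (integral2D mf mfs)//.
  rewrite [X in (_ + X)%E](ge0_integral_swap h mf f0).
  by rewrite -[in LHS](mul1e (integral _ _ _)) -ge0_muleDl.
by move=> z; exact: f0.
Qed.

Let mass2 : \bar R := (\int[leb]_x (\1_O x * (phi x ^+ 2 * ((P x + Q x) / 2) `^ al))%:E)%E.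

Let mass0 x : 0 <= \1_O x * (phi x ^+ 2 * ((P x + Q x) / 2) `^ al).
Proof. by rewrite mulr_ge0// mulr_ge0 ?sqr_ge0 ?powR_ge0. Qed.

Let fk0 e z : 0 <= far e z * ker z * phi z.1 ^+ 2.
Proof. by rewrite mulr_ge0 ?sqr_ge0// mulr_ge0// powR_ge0. Qed.

Let mphi1 : measurable_fun [set: 'rV[R]_N * R] (fun z => phi z.1).
Proof. exact: (measurableT_comp mphi measurable_fst). Qed.

(** The integrated form of a^2 + b^2 <= (a - b)^2 + rho a^2 + b^2 / rho. The term [B] stays on the
    right so that no difference of possibly infinite integrals is formed. *)
Let main_e e : (2%:E * A e <= energy_dir + 2%:E * B e)%E.
Proof.
have mO1 : measurable_fun [set: 'rV[R]_N] (\1_O : _ -> R) by exact: measurable_indic.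
pose f1 z := far e z * ker z * phi z.1 ^+ 2.
pose f2 z := far e z * ker z * phi z.1 ^+ 2 * rho z.
pose D z := \1_O z.1 * \1_O (sw z).1 * (phi z.1 - phi (sw z).1) ^+ 2 * ker z.
have ker0 z : 0 <= ker z by exact: powR_ge0.
have mf1 : measurable_fun [set: 'rV[R]_N * R] f1.
  by apply: measurable_funM; [exact: measurable_funM|exact: measurable_funX].
have mf2 : measurable_fun [set: 'rV[R]_N * R] f2 by exact: measurable_funM.
have mD : measurable_fun [set: 'rV[R]_N * R] D.
  have m1 : measurable_fun [set: 'rV[R]_N * R] (fun z => (sw z).1).
    exact: (measurableT_comp measurable_fst msw).
  apply: measurable_funM => //; apply: measurable_funM; first apply: measurable_funM.
  - exact: (measurableT_comp mO1 measurable_fst).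
  - exact: (measurableT_comp mO1 m1).
  - by apply: measurable_funX; apply: measurable_funB => //; exact: measurableT_comp mphi m1.
have f10 z : 0 <= f1 z by exact: fk0.
have f20 z : 0 <= f2 z by rewrite mulr_ge0// ?powR_ge0.
have D0 z : 0 <= D z by rewrite mulr_ge0// mulr_ge0 ?sqr_ge0// mulr_ge0.
rewrite -(twice mf1 f10) -(twice mf2 f20) -[energy_dir]/(\int[leb]_x \int[mu]_t (D (x, t))%:E)%E.
have mfs (f : 'rV[R]_N * R -> R) : measurable_fun [set: 'rV[R]_N * R] f -> measurable_fun [set: 'rV[R]_N * R] (fun z => f z + f (sw z) : R).
  by move=> mf; apply: measurable_funD => //; exact: measurableT_comp.
have fs0 (f : 'rV[R]_N * R -> R) : (forall z, 0 <= f z) -> forall z : 'rV[R]_N * R, 0 <= (f z + f (sw z) : R).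
  by move=> f0 z; rewrite addr_ge0.
rewrite -(integral2D mD (mfs _ mf2))//; last exact: fs0.
have key z : f1 z + f1 (sw z) <= D z + (f2 z + f2 (sw z)).
  rewrite /f1 /f2 !far_swap !ker_swap.
  have -> : far e z * ker z * phi (sw z).1 ^+ 2 * rho (sw z) =
    far e z * rho (sw z) * (ker z * phi (sw z).1 ^+ 2) by ring.
  rewrite far_rho_swap.
  have [->|fz] := eqVneq (far e z) 0; first by rewrite !mul0r !addr0.
  have r0 := rho_gt0 fz.
  have [f1z O1 O2] : [/\ far e z = 1, \1_O z.1 = 1 :> R & \1_O (sw z).1 = 1 :> R].
    move: fz; rewrite /far !indicE; case: (boolP (z.1 \in O)) => [/set_mem Oz|_]; last by rewrite mul0r eqxx.
    rewrite mul1r; case: (boolP (chord_far _ _ _ _)) => [cz|_]; last by rewrite eqxx.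
    by have [Os _ _] := far_swap1 Oz cz; rewrite mem_set.
  rewrite /D O1 O2 f1z !mul1r.
  move: (phi z.1) (phi (sw z).1) (ker z) (ker0 z) (rho z) r0 => a b k k0 r r0.
  have -> : (a - b) ^+ 2 * k + (k * a ^+ 2 * r + r^-1 * (k * b ^+ 2)) =
    k * a ^+ 2 + k * b ^+ 2 + k * ((a * r - b) ^+ 2 / r) by field; rewrite gt_eqF.
  by rewrite lerDl mulr_ge0// divr_ge0 ?sqr_ge0// (ltW r0).
apply: ge0_le_integral => //.
- by move=> x _; apply: integral_ge0 => t _; rewrite lee_fin; exact: (fs0 _ f10 (x, t)).
- exact: (mint (mfs _ mf1) (fs0 _ f10)).
- apply: (mint (f := fun z => D z + (f2 z + f2 (sw z)))).
    by apply: measurable_funD => //; exact: mfs.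
  by move=> z; rewrite addr_ge0//; exact: fs0.
move=> x _; apply: ge0_le_integral => //.
- by move=> t _; rewrite lee_fin; exact: (fs0 _ f10 (x, t)).
- by apply/measurable_EFinP; exact: (measurableT_comp (mfs _ mf1) (pair1_measurable x)).
- apply/measurable_EFinP.
  apply: (measurableT_comp (f := fun z => D z + (f2 z + f2 (sw z))) _ (pair1_measurable x)).
  by apply: measurable_funD => //; exact: mfs.
- by move=> t _; rewrite lee_fin; exact: key.
Qed.

Let Ie e : \bar R := (\int[mu]_(z in `[e, 1%R]) (chord_kernel al z)%:E)%E.

Let mmass2 : measurable_fun [set: 'rV[R]_N] (fun x => \1_O x * (phi x ^+ 2 * ((P x + Q x) / 2) `^ al)).
Proof.
have mg := measurable_gauge oO.
apply: measurable_funM; first exact: measurable_indic.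
apply: measurable_funM; first exact: measurable_funX.
apply: (measurableT_comp (measurable_powR _)); apply: measurable_funM => //.
apply: measurable_funD.
  by apply: (measurableT_comp mg (g := fun x => (x, h))); exact: measurable_fun_pair.
by apply: (measurableT_comp mg (g := fun x => (x, - h))); exact: measurable_fun_pair.
Qed.

Let A_ge e : 0 < e < 1 -> 0 <= 2 * e `^ (- al) - 2 `^ al ->
  (((2 * e `^ (- al) - 2 `^ al) / al)%:E * mass2 <= A e)%E.
Proof.
move=> e01 c0; rewrite -ge0_integralZl//; last 3 first.
- exact/measurable_EFinP.
- by move=> x _; rewrite lee_fin; exact: mass0.
- by rewrite lee_fin divr_ge0// (le_trans _ (ltW al1)).
have msec x : measurable_fun [set: R] (fun t => far e (x, t) * ker (x, t)).
  apply: (measurableT_comp (f := fun z => far e z * ker z) _ (pair1_measurable x)).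
  exact: measurable_funM.
apply: ge0_le_integral => //.
- by move=> x _; rewrite -EFinM lee_fin mulr_ge0 ?mass0// divr_ge0// (le_trans _ (ltW al1)).
- by apply/measurable_EFinP; exact: measurable_funM.
- apply: (mint (f := fun z => far e z * ker z * phi z.1 ^+ 2)).
    by apply: measurable_funM; [exact: measurable_funM|exact: measurable_funX].
  exact: fk0.
move=> x _; rewrite indicE; case: (boolP (x \in O)) => [/set_mem Ox|_]; last first.
  by rewrite mul0r mule0; apply: integral_ge0 => t _; rewrite lee_fin; exact: (fk0 e (x, t)).
rewrite mul1r -EFinM [X in (X%:E <= _)%E](_ : _ = phi x ^+ 2 *
   (((P x + Q x) / 2) `^ al * ((2 * e `^ (- al) - 2 `^ al) / al))); last by ring.
rewrite EFinM; under eq_integral do rewrite mulrC EFinM.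
rewrite ge0_integralZl ?lee_fin ?sqr_ge0//; last 2 first.
- apply/measurable_EFinP; exact: msec.
- by move=> t _; rewrite lee_fin mulr_ge0// ?powR_ge0.
apply: lee_wpmul2l; first by rewrite lee_fin ?sqr_ge0.
under eq_integral do rewrite (farE e (z := (x, _)) Ox).
exact: (integral_chord_far_powR_ge al1 (hP Ox) (hQ Ox) e01).
Qed.

Let B_eq e : 0 < e < 1 -> (B e = 2%:E * Ie e * mass2)%E.
Proof.
move=> e01.
have I0 : (0 <= Ie e)%E by apply: integral_ge0 => z _; rewrite lee_fin chord_kernel_ge0.
rewrite -ge0_integralZl//; last 3 first.
- exact/measurable_EFinP.
- by move=> x _; rewrite lee_fin; exact: mass0.
- by rewrite mule_ge0.
apply: eq_integral => x _; rewrite indicE; case: (boolP (x \in O)) => [/set_mem Ox|nOx]; last first.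
  rewrite mul0r mule0; apply: integral0_eq => t _.
  by rewrite /far indicE (negbTE nOx) !mul0r.
transitivity ((phi x ^+ 2)%:E * \int[mu]_t ((chord_far (P x) (Q x) e t)%:R * (ker (x, t) * rho (x, t)))%:E)%E.
  rewrite -ge0_integralZl ?lee_fin ?sqr_ge0//.
  - by apply: eq_integral => t _; rewrite (farE e (z := (x, t)) Ox) -EFinM; congr EFin; ring.
  - apply/measurable_EFinP; apply: measurable_funM.
      by apply: measurable_bool_natr; exact: measurable_chord_far.
    by apply: measurable_funM; [exact: (measurableT_comp mker (pair1_measurable x))|
      exact: (measurableT_comp mrho (pair1_measurable x))].
  - by move=> t _; rewrite lee_fin !mulr_ge0// ?powR_ge0.
rewrite (integral_chord_far_ground_state al1 (hP Ox) (hQ Ox) e01) mul1r -/(Ie e).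
by rewrite [(2 * _)%R%:E]EFinM [in RHS]EFinM [RHS]muleACA -[RHS]muleA -[X in (_ * X)%E = _]muleA [LHS]muleCA [in RHS](muleC (Ie e)).
Qed.

Let mass2E : mass2 = ((2 `^ (- al))%:E * mass_dir)%E.
Proof.
have mm : measurable_fun [set: 'rV[R]_N] (fun x => \1_O x * (phi x ^+ 2 * (P x + Q x) `^ al)).
  have mg := measurable_gauge oO.
  apply: measurable_funM; first exact: measurable_indic.
  apply: measurable_funM; first exact: measurable_funX.
  apply: (measurableT_comp (measurable_powR _)); apply: measurable_funD.
    by apply: (measurableT_comp mg (g := fun x => (x, h))); exact: measurable_fun_pair.
  by apply: (measurableT_comp mg (g := fun x => (x, - h))); exact: measurable_fun_pair.
rewrite /mass_dir -ge0_integralZl//; last 2 first.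
- exact/measurable_EFinP.
- by move=> x _; rewrite lee_fin mulr_ge0// mulr_ge0 ?sqr_ge0 ?powR_ge0.
apply: eq_integral => x _; rewrite -EFinM; congr EFin.
have PQ0 : 0 <= P x + Q x by rewrite addr_ge0 ?gauge_ge0.
by rewrite powRM// powRV// powRN; ring.
Qed.

(** The boundary term at e is replaced by e^(- al), exactly the amount that cancels against the one
    in [A_ge]. *)
Let Ie_bound e : 0 < e < 1 -> (al%:E * Ie e + \int[mu]_(z in `[e, 1%R]) (chord_remainder al z)%:E <=
  (e `^ (- al))%:E)%E.
Proof.
move=> e01; rewrite (integral_chord_kernel al1 e01) lee_fin -[leRHS]mulr1 ler_wpM2l ?powR_ge0//.
have /andP[e0 e1] := e01.
have : (1 - e ^+ 2) `^ ((al + 1) / 2) <= 1 `^ ((al + 1) / 2).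
  have al2' : 0 <= (al + 1) / 2 by rewrite divr_ge0 ?addr_ge0 ?(le_trans _ (ltW al1)).
  by apply: ge0_ler_powR; rewrite ?nnegrE//; nra.
by rewrite powR1.
Qed.

(** After cancellation of e^(- al), the inequality is read as an upper bound, uniform in e, for the
    integral of [chord_remainder] over [e, 1]. Monotone convergence as e tends to 0 and the value of
    the full integral then give the bound on the energy. *)
Lemma hardy_dir : (mass_dir < +oo)%E -> ((2 * hardy1 al)%:E * mass_dir <= energy_dir)%E.
Proof.
move=> moo.
have al0 : 0 < al := lt_trans ltr01 al1.
have E0 : (0 <= energy_dir)%E.
  apply: integral_ge0 => x _; apply: integral_ge0 => t _; rewrite lee_fin.
  by rewrite mulr_ge0 ?powR_ge0// mulr_ge0 ?sqr_ge0// mulr_ge0.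
have M0 : (0 <= mass2)%E by apply: integral_ge0 => x _; rewrite lee_fin mass0.
have c0 : 0 < 2 `^ al :> R by exact: powR_gt0.
have [m mE m0] : exists2 m : R, mass_dir = (2 `^ al * m)%:E & mass2 = m%:E.
  by apply: (ereal_scale_fin_num c0 _ moo M0); rewrite -powRN; exact: mass2E.
have m_ge0 : 0 <= m by rewrite -lee_fin -m0.
case: (energy_dir) (fun e => @main_e e) E0 => [r| |] Er E0 //; last by rewrite leey.
rewrite lee_fin in E0.
rewrite mE -EFinM lee_fin.
have [m1|m1] := eqVneq m 0; first by rewrite m1 mulr0 mulr0.
have mp : 0 < m by rewrite lt_neqAle eq_sym m1.
(* The inequality 2 A <= r + 2 B, with the bounds for A and B inserted, solved for the integral of
   [chord_remainder]. *)
pose X := (r + 2 / al * 2 `^ al * m) / (4 / al * m).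
have bd e : 0 < e < 1 -> e <= 2^-1 ->
    (\int[mu]_(z in `[e, 1%R]) (chord_remainder al z)%:E <= X%:E)%E.
  move=> e01 e2; have /andP[e0 e1] := e01.
  (* For e <= 1 / 2 one has e^(- al) >= 2^al; [A_ge] asks for a nonnegative coefficient. *)
  have ce : 0 <= 2 * e `^ (- al) - 2 `^ al.
    rewrite subr_ge0 -[2 `^ al]mul1r ler_pM// ?powR_ge0 ?ler1n//.
    rewrite powRN -powRV//; apply: ge0_ler_powR; rewrite ?nnegrE ?invr_ge0 ?(ltW e0) ?(ltW al0)//.
    by rewrite -[leLHS]invrK lef_pV2 ?posrE ?invr_gt0.
  have := Er e; rewrite B_eq// m0 => H.
  have := A_ge e01 ce; rewrite m0 => HA.
  have := Ie_bound e01.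
  have I0 : (0 <= Ie e)%E by apply: integral_ge0 => z _; rewrite lee_fin chord_kernel_ge0.
  have L0 : (0 <= \int[mu]_(z in `[e, 1%R]) (chord_remainder al z)%:E)%E.
    by apply: integral_ge0 => z _; rewrite lee_fin chord_remainder_ge0.
  case: (Ie e) I0 H => [i| |] I0 H //; last first.
    by rewrite gt0_muley ?lte_fin// addye// -ltNye (lt_le_trans _ L0).
  case: (\int[mu]_(z in _) _)%E L0 => [l| |] L0 //.
  rewrite -EFinM -EFinD lee_fin => Hil; rewrite lee_fin /X.
  have H2 : ((2 * ((2 * e `^ (- al) - 2 `^ al) / al * m))%:E <= (r + 2 * (2 * i * m))%:E)%E.
    rewrite EFinD [(2 * (2 * i * m))%:E]EFinM ![(2 * i * m)%:E]EFinM [(2 * i)%:E]EFinM.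
    apply: le_trans H; rewrite EFinM; apply: lee_wpmul2l; first by rewrite lee_fin.
    by rewrite EFinM.
  move: H2; rewrite lee_fin => H2.
  have p4 : 0 < 4 / al * m by rewrite mulr_gt0// divr_gt0.
  rewrite ler_pdivlMr//.
  have H3 : (al * i + l) * (4 / al * m) <= e `^ (- al) * (4 / al * m) by rewrite ler_wpM2r ?(ltW p4).
  have E1 : al * i * (4 / al * m) = 4 * i * m by field; rewrite gt_eqF.
  have E2 : 2 * ((2 * e `^ (- al) - 2 `^ al) / al * m) =
    e `^ (- al) * (4 / al * m) - 2 / al * 2 `^ al * m by field; rewrite gt_eqF.
  rewrite mulrDl E1 in H3; rewrite E2 in H2; lra.
have U : \bigcup_n `[(n.+2%:R^-1 : R), 1]%classic = `]0, 1]%classic.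
  apply/seteqP; split=> [y [n _] /=|y /=]; rewrite !in_itv/=.
    by move=> /andP[ny ->]; rewrite andbT (lt_le_trans _ ny)// invr_gt0.
  move=> /andP[y0 y1]; exists (Num.truncn y^-1) => //=; rewrite in_itv/= y1 andbT.
  rewrite -[leRHS]invrK lef_pV2 ?posrE ?invr_gt0//.
  by rewrite ltW// (lt_trans (truncnS_gt _))// ltr_nat.
have cvl : (\int[mu]_(z in `[n.+2%:R^-1%R, 1%R]) (chord_remainder al z)%:E)%E @[n --> \oo] -->
    (\int[mu]_(z in `]0%R, 1%R]) (chord_remainder al z)%:E)%E.
  rewrite -U; apply: ge0_nondecreasing_set_cvg_integral => //.
  - apply/nondecreasing_seqP => n; apply/subsetPset => y /=; rewrite !in_itv/=.
      move=> /andP[ny ->]; rewrite andbT (le_trans _ ny)// lef_pV2 ?posrE// ler_nat//.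
  - by move=> n; apply: measurable_funTS; apply/measurable_EFinP; exact: measurable_chord_remainder.
  - by move=> n z _; rewrite lee_fin chord_remainder_ge0.
have : (\int[mu]_(z in `]0%R, 1%R]) (chord_remainder al z)%:E <= X%:E)%E.
  apply: (cvge_to_le cvl).
  apply: nearW => n; apply: bd.
    by rewrite invr_gt0 ltr0n/= invf_lt1 ?ltr1n// ltr0n.
  by rewrite lef_pV2 ?posrE// ler_nat.
have -> : (\int[mu]_(z in `]0%R, 1%R]) (chord_remainder al z)%:E =
    \int[mu]_(z in `]0%R, 1%R[) (chord_remainder al z)%:E)%E.
  rewrite integral_itv_bndo_bndc//; apply: measurable_funTS; apply/measurable_EFinP.
  exact: measurable_chord_remainder.
have := integral_chord_remainder al1 al2.
set G := Gamma _ * _ / _.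
case: (\int[mu]_(z in _) _)%E => [l| |] //; rewrite /hardy1 -/G; last by rewrite gt0_muleNy ?lte_fin.
rewrite -EFinM => -[lG]; rewrite lee_fin /X ler_pdivlMr; last by rewrite mulr_gt0 ?divr_gt0.
rewrite -lG powRN => Hl.
have -> : 2 * (((2 `^ al)^-1 * (2 * l) - 1) / al) * (2 `^ al * m) =
  l * (4 / al * m) - 2 / al * 2 `^ al * m by field; rewrite !gt_eqF.
lra.
Qed.

End fixed_direction.
End hardy_direction.

(** * Gaussian averages over directions *)

Section gauss_plane.
Context {R : realType}.
Local Notation mu := (@lebesgue_measure R).
Implicit Types f : R -> \bar R.

Lemma gauss_funZ_gt0 (t : R) : 0 < gauss_fun t.
Proof. exact: expR_gt0. Qed.

Lemma integral_gauss_rescale (a r : R) f : r = `|a| -> measurable_fun [set: R] f -> (forall y, (0 <= f y)%E) ->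
  (\int[mu]_t ((gauss_fun t)%:E * f (a * t)%R) = \int[mu]_t ((gauss_fun t)%:E * f (r * t)%R))%E.
Proof.
move=> -> mf f0; have [a0|a0] := leP 0 a; first by rewrite ger0_norm.
rewrite (ltr0_norm a0).
have mg : measurable_fun [set: R] (fun t : R => ((gauss_fun t)%:E * f (a * t)%R)%E).
  apply: emeasurable_funM; first by apply/measurable_EFinP; exact: measurable_gauss_fun.
  by apply: measurableT_comp => //; exact: measurable_funM.
pose F (t : R) := ((gauss_fun t)%:E * f (a * t)%R)%E.
have n1 : (-1 : R) != 0 by rewrite oppr_eq0 oner_eq0.
have F0 t : (0 <= F t)%E by rewrite mule_ge0// lee_fin ltW// gauss_funZ_gt0.
have E := ge0_integral_scale n1 mg F0.
rewrite normrN1 invr1 mul1e in E; rewrite -[LHS]/(\int[mu]_t F t)%E -E.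
by apply: eq_integral => t _; rewrite /F /gauss_fun mulN1r sqrrN mulrN mulNr.
Qed.

(* The rotation invariance of the Gaussian measure of the plane, through the identity
   [t^2 + (y - a t)^2 / b^2 = (r / b)^2 (t - y a / r^2)^2 + (y / r)^2] for [r^2 = a^2 + b^2]. *)
Lemma integral_gauss_plane (a b : R) f : measurable_fun [set: R] f -> (forall y, (0 <= f y)%E) ->
  (\int[mu]_t \int[mu]_s ((gauss_fun t * gauss_fun s)%:E * f (a * t + b * s)%R) =
   (Num.sqrt pi)%:E * \int[mu]_s ((gauss_fun s)%:E * f (Num.sqrt (a ^+ 2 + b ^+ 2) * s)%R))%E.
Proof.
move=> mf f0.
have mg : measurable_fun [set: R] (@gauss_fun R) := @measurable_gauss_fun R.
have g0 t : 0 <= gauss_fun t :> R := ltW (gauss_funZ_gt0 t).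
(* For b = 0 the substitution y = a t + b s in s degenerates. *)
have [->|b0] := eqVneq b 0.
  rewrite expr0n addr0 sqrtr_sqr -(@integral_gauss_rescale a)//.
  have mh : measurable_fun [set: R] (fun t : R => ((gauss_fun t)%:E * f (a * t)%R)%E).
    apply: emeasurable_funM; first exact/measurable_EFinP.
    by apply: measurableT_comp => //; exact: measurable_funM.
  rewrite -ge0_integralZl//; last by move=> t _; rewrite mule_ge0// lee_fin.
  apply: eq_integral => t _; rewrite -integralT_gauss muleC.
  rewrite -ge0_integralZl//; last 3 first.
  - exact/measurable_EFinP.
  - by move=> s _; rewrite lee_fin.
  - by rewrite mule_ge0// lee_fin.
  by apply: eq_integral => s _; rewrite mul0r addr0 EFinM muleAC.
set r := Num.sqrt (a ^+ 2 + b ^+ 2).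
have rr : r ^+ 2 = a ^+ 2 + b ^+ 2 by rewrite sqr_sqrtr// addr_ge0 ?sqr_ge0.
have b2 : 0 < b ^+ 2 by rewrite exprn_even_gt0.
have r0 : 0 < r by rewrite sqrtr_gt0 ltr_wpDl ?sqr_ge0.
pose K (z : R * R) : \bar R := ((gauss_fun z.1 * gauss_fun ((z.2 - a * z.1) / b))%:E * f z.2)%E.
have mK : measurable_fun [set: R * R] K.
  apply: emeasurable_funM; last exact: (measurableT_comp mf).
  apply/measurable_EFinP; apply: measurable_funM; first exact: (measurableT_comp mg measurable_fst).
  apply: (measurableT_comp mg); apply: measurable_funM => //; apply: measurable_funB => //.
  exact: measurable_funM.
have K0 z : (0 <= K z)%E by rewrite mule_ge0// lee_fin mulr_ge0.
transitivity (\int[mu]_t ((`|b|^-1)%:E * \int[mu]_y K (t, y)))%E.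
  apply: eq_integral => t _.
  have mKt := measurableT_comp mK (pair1_measurable t).
  have mKs : measurable_fun [set: R] (fun y => K (t, y + a * t)).
    by apply: (measurableT_comp mKt); exact: measurable_funD.
  have E1 := ge0_integral_shift (a * t) mKt (fun y => K0 (t, y)).
  have E2 := ge0_integral_scale b0 mKs (fun y => K0 (t, y + a * t)).
  rewrite -[X in (_ * X)%E]E1 -[RHS]E2.
  apply: eq_integral => s _; rewrite /K/= addrK mulrAC mulfV// mul1r.
  by rewrite [(b * s + _)%R]addrC.
rewrite ge0_integralZl//; last 2 first.
- exact: (measurable_fun_fubini_tonelli_F (m2 := mu) K mK K0).
- by move=> t _; exact: integral_ge0.
have TK := @fubini_tonelli _ _ _ _ _ mu mu K mK K0.
rewrite TK/=; clear TK mK K0.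
pose F y : \bar R := ((gauss_fun (r^-1 * y))%:E * f y)%E.
have mF : measurable_fun [set: R] F.
  apply: emeasurable_funM; last exact: mf.
  apply/measurable_EFinP; apply: (measurableT_comp mg); exact: measurable_funM.
have F0 y : (0 <= F y)%E by apply: mule_ge0; [rewrite lee_fin; exact: g0|exact: f0].
transitivity (`|b|^-1%:E * \int[mu]_y ((`|b| / r * Num.sqrt pi)%:E * F y))%E.
  congr (_ * _)%E; apply: eq_integral => y _.
  transitivity (f y * (gauss_fun (r^-1 * y))%:E *
     \int[mu]_t (gauss_fun ((r / b) * (t + - (y * a / r ^+ 2))))%:E)%E.
    rewrite -ge0_integralZl//; last 3 first.
    - apply/measurable_EFinP; apply: (measurableT_comp mg); apply: measurable_funM => //.
      exact: measurable_funD.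
    - by move=> t _; rewrite lee_fin.
    - by rewrite mule_ge0// lee_fin.
    apply: eq_integral => t _; rewrite /K/= muleC -muleA; congr (_ * _)%E.
    rewrite -EFinM; congr EFin; rewrite /gauss_fun -!expRD; congr expR.
    rewrite -!opprD; congr (- _); rewrite !exprMn !exprVn.
    have r20 : r ^+ 2 != 0 by rewrite gt_eqF// exprn_gt0.
    have -> : r ^+ 2 = a ^+ 2 + b ^+ 2 by [].
    by field; rewrite -rr r20 b0.
  pose G t : \bar R := (gauss_fun ((r / b) * t))%:E.
  have mG : measurable_fun [set: R] G.
    by apply/measurable_EFinP; apply: (measurableT_comp mg); exact: measurable_funM.
  rewrite (@ge0_integral_shift _ G)//; last by move=> t; rewrite lee_fin.
  rewrite (@ge0_integral_scale _ (EFin \o gauss_fun) (r / b))//; last 2 first.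
  - by rewrite mulf_neq0 ?invr_eq0// gt_eqF.
  - exact/measurable_EFinP.
  rewrite [X in (_ * (_ * X))%E]integralT_gauss normrM normfV (gtr0_norm r0) invf_div -EFinM.
  by rewrite /F muleC [(f y * _)%E]muleC.
rewrite ge0_integralZl//; last first.
  by rewrite lee_fin mulr_ge0 ?sqrtr_ge0// divr_ge0// (ltW r0).
have r1 : r != 0 by rewrite gt_eqF.
transitivity ((Num.sqrt pi)%:E * (`|r|^-1%:E * \int[mu]_y F y))%E.
  rewrite !muleA -!EFinM (gtr0_norm r0); congr (_%:E * _)%E; field.
  by rewrite r1 normr_eq0 b0.
have E := ge0_integral_scale r1 mF F0.
rewrite -[X in (_ * X)%E]E; congr (_ * _)%E.
by apply: eq_integral => s _; rewrite /F mulrA mulVf// mul1r.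
Qed.

End gauss_plane.

Section gauss_rV.
Context {R : realType}.
Local Notation mu := (@lebesgue_measure R).

Definition gauss_rV n (h : 'rV[R]_n) : R := expR (- (enorm h ^+ 2)).

Definition dot n (h e : 'rV[R]_n) : R := \sum_(i < n) h 0 i * e 0 i.

Lemma gauss_rV_ge0 n (h : 'rV[R]_n) : 0 <= gauss_rV h.
Proof. exact: expR_ge0. Qed.

Lemma gauss_rV_cons n t (v : 'rV[R]_n) : gauss_rV (rV_cons (t, v)) = gauss_fun t * gauss_rV v.
Proof.
rewrite /gauss_rV !sqr_enorm big_ord_recl rV_cons0 opprD expRD; congr (_ * expR (- _)).
by apply: eq_bigr => i _; rewrite rV_consS.
Qed.

Lemma measurable_gauss_rV n : measurable_fun [set: 'rV[R]_n] (@gauss_rV n).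
Proof.
apply: measurableT_comp => //; apply: measurableT_comp => //.
by apply: measurable_funX; exact: measurable_enorm.
Qed.

Lemma measurable_dot n (e : 'rV[R]_n) : measurable_fun [set: 'rV[R]_n] (fun h => dot h e).
Proof.
apply: measurable_sum => i; apply: measurable_funM => //; exact: measurable_coord.
Qed.

(** In the induction, [integral_gauss_plane] merges the first coordinate with the norm of the
    remaining ones. The factor sqrt pi on the left avoids the power n - 1 and lets the induction
    start at n = 0. *)
Lemma integral_gauss_dot n (e : 'rV[R]_n) (f : R -> \bar R) :
  measurable_fun [set: R] f -> (forall y, (0 <= f y)%E) ->
  ((Num.sqrt pi)%:E * \int[lebesgue_rV R n]_h ((gauss_rV h)%:E * f (dot h e)) =
   (Num.sqrt pi ^+ n)%:E * \int[mu]_s ((gauss_fun s)%:E * f (enorm e * s)%R))%E.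
Proof.
have mg : measurable_fun [set: R] (@gauss_fun R) := @measurable_gauss_fun R.
have g0 t : 0 <= gauss_fun t :> R := ltW (gauss_funZ_gt0 t).
have pi0 : 0 <= Num.sqrt pi :> R by rewrite sqrtr_ge0.
elim: n e f => [|n IH] e f mf f0.
  rewrite /= integral_dirac//=; last first.
    apply: emeasurable_funM; last exact: (measurableT_comp mf (measurable_dot e)).
    by apply/measurable_EFinP; exact: measurable_gauss_rV.
  rewrite diracT mul1e expr0 mul1e /dot big_ord0.
  have -> : gauss_rV (0 : 'rV[R]_0) = 1 by rewrite /gauss_rV sqr_enorm big_ord0 oppr0 expR0.
  have -> : enorm e = 0 by rewrite /enorm big_ord0 sqrtr0.
  rewrite mul1e -integralT_gauss muleC -ge0_integralZl//; last 2 first.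
  - exact/measurable_EFinP.
  - by move=> t _; rewrite lee_fin.
  by apply: eq_integral => t _; rewrite mul0r muleC.
pose e' : 'rV[R]_n := \row_j e 0 (lift 0 j); pose a := e 0 0; pose b := enorm e'.
have mft t : measurable_fun [set: R] (fun y => f (a * t + y)).
  by apply: (measurableT_comp mf); exact: measurable_funD.
pose K (z : R * 'rV[R]_n) : \bar R := ((gauss_rV z.2)%:E * f (a * z.1 + dot z.2 e')%R)%E.
have mK : measurable_fun [set: R * 'rV[R]_n] K.
  apply: emeasurable_funM.
    apply/measurable_EFinP; exact: (measurableT_comp (@measurable_gauss_rV n) measurable_snd).
  apply: (measurableT_comp mf); apply: measurable_funD; first exact: measurable_funM.
  exact: (measurableT_comp (measurable_dot e') measurable_snd).
have K0 z : (0 <= K z)%E.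
  by apply: mule_ge0; [rewrite lee_fin; exact: gauss_rV_ge0|exact: f0].
have mKt t : measurable_fun [set: 'rV[R]_n] (fun v => K (t, v)).
  exact: (measurableT_comp mK (pair1_measurable t)).
have mIK := measurable_fun_fubini_tonelli_F (m2 := lebesgue_rV R n) K mK K0.
pose L (z : R * R) : \bar R := ((gauss_fun z.2)%:E * f (a * z.1 + b * z.2)%R)%E.
have mL : measurable_fun [set: R * R] L.
  apply: emeasurable_funM.
    by apply/measurable_EFinP; exact: (measurableT_comp mg measurable_snd).
  by apply: (measurableT_comp mf); apply: measurable_funD; exact: measurable_funM.
have L0 z : (0 <= L z)%E by apply: mule_ge0; [rewrite lee_fin; exact: g0|exact: f0].
have mLt t : measurable_fun [set: R] (fun s => L (t, s)).
  exact: (measurableT_comp mL (pair1_measurable t)).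
have mIL := measurable_fun_fubini_tonelli_F (m2 := mu) L mL L0.
have IK0 t : (0 <= \int[lebesgue_rV R n]_v K (t, v))%E by apply: integral_ge0 => v _; exact: K0.
have IL0 t : (0 <= \int[mu]_s L (t, s))%E by apply: integral_ge0 => s _; exact: L0.
rewrite ge0_integral_rV_cons; last 2 first.
- apply: emeasurable_funM; first by apply/measurable_EFinP; exact: measurable_gauss_rV.
  exact: (measurableT_comp mf (measurable_dot e)).
- by move=> h; apply: mule_ge0; [rewrite lee_fin; exact: gauss_rV_ge0|exact: f0].
transitivity ((Num.sqrt pi)%:E * \int[mu]_t ((gauss_fun t)%:E * \int[lebesgue_rV R n]_v K (t, v)))%E.
  congr (_ * _)%E; apply: eq_integral => t _.
  rewrite -ge0_integralZl//; last first.
    by rewrite lee_fin.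
  apply: eq_integral => v _; rewrite gauss_rV_cons EFinM muleA; congr (_ * f _)%E.
  rewrite /dot big_ord_recl rV_cons0 mulrC; congr (_ + _).
  by apply: eq_bigr => i _; rewrite rV_consS mxE.
transitivity (\int[mu]_t ((gauss_fun t)%:E * ((Num.sqrt pi ^+ n)%:E * \int[mu]_s L (t, s))))%E.
  rewrite -ge0_integralZl//; last 2 first.
  - by apply: emeasurable_funM; [exact/measurable_EFinP|exact: mIK].
  - by move=> t _; apply: mule_ge0; [rewrite lee_fin; exact: g0|exact: IK0].
  apply: eq_integral => t _; rewrite muleCA; congr (_ * _)%E.
  exact: (IH e' (fun y => f (a * t + y)) (mft t) (fun y => f0 _)).
transitivity ((Num.sqrt pi ^+ n)%:E * \int[mu]_t ((gauss_fun t)%:E * \int[mu]_s L (t, s)))%E.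
  rewrite -ge0_integralZl//; last 2 first.
  - by apply: emeasurable_funM; [exact/measurable_EFinP|exact: mIL].
  - by move=> t _; apply: mule_ge0; [rewrite lee_fin; exact: g0|exact: IL0].
  by apply: eq_integral => t _; rewrite muleCA.
rewrite exprSr EFinM -muleA; congr (_ * _)%E.
have -> : enorm e = Num.sqrt (a ^+ 2 + b ^+ 2).
  rewrite /enorm big_ord_recl sqr_enorm; congr (Num.sqrt (_ + _)).
  by apply: eq_bigr => i _; rewrite mxE.
rewrite -(integral_gauss_plane a b mf f0); apply: eq_integral => t _.
rewrite -ge0_integralZl//; last 2 first.
- exact: mLt.
- by rewrite lee_fin.
by apply: eq_integral => s _; rewrite EFinM muleA.
Qed.

Lemma integral_gauss_rV n :
  (\int[lebesgue_rV R n]_h (gauss_rV h)%:E = (pi `^ (n%:R / 2))%:E)%E.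
Proof.
have p0 : 0 < pi :> R := pi_gt0 R.
have sp : 0 < Num.sqrt pi :> R by rewrite sqrtr_gt0.
have := @integral_gauss_dot n 0 (cst 1%E) (measurable_cst _) (fun y => lee01).
under eq_integral do rewrite mule1.
under [X in (_ = _ * X)%E -> _]eq_integral do rewrite mule1.
rewrite integralT_gauss -EFinM mulrC EFinM => /(congr1 (fun x => ((Num.sqrt pi)^-1%:E * x)%E)).
rewrite !muleA -!EFinM mulVf ?gt_eqF// mul1e mul1r => ->.
by rewrite mulrC powRrM powR12_sqrt ?(ltW p0)// powR_mulrn// ltW.
Qed.

End gauss_rV.

(** * Radial integrals against a Gaussian *)

Section gauss_radial.
Context {R : realType}.
Local Notation mu := (@lebesgue_measure R).

Lemma measurable_powR_fun d (T : measurableType d) (f : T -> R) p :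
  measurable_fun [set: T] f -> measurable_fun [set: T] (fun z => f z `^ p).
Proof. by move=> mf; exact: (measurableT_comp (measurable_powR _)). Qed.

Lemma measurable_sqrV : measurable_fun [set: R] (fun t : R => t ^- 2).
Proof.
rewrite (_ : (fun t => _) = (fun t : R => `|t| `^ (- 2%:R))).
  by apply: (measurableT_comp (measurable_powR _)); exact: normr_measurable.
by apply/funext => t; rewrite powRN powR_mulrn// real_normK// num_real.
Qed.

(** Inversion of t and scaling by r reduce this to [Gamma_square] with exponent b - 1. *)
Lemma integral_gauss_inv (r b : R) : 0 < r -> 0 < b ->
  (\int[mu]_t (`|t| `^ (- (1 + b)) * expR (- (r ^+ 2 / t ^+ 2)))%:E =
   (r `^ (- b) * Gamma (b / 2))%:E)%E.
Proof.
move=> r0 b0.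
pose G (t : R) := t `^ (- (1 + b)) * expR (- (r ^+ 2 / t ^+ 2)).
have mG : measurable_fun [set: R] G.
  apply: measurable_funM; first exact: measurable_powR.
  apply: measurableT_comp => //; apply: measurableT_comp => //; apply: measurable_funM => //.
  exact: measurable_sqrV.
have G0 t : 0 <= G t by rewrite mulr_ge0 ?powR_ge0 ?expR_ge0.
transitivity (\int[mu]_t (G `|t|)%:E)%E.
  by apply: eq_integral => t _; rewrite /G real_normK// num_real.
rewrite ge0_integral_even// ge0_substitution_inv; last 2 first.
- move=> t; rewrite inE/= in_itv/= andbT => t0; apply: cvgM; first exact: powR_continuous.
  apply: (@continuous_comp _ _ _ (fun t : R => - (r ^+ 2 / t ^+ 2)) expR); last exact: continuous_expR.
  apply: cvgN; apply: cvgM; first exact: cvg_cst.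
  apply: cvgV; first by rewrite gt_eqF// exprn_gt0.
  exact: exprn_continuous.
- by move=> t _; exact: G0.
pose F (t : R) := t `^ (b - 1) * gauss_fun (r * t).
have mF : measurable_fun [set: R] F.
  apply: measurable_funM; first exact: measurable_powR.
  by apply: measurableT_comp; [exact: measurable_gauss_fun|exact: measurable_funM].
have F0 t : 0 <= F t by rewrite mulr_ge0 ?powR_ge0 ?expR_ge0.
transitivity (2%:E * \int[mu]_(t in `]0%R, +oo[) (F t)%:E)%E.
  congr (_ * _)%E; apply: eq_integral => t; rewrite inE/= in_itv/= andbT => t0.
  congr EFin; rewrite /G /F powRV// -powRN opprK mulrAC; congr (_ * _).
    rewrite -[t ^+ 2]powR_mulrn ?(ltW t0)// -powRN -powRD; last by rewrite (gt_eqF t0) implybT.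
    by congr (_ `^ _); ring.
  by rewrite /gauss_fun exprVn invrK exprMn.
rewrite -ge0_integral_even//.
transitivity (\int[mu]_t ((r `^ (1 - b))%:E * ((fun t => (`|t| `^ (b - 1) * gauss_fun t)%:E) (r * t)%R)))%E.
  apply: eq_integral => t _; rewrite -EFinM; congr EFin.
  rewrite /F normrM (gtr0_norm r0) powRM ?(ltW r0)// !mulrA -powRD; last by rewrite (gt_eqF r0) implybT.
  rewrite addrA subrK subrr powRr0 mul1r; congr (_ * _).
  by rewrite /gauss_fun !exprMn real_normK// num_real.
have mH : measurable_fun [set: R] (fun t : R => (`|t| `^ (b - 1) * gauss_fun t)%:E).
  apply/measurable_EFinP; apply: measurable_funM; last exact: measurable_gauss_fun.
  by apply: (measurableT_comp (measurable_powR _)); exact: normr_measurable.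
have H0 t : (0 <= (`|t| `^ (b - 1) * gauss_fun t)%:E)%E.
  by rewrite lee_fin mulr_ge0 ?powR_ge0 ?expR_ge0.
have r1 : r != 0 by rewrite gt_eqF.
rewrite ge0_integralZl//; last 2 first.
- by apply: (measurableT_comp mH); exact: measurable_funM.
- by rewrite lee_fin powR_ge0.
have E := ge0_integral_scale r1 mH H0.
rewrite E Gamma_square; last by rewrite ltrBrDr addNr.
rewrite subrK -!EFinM mulrA; congr (_ * _)%:E.
rewrite (gtr0_norm r0) -powR_inv1 ?(ltW r0)// -powRD; last by rewrite (gt_eqF r0) implybT.
by congr (_ `^ _); ring.
Qed.

(* Polar coordinates in disguise: averaging the integrals over lines through the origin
   against a Gaussian weight, whose radial profile integrates to a Gamma value. *)
Lemma ge0_integral_gauss_radial n (H : 'rV[R]_n -> \bar R) (m g b : R) :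
  0 < b -> b = n%:R + m - g - 1 -> H 0 = 0%E ->
  measurable_fun [set: 'rV[R]_n] H -> (forall k, (0 <= H k)%E) ->
  (\int[lebesgue_rV R n]_h \int[mu]_t
     ((gauss_rV h * enorm h `^ m * `|t| `^ g)%:E * H (t *: h)%R) =
   (Gamma (b / 2))%:E * \int[lebesgue_rV R n]_k ((enorm k `^ (m - b))%:E * H k))%E.
Proof.
move=> b0 bE H0 mH Hge0.
pose K (z : 'rV[R]_n * R) : \bar R :=
  ((gauss_rV z.1 * enorm z.1 `^ m * `|z.2| `^ g)%:E * H (z.2 *: z.1)%R)%E.
have men : measurable_fun [set: 'rV[R]_n * R] (fun z => enorm z.1).
  exact: (measurableT_comp (@measurable_enorm R n) measurable_fst).
have mab : measurable_fun [set: 'rV[R]_n * R] (fun z => `|z.2|).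
  by apply: measurableT_comp => //; exact: normr_measurable.
have mK : measurable_fun [set: 'rV[R]_n * R] K.
  apply: emeasurable_funM.
    apply/measurable_EFinP; apply: measurable_funM; last exact: measurable_powR_fun.
    apply: measurable_funM; last exact: measurable_powR_fun.
    exact: (measurableT_comp (@measurable_gauss_rV R n) measurable_fst).
  by apply: (measurableT_comp mH); exact: measurable_rV_scale_fun.
have K0 z : (0 <= K z)%E.
  apply: mule_ge0 => //; rewrite lee_fin mulr_ge0 ?powR_ge0// mulr_ge0 ?powR_ge0//.
  exact: gauss_rV_ge0.
have T1 := @fubini_tonelli _ _ _ _ _ (lebesgue_rV R n) mu K mK K0.
rewrite [LHS]T1/=; clear T1.
pose L (z : 'rV[R]_n * R) : \bar R :=
  ((enorm z.1 `^ m * (`|z.2| `^ (- (1 + b)) * expR (- (enorm z.1 ^+ 2 / z.2 ^+ 2))))%:E * H z.1)%E.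
have mL : measurable_fun [set: 'rV[R]_n * R] L.
  apply: emeasurable_funM; last exact: (measurableT_comp mH measurable_fst).
  apply/measurable_EFinP; apply: measurable_funM; first exact: measurable_powR_fun.
  apply: measurable_funM; first exact: measurable_powR_fun.
  apply: measurableT_comp => //; apply: measurableT_comp => //; apply: measurable_funM.
    exact: measurable_funX.
  exact: (measurableT_comp measurable_sqrV measurable_snd).
have L0 z : (0 <= L z)%E.
  by apply: mule_ge0 => //; rewrite lee_fin mulr_ge0 ?powR_ge0// mulr_ge0 ?powR_ge0 ?expR_ge0.
have b1 : - (1 + b) != 0 by rewrite oppr_eq0 gt_eqF// addr_gt0.
transitivity (\int[mu]_t \int[lebesgue_rV R n]_k L (k, t))%E.
  (* The substitution k = t h fails at t = 0, where both sides vanish: H 0 = 0, and 0 to a nonzero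
     power is 0, even to a negative one. *)
  apply: eq_integral => t _; have [->|t0] := eqVneq t 0.
    transitivity (0 : \bar R)%E; first by apply: integral0_eq => h _; rewrite /K/= scale0r H0 mule0.
    apply/esym; apply: integral0_eq => h _.
    by rewrite /L/= normr0 powR0// mul0r mulr0 mul0e.
  have t1 : 0 < `|t| by rewrite normr_gt0.
  have mLt : measurable_fun [set: 'rV[R]_n] (fun k => L (k, t)).
    exact: (measurableT_comp mL (pair2_measurable t)).
  have E := ge0_integral_rV_scale t0 mLt (fun k => L0 (k, t)).
  transitivity ((`|t| ^+ n)%:E * ((`|t| ^- n)%:E * \int[lebesgue_rV R n]_k L (k, t)))%E; last first.
    by rewrite muleA -EFinM mulfV ?mul1e// expf_neq0// gt_eqF.
  rewrite -[X in (_ * X)%E]E -ge0_integralZl//; last first.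
    by apply: (measurableT_comp mLt); exact: measurable_rV_scale.
  apply: eq_integral => h _; rewrite /K /L/= muleA -EFinM; congr (_%:E * _)%E.
  have -> : expR (- (enorm (t *: h) ^+ 2 / t ^+ 2)) = gauss_rV h.
    rewrite enormZ exprMn real_normK ?num_real// mulrAC mulfV ?mul1r//.
    by rewrite expf_neq0.
  rewrite enormZ powRM ?enorm_ge0//.
  have E2 : `|t| `^ g = `|t| ^+ n * (`|t| `^ m * `|t| `^ (- (1 + b))).
    rewrite -powR_mulrn// -!powRD ?(gt_eqF t1) ?implybT//.
    by congr (_ `^ _); rewrite bE; ring.
  by rewrite E2; ring.
have T2 := @fubini_tonelli _ _ _ _ _ (lebesgue_rV R n) mu L mL L0.
rewrite -[LHS]T2/=; clear T2.
rewrite -ge0_integralZl//; last 3 first.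
- apply: emeasurable_funM => //; apply/measurable_EFinP; apply: measurable_powR_fun; exact: measurable_enorm.
- by move=> k _; apply: mule_ge0 => //; rewrite lee_fin powR_ge0.
- by rewrite lee_fin ltW// Gamma_gt0// divr_gt0.
apply: eq_integral => k _; have [->|k0] := eqVneq k 0.
  by rewrite H0 !mule0; apply: integral0_eq => t _; rewrite /L/= H0 mule0.
have e0 : 0 < enorm k by rewrite enorm_gt0.
transitivity (\int[mu]_t (((enorm k `^ m)%:E * H k) *
    (`|t| `^ (- (1 + b)) * expR (- (enorm k ^+ 2 / t ^+ 2)))%:E))%E.
  by apply: eq_integral => t _; rewrite /L/= EFinM muleAC.
rewrite ge0_integralZl//; last 2 first.
- apply/measurable_EFinP; apply: measurable_funM.
    by apply: measurable_powR_fun; exact: normr_measurable.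
  apply: measurableT_comp => //; apply: measurableT_comp => //; apply: measurable_funM => //.
  exact: measurable_sqrV.
- by apply: mule_ge0 => //; rewrite lee_fin powR_ge0.
rewrite integral_gauss_inv// powRD; last by rewrite (gt_eqF e0) implybT.
by rewrite muleAC -EFinM [RHS]muleA -EFinM; congr (_%:E * _)%E; ring.
Qed.

End gauss_radial.

(** * Gaussian moments and the area of the sphere *)

Section sphere.
Context {R : realType}.
Local Notation mu := (@lebesgue_measure R).

Lemma integral_exprn (n : nat) (c : R) : 0 < c ->
  (\int[mu]_(t in `]0%R, c]) (t ^+ n)%:E = (c ^+ n.+1 / n.+1%:R)%:E)%E.
Proof.
move=> c0; have cf (m : nat) : continuous (fun t : R => t ^+ m) by exact: exprn_continuous.
have dF (t : R) : is_derive t (1 : R) (fun t => n.+1%:R^-1 * t ^+ n.+1) (t ^+ n).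
  have D : is_derive t (1 : R) (fun t : R => t ^+ n.+1) (n.+1%:R * t ^+ n).
    apply: DeriveDef; first exact: exprn_derivable.
    by rewrite exp_derive [LHS]mulr1.
  apply: (is_derive_eq (is_derive1Z n.+1%:R^-1 D)).
  by rewrite mulrA mulVf// mul1r.
have mX : measurable_fun [set: R] (fun t : R => (t ^+ n)%:E).
  by apply/measurable_EFinP; exact: measurable_funX.
rewrite integral_itv_obnd_cbnd; last exact: measurable_funTS.
rewrite (@continuous_FTC2 _ _ (fun t => n.+1%:R^-1 * t ^+ n.+1))//.
- by rewrite expr0n/= mulr0 sube0 mulrC.
- by apply: continuous_subspaceT; exact: cf.
- split.
  + by move=> t _; have [] := dF t.
  + by apply: cvg_at_right_filter; exact: (is_derive_continuous (dF 0)).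
  + by apply: cvg_at_left_filter; exact: (is_derive_continuous (dF c)).
- by move=> t _; rewrite derive1E; exact: (@derive_val _ _ _ _ _ _ _ (dF t)).
Qed.

Lemma integral_line_ball n (c : R) : 0 < c ->
  (\int[mu]_t (`|t| `^ (n.+1%:R - 1) * \1_[set t : R | 0 < t <= c] `|t|)%:E =
   (2 * c ^+ n.+1 / n.+1%:R)%:E)%E.
Proof.
move=> c0; rewrite -mulrA EFinM -integral_exprn// (_ : _ - 1 = n%:R); last first.
  by rewrite -natr1 addrK.
have m1 : measurable [set t : R | 0 < t <= c].
  rewrite (_ : mkset _ = `]0, c]%classic); first exact: measurable_itv.
  by apply/seteqP; split => t /=; rewrite in_itv.
rewrite (@ge0_integral_even _ (fun t => t `^ n%:R * \1_[set t : R | 0 < t <= c] t)).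
- congr (_ * _)%E; rewrite integral_mkcond [RHS]integral_mkcond; apply: eq_integral => t _.
  rewrite !patchE !mem_setE !in_itv/= andbT indicE.
  rewrite [t \in mkset _](_ : _ = (0 < t <= c)); last by apply/asboolP/idP.
  have [t0|t0] //= := ltP 0 t.
  by rewrite powR_mulrn ?(ltW t0)//; case: ifP => _; rewrite ?mulr1 ?mulr0.
- by apply: measurable_funM; [exact: measurable_powR|exact: measurable_indic].
- by move=> t; rewrite mulr_ge0 ?powR_ge0.
Qed.

Lemma measurable_punctured_ball N : measurable [set k : 'rV[R]_N | 0 < enorm k <= 1].
Proof.
rewrite -[X in measurable X]setTI.
rewrite (_ : [set k : 'rV[R]_N | 0 < enorm k <= 1] = (@enorm R N) @^-1` `]0, 1]%classic).
  by apply: measurable_enorm => //; exact: measurable_itv.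
by apply/seteqP; split => k /=; rewrite in_itv.
Qed.

Lemma surface_unit_sphere N : surface_measure (@unit_sphere R N) =
  (N%:R%:E * lebesgue_rV R N [set k | (0 < enorm k <= 1)%R])%E.
Proof.
congr (_ * _)%E; congr (lebesgue_rV R N _); apply/seteqP; split => [k [r [w [/andP[r0 r1] w1 ->]]]|k /=].
  by rewrite /= enormZ w1 mulr1 gtr0_norm// r0.
move=> /andP[k0 k1]; exists (enorm k), ((enorm k)^-1 *: k); rewrite k0; split=> //.
  by rewrite /unit_sphere/= enormZ ger0_norm ?invr_ge0 ?(ltW k0)// mulVf// gt_eqF.
by rewrite scalerA mulfV ?scale1r// gt_eqF.
Qed.

Lemma rV_originE N : [set 0] = [set v : 'rV[R]_N | forall i, [set 0 : R] (v 0 i)].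
Proof.
apply/seteqP; split => [v /= -> i|v /= v0]; first by rewrite mxE.
by apply/rowP => i; rewrite mxE v0.
Qed.

Lemma measurable_rV_origin N : measurable [set 0 : 'rV[R]_N].
Proof.
rewrite rV_originE.
by apply: (@measurable_box R N (fun=> [set 0])) => i; exact: measurable_set1.
Qed.

Lemma lebesgue_rV_origin N : (0 < N)%N -> lebesgue_rV R N [set 0] = 0%E.
Proof.
case: N => // N _; rewrite rV_originE.
have -> := @lebesgue_rV_box R N.+1 (fun=> [set 0]) (fun=> measurable_set1 0).
by rewrite big_ord_recl/= lebesgue_measure_set1 mul0e.
Qed.

(** The radial formula for the indicator of the unit ball without its center: the integral of |t|^(N
    - 1) over 0 < |t| |h| <= 1 is 2 |h|^(- N) / N, and the ball has 1 / N times the area of the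
    sphere as its volume. *)
Lemma integral_gauss_moment N (b : R) : (0 < N)%N -> 0 < b ->
  (\int[lebesgue_rV R N]_h (gauss_rV h * enorm h `^ (b - N%:R))%:E =
   (Gamma (b / 2) / 2)%:E * surface_measure (@unit_sphere R N))%E.
Proof.
move=> N0 b0; have mB : measurable [set k : 'rV[R]_N | 0 < enorm k <= 1] by exact: measurable_punctured_ball.
pose H (k : 'rV[R]_N) : \bar R := (\1_[set k : 'rV[R]_N | 0 < enorm k <= 1] k)%:E.
have mH : measurable_fun [set: 'rV[R]_N] H by apply/measurable_EFinP; exact: measurable_indic.
have H0 k : (0 <= H k)%E by rewrite lee_fin.
have H00 : H 0 = 0%E.
  rewrite /H indicE memNset//= => /andP[+ _]; rewrite enorm_gt0 eqxx.
  by [].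
have bE : b = N%:R + b - (N%:R - 1) - 1 by ring.
have nN : N%:R != 0 :> R by rewrite pnatr_eq0 -lt0n.
have := ge0_integral_gauss_radial b0 bE H00 mH H0.
under [X in (_ = _ * X)%E -> _]eq_integral do rewrite subrr powRr0 mul1e.
rewrite /H integral_indic// setIT => E.
have mint : measurable_fun [set: 'rV[R]_N] (fun h : 'rV[R]_N => (gauss_rV h * enorm h `^ (b - N%:R))%:E).
  apply/measurable_EFinP; apply: measurable_funM; first exact: measurable_gauss_rV.
  exact: (measurableT_comp (measurable_powR _) (@measurable_enorm R N)).
have int0 h : (0 <= (gauss_rV h * enorm (h : 'rV[R]_N) `^ (b - N%:R))%:E)%E.
  by rewrite lee_fin mulr_ge0 ?powR_ge0 ?gauss_rV_ge0.
pose K (z : 'rV[R]_N * R) : \bar R :=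
  ((gauss_rV z.1 * enorm z.1 `^ b * `|z.2| `^ (N%:R - 1))%:E * H (z.2 *: z.1)%R)%E.
have mK : measurable_fun [set: 'rV[R]_N * R] K.
  apply: emeasurable_funM.
    apply/measurable_EFinP; apply: measurable_funM; last first.
      by apply: measurable_powR_fun; apply: measurableT_comp => //; exact: normr_measurable.
    apply: measurable_funM; last first.
      by apply: measurable_powR_fun; exact: (measurableT_comp (@measurable_enorm R N) measurable_fst).
    exact: (measurableT_comp (@measurable_gauss_rV R N) measurable_fst).
  by apply: (measurableT_comp mH); exact: measurable_rV_scale_fun.
have K0 z : (0 <= K z)%E.
  apply: mule_ge0 => //; rewrite lee_fin mulr_ge0 ?powR_ge0// mulr_ge0 ?powR_ge0//.
  exact: gauss_rV_ge0.
have mIK := measurable_fun_fubini_tonelli_F (m2 := mu) K mK K0.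
have IK0 h : (0 <= \int[mu]_t K (h, t))%E by apply: integral_ge0 => t _; exact: K0.
transitivity ((N%:R / 2)%:E * \int[lebesgue_rV R N]_h \int[mu]_t K (h, t))%E; last first.
  by rewrite surface_unit_sphere [X in (_ * X)%E]E !muleA -!EFinM; congr (_%:E * _)%E; ring.
rewrite -ge0_integralZl//.
have m0 : measurable [set 0 : 'rV[R]_N] by exact: measurable_rV_origin.
have leb0 := lebesgue_rV_origin N0.
(* The pointwise evaluation divides by |h|, so the origin, a null set since N > 0, is removed
   first. *)
have del (f : 'rV[R]_N -> \bar R) : measurable_fun [set: 'rV[R]_N] f -> (forall h, (0 <= f h)%E) ->
    (\int[lebesgue_rV R N]_h f h = \int[lebesgue_rV R N]_(h in setT `\ 0%R) f h)%E.
  by move=> mf f0; exact: (ge0_negligible_integral m0 measurableT mf (fun x _ => f0 x) leb0).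
rewrite (del _ mint int0) [RHS]del; last 2 first.
- by apply: emeasurable_funM => //; exact: mIK.
- by move=> h; apply: mule_ge0 => //; rewrite lee_fin divr_ge0.
apply: eq_integral => h; rewrite inE /= => -[_ /eqP h0].
have e0 : 0 < enorm h by rewrite enorm_gt0.
have ei : 0 < (enorm h)^-1 by rewrite invr_gt0.
have -> : (\int[mu]_t K (h, t) = (gauss_rV h * enorm h `^ b)%:E *
   \int[mu]_t (`|t| `^ (N%:R - 1) * \1_[set t : R | 0 < t <= (enorm h)^-1] `|t|)%:E)%E.
  rewrite -ge0_integralZl//; last 2 first.
  - apply/measurable_EFinP; apply: measurable_funM; first by apply: measurable_powR_fun; exact: normr_measurable.
    apply: (measurableT_comp (f := \1__ : R -> R)); last exact: normr_measurable.
    apply: measurable_indic.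
    rewrite (_ : mkset _ = `]0, (enorm h)^-1]%classic); first exact: measurable_itv.
    by apply/seteqP; split => t /=; rewrite in_itv.
  - by rewrite lee_fin mulr_ge0 ?gauss_rV_ge0 ?powR_ge0.
  apply: eq_integral => t _; rewrite /K/= /H -!EFinM mulrA; congr (_ * _)%:E.
  rewrite !indicE; congr (nat_of_bool _)%:R.
  apply/asboolP/asboolP => /=; rewrite enormZ pmulr_lgt0//.
    by move=> /andP[-> ]; rewrite -ler_pdivlMr// mul1r.
  by move=> /andP[-> ]; rewrite -[X in _ <= X -> _]mul1r ler_pdivlMr.
have := integral_line_ball N.-1 ei; rewrite prednK// => ->.
rewrite -!EFinM; congr EFin.
rewrite exprVn powRD; last by rewrite (gt_eqF e0) implybT.
rewrite powRN powR_mulrn ?(ltW e0)//; field.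
by rewrite nN expf_neq0// gt_eqF.
Qed.

(** For b = N the moment is the total Gaussian mass pi^(N / 2), which is finite. *)
Lemma surface_unit_sphere_fin N : (0 < N)%N ->
  surface_measure (@unit_sphere R N) = (sphere_area N)%:E.
Proof.
move=> N0; have S0 : (0 <= surface_measure (@unit_sphere R N))%E by rewrite surface_unit_sphere mule_ge0.
rewrite /sphere_area fineK// ge0_fin_numE//.
have b0 : 0 < N%:R :> R by rewrite ltr0n.
have G0 : 0 < Gamma (N%:R / 2) / 2 :> R by rewrite divr_gt0// Gamma_gt0// divr_gt0.
have := integral_gauss_moment N0 b0; under eq_integral do rewrite subrr powRr0 mulr1.
rewrite integral_gauss_rV; case: (surface_measure _) S0 => [r|//|//] S0; first by rewrite ltry.
by rewrite gt0_muley// lte_fin.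
Qed.

Lemma sphere_areaE N : (0 < N)%N ->
  sphere_area N = 2 * pi `^ (N%:R / 2) / Gamma (N%:R / 2) :> R.
Proof.
move=> N0; have b0 : 0 < N%:R :> R by rewrite ltr0n.
have G0 : 0 < Gamma (N%:R / 2) :> R by rewrite Gamma_gt0// divr_gt0.
have := integral_gauss_moment N0 b0; under eq_integral do rewrite subrr powRr0 mulr1.
rewrite integral_gauss_rV surface_unit_sphere_fin// -EFinM => -[->].
by field; rewrite gt_eqF.
Qed.

Lemma sphere_area_gt0 N : (0 < N)%N -> 0 < sphere_area N :> R.
Proof.
move=> N0; rewrite sphere_areaE// divr_gt0 ?Gamma_gt0 ?divr_gt0 ?ltr0n//.
by rewrite mulr_gt0// powR_gt0// pi_gt0.
Qed.

Lemma integral_gauss_dot_powR N (e : 'rV[R]_N) (al : R) : (0 < N)%N -> 0 < al -> enorm e = 1 ->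
  (\int[lebesgue_rV R N]_h (gauss_rV h * `|dot h e| `^ al)%:E =
   (pi `^ ((N%:R - 1) / 2) * Gamma ((1 + al) / 2))%:E)%E.
Proof.
move=> N0 al0 e1; have p0 : 0 < pi :> R := pi_gt0 R.
have sp : 0 < Num.sqrt pi :> R by rewrite sqrtr_gt0.
have mf : measurable_fun [set: R] (fun y : R => (`|y| `^ al)%:E).
  by apply/measurable_EFinP; apply: (measurableT_comp (measurable_powR _)); exact: normr_measurable.
have := @integral_gauss_dot _ N e _ mf (fun y => powR_ge0 _ _).
rewrite e1; under [X in (_ = _ * X)%E -> _]eq_integral do rewrite mul1r -EFinM mulrC.
rewrite -[X in (_ * X)%E = _ -> _]/(\int[lebesgue_rV R N]_h (gauss_rV h * `|dot h e| `^ al)%:E)%E.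
rewrite Gamma_square ?(lt_trans _ al0)// addrC.
move/(congr1 (fun x => ((Num.sqrt pi)^-1%:E * x)%E)).
rewrite !muleA -!EFinM mulVf ?gt_eqF// mul1e => ->; congr EFin.
rewrite -(prednK N0) exprS mulrA mulVf ?gt_eqF// mul1r; congr (_ * _).
by rewrite -natr1 addrK mulrC powRrM powR12_sqrt ?(ltW p0)// powR_mulrn// ltW.
Qed.

End sphere.

(** * Lower bounds on the averaged weight *)

Section supporting.
Context {R : realType} {N : nat}.
Implicit Types (O : set 'rV[R]_N) (x y z h e : 'rV[R]_N).

Lemma dotDl x y e : dot (x + y) e = dot x e + dot y e.
Proof. by rewrite /dot -big_split; apply: eq_bigr => i _; rewrite mxE mulrDl. Qed.

Lemma dotZl (t : R) x e : dot (t *: x) e = t * dot x e.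
Proof. by rewrite /dot mulr_sumr; apply: eq_bigr => i _; rewrite mxE mulrA. Qed.

Lemma dotNl x e : dot (- x) e = - dot x e.
Proof. by rewrite -scaleN1r dotZl mulN1r. Qed.

Lemma dotC x y : dot x y = dot y x.
Proof. by apply: eq_bigr => i _; rewrite mulrC. Qed.

Lemma dotxx x : dot x x = enorm x ^+ 2.
Proof. by rewrite sqr_enorm; apply: eq_bigr => i _; rewrite expr2. Qed.

Lemma enormD_sqr x y : enorm (x + y) ^+ 2 = enorm x ^+ 2 + 2 * dot x y + enorm y ^+ 2.
Proof. by rewrite -!dotxx dotDl ![dot _ (x + y)]dotC !dotDl [dot y x]dotC; ring. Qed.

(** The distance attains its minimum on the part of the complement in a compact cube around x;
    points outside that cube are farther away than [z0]. *)
Lemma nearest_point O x : open O -> (~` O) !=set0 ->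
  exists2 y, ~ O y & forall z, ~ O z -> enorm (x - y) <= enorm (x - z).
Proof.
move=> oO [z0 Oz0]; pose d := enorm (x - z0).
pose A := [set v : 'rV[R]_N | forall i, `[x 0 i - d, x 0 i + d]%classic (v 0 i)] `&` ~` O.
have inA z : (forall i, `|x 0 i - z 0 i| <= d) -> ~ O z -> A z.
  move=> zd Oz; split => // i /=; rewrite in_itv/=.
  by have := zd i; rewrite ler_norml; lra.
have cA : compact A.
  apply: compact_closedI; last exact: open_closedC.
  apply: (@rV_compact _ _ (fun i => `[x 0 i - d, x 0 i + d]%classic)) => i.
  exact: segment_compact.
have Az0 : A z0.
  by apply: inA => // i; have := le_coord_enorm (x - z0) i; rewrite !mxE.
have [||y] := @compact_EVT_min _ _ (fun z => enorm (x - z)) A _ cA; first by exists z0.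
  apply: continuous_subspaceT => z; apply: (@continuous_comp _ _ _ (fun z => x - z) (@enorm R N)).
    by apply: continuousB; [exact: cst_continuous|exact: cvg_id].
  exact: enorm_continuous.
move=> /set_mem[_ Oy] ymin; exists y => // z Oz.
have [zd|] := pselect (forall i, `|x 0 i - z 0 i| <= d).
  by apply: ymin; apply: mem_set; exact: inA.
move=> /existsNP[i /negP]; rewrite -ltNge => zd.
apply: (@le_trans _ _ d); first by apply: ymin; exact: mem_set.
by rewrite ltW// (lt_le_trans zd)//; have := le_coord_enorm (x - z) i; rewrite !mxE.
Qed.

(* If [(z - y) . (y - x) > 0], the point [y - tau (z - y)] is closer to [x] than [y]. *)
Lemma convex_supporting O x y z : open O -> convex_set O -> O x -> ~ O y ->
  (forall w, ~ O w -> enorm (x - y) <= enorm (x - w)) -> O z ->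
  dot (z - x) (y - x) < enorm (x - y) ^+ 2.
Proof.
move=> oO cO Ox Oy ymin Oz.
have strict z' : O z' -> dot (z' - y) (y - x) <= 0.
  move=> Oz'; rewrite leNgt; apply/negP => p0.
  pose p := dot (z' - y) (y - x); pose q := enorm (z' - y) ^+ 2.
  have q0 : 0 <= q by rewrite sqr_ge0.
  have q1 : 0 < 1 + q by rewrite addrC ltr_wpDl.
  (* The squared distance to x changes by tau (tau q - 2 p), so tau q < p suffices; the 1 in the
     denominator covers q = 0. *)
  pose tau := p / (1 + q); have t0 : 0 < tau by rewrite divr_gt0.
  have tq : tau * (1 + q) = p by rewrite /tau divfK// gt_eqF.
  pose w := y - tau *: (z' - y).
  have Ow : O w.
    apply: contrapT => /ymin; rewrite leNgt => /negP; apply.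
    rewrite -ltr_sqr ?nnegrE ?enorm_ge0//.
    rewrite -[x - w]opprB enormN -[x - y]opprB enormN.
    have -> : w - x = (y - x) + (- tau) *: (z' - y) by rewrite /w addrAC scaleNr.
    rewrite enormD_sqr enormZ dotC dotZl -/p exprMn -/q real_normK ?num_real//.
    rewrite -addrA gtrDl sqrrN.
    have -> : tau ^+ 2 * q = tau * (p - tau) by rewrite -tq; ring.
    have := mulr_gt0 t0 p0; have := mulr_gt0 t0 t0; rewrite -/p; lra.
  (* Now y = (w + tau z') / (1 + tau) lies between two points of O. *)
  apply: Oy; have u0 : 0 < 1 + tau by rewrite addrC ltr_wpDl ?(ltW t0).
  have l01 : 0 <= (1 + tau)^-1 <= 1.
    by rewrite invr_ge0 (ltW u0) invf_le1//; lra.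
  have := convex_setP cO l01 Ow Oz'; congr (O _).
  apply/rowP => i; rewrite !mxE; field; rewrite gt_eqF//.
have [/eqP xy|xy] := eqVneq (enorm (x - y)) 0.
  by move: xy; rewrite enorm_eq0 subr_eq0 => /eqP xy; case: Oy; rewrite -xy.
have d0 : 0 < enorm (x - y) ^+ 2 by rewrite exprn_even_gt0.
(* Strictness comes from applying the weak inequality to z pushed a little in the direction y -
   x. *)
have [r r0 rO] := open_line (y - x) oO Oz.
have := strict (z + (r / 2) *: (y - x)) (rO _ _).
rewrite gtr0_norm ?divr_gt0// ltr_pdivrMr// => /(_ _)/wrap[]; first by lra.
have -> : z + (r / 2) *: (y - x) - y = (z - x) + (- (y - x) + (r / 2) *: (y - x)).
  by apply/rowP => i; rewrite !mxE; ring.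
have e1 : dot (y - x) (y - x) = enorm (x - y) ^+ 2 by rewrite dotxx -[y - x]opprB enormN.
rewrite (dotDl (z - x)) (dotDl (- (y - x))) (dotNl (y - x)) dotZl e1.
have : 0 < r / 2 * enorm (x - y) ^+ 2 by rewrite mulr_gt0// divr_gt0.
lra.
Qed.

(** By [convex_supporting], O lies in the half-space through y normal to y - x; a positive left-hand
    side is the gauge of that half-space. *)
Lemma gauge_ge_dot O x y h : open O -> convex_set O -> O x -> ~ O y ->
  (forall w, ~ O w -> enorm (x - y) <= enorm (x - w)) ->
  dot h (y - x) / enorm (x - y) ^+ 2 <= gauge O x h.
Proof.
move=> oO cO Ox Oy ymin; set q := _ / _.
rewrite leNgt; apply/negP => gq; have q0 : 0 < q by apply: le_lt_trans gq; exact: gauge_ge0.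
have xy : 0 < enorm (x - y) ^+ 2.
  by rewrite exprn_even_gt0//= enorm_eq0 subr_eq0; apply/eqP => xy; apply: Oy; rewrite -xy.
have qi : 0 < q^-1 by rewrite invr_gt0.
have : O (x + q^-1 *: h) by apply/(gauge_lt1P h oO cO Ox qi); rewrite ltr_pdivrMr// mul1r.
move=> /(convex_supporting oO cO Ox Oy ymin); rewrite addrAC subrr add0r dotZl.
rewrite /q invf_div divfK ?ltxx// gt_eqF//.
by move: q0; rewrite /q pmulr_lgt0// invr_gt0.
Qed.

Lemma gauge_max_ge_dot O x y h : open O -> convex_set O -> O x -> ~ O y ->
  (forall w, ~ O w -> enorm (x - y) <= enorm (x - w)) ->
  `|dot h ((enorm (x - y))^-1 *: (y - x))| / enorm (x - y) <=
    Num.max (gauge O x h) (gauge O x (- h)).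
Proof.
move=> oO cO Ox Oy ymin.
have xy : 0 < enorm (x - y).
  by rewrite enorm_gt0 subr_eq0; apply/eqP => xy; apply: Oy; rewrite -xy.
rewrite dotC dotZl normrM gtr0_norm ?invr_gt0// dotC mulrAC -invfM -expr2 mulrC.
have := gauge_ge_dot h oO cO Ox Oy ymin; have := gauge_ge_dot (- h) oO cO Ox Oy ymin.
rewrite dotNl le_max => h1 h2; apply/orP.
by have [p0|p0] := leP 0 (dot h (y - x)); [left; rewrite ger0_norm|right; rewrite ltr0_norm].
Qed.

End supporting.

(** * Convexity inequalities for powers *)

Section weight_inequalities.
Context {R : realType}.

(** Both b and 2 a lie in [a, a + b] and their sum is a + (a + b), so convexity gives (2 a)^al +
    b^al <= a^al + (a + b)^al. *)
Lemma powR_majorization al (a b : R) : 1 <= al -> 0 <= a -> a <= b ->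
  b `^ al + (2 `^ al - 1) * a `^ al <= (a + b) `^ al.
Proof.
move=> al1 a0 ab; have [b0|b0] := eqVneq b 0.
  have -> : a = 0 by apply/eqP; rewrite eq_le a0 -b0 ab.
  by rewrite b0 addr0 powR0 ?mulr0 ?addr0// gt_eqF// (lt_le_trans ltr01).
have bp : 0 < b by rewrite lt_neqAle eq_sym b0 (le_trans a0).
have l0 : 0 <= a / b by rewrite divr_ge0// ltW.
have l1 : a / b <= 1 by rewrite ler_pdivrMr// mul1r.
have m0 : 0 <= 1 - a / b by rewrite subr_ge0.
have m1 : 1 - a / b <= 1 by rewrite gerBl.
have ui : a \in (`[0, +oo[%classic : set R) by rewrite inE/= in_itv/= a0.
have vi : a + b \in (`[0, +oo[%classic : set R) by rewrite inE/= in_itv/= addr_ge0// ltW.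
have := @convex_powR R al al1 (Itv01 l0 l1) a (a + b) ui vi.
have := @convex_powR R al al1 (Itv01 m0 m1) a (a + b) ui vi.
rewrite ![in X in X -> _]convRE/= /unstable.onem => h1 h2.
rewrite [X in X `^ _ <= _]convRE/= in h1; rewrite [X in X `^ _ <= _]convRE/= in h2.
move: h1 h2; rewrite !convRE/= /unstable.onem.
have -> : (1 - a / b) * a + (1 - (1 - a / b)) * (a + b) = 2 * a by field.
have -> : a / b * a + (1 - a / b) * (a + b) = b by field.
rewrite powRM//; move: (_ `^ al) (a `^ al) (b `^ al) ((a + b) `^ al) => t u v w; nra.
Qed.

(* Both powers are bounded below by their tangents, whose slopes cancel. *)
Lemma powR_volume_ge (al n c p : R) : 0 <= al -> 0 < n -> 0 < c -> 0 < p ->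
  (1 + al / n) * c `^ al <= p `^ al + al / n * (c `^ (al + n) * p `^ (- n)).
Proof.
move=> al0 n0 c0 p0; pose s := p / c; have s0 : 0 < s by rewrite divr_gt0.
have -> : p = s * c by rewrite /s divfK// gt_eqF.
clearbody s.
have cD : c `^ (al + n) = c `^ al * c `^ n by rewrite powRD// (gt_eqF c0) implybT.
rewrite cD !powRM ?(ltW s0) ?(ltW c0)//.
have -> : c `^ al * c `^ n * (s `^ (- n) * c `^ (- n)) = s `^ (- n) * c `^ al.
  by rewrite [c `^ (- n)]powRN; field; rewrite gt_eqF// powR_gt0.
rewrite mulrA -mulrDl ler_wpM2r ?powR_ge0// !powRE//.
have h1 := expR_ge1Dx (al * ln s); have h2 := expR_ge1Dx (- n * ln s).
have h3 : al / n * (1 + - n * ln s) <= al / n * expR (- n * ln s).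
  by rewrite ler_wpM2l// divr_ge0// ltW.
have h4 : al / n * (1 + - n * ln s) = al / n - al * ln s by field; rewrite gt_eqF.
lra.
Qed.

End weight_inequalities.

Section real_integrands.
Context d (T : measurableType d) (R : realType) (m : {measure set T -> \bar R}).
Implicit Types f g : T -> R.

Lemma ge0_integral_realD f g : measurable_fun [set: T] f -> measurable_fun [set: T] g ->
  (forall x, 0 <= f x) -> (forall x, 0 <= g x) ->
  (\int[m]_x (f x + g x)%:E = \int[m]_x (f x)%:E + \int[m]_x (g x)%:E)%E.
Proof.
move=> mf mg f0 g0; under eq_integral do rewrite EFinD.
by apply: ge0_integralD => //; [move=> x _; rewrite lee_fin|exact/measurable_EFinP|
  move=> x _; rewrite lee_fin|exact/measurable_EFinP].
Qed.

Lemma ge0_integral_realZ f (c : R) : measurable_fun [set: T] f -> (forall x, 0 <= f x) -> 0 <= c ->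
  (\int[m]_x (c * f x)%:E = c%:E * \int[m]_x (f x)%:E)%E.
Proof.
move=> mf f0 c0; under eq_integral do rewrite EFinM.
by apply: ge0_integralZl => //; [exact/measurable_EFinP|move=> x _; rewrite lee_fin].
Qed.

Lemma ge0_le_integral_real f g : measurable_fun [set: T] f -> measurable_fun [set: T] g ->
  (forall x, 0 <= f x) -> (forall x, f x <= g x) ->
  (\int[m]_x (f x)%:E <= \int[m]_x (g x)%:E)%E.
Proof.
move=> mf mg f0 fg; apply: ge0_le_integral => //.
- by move=> x _; rewrite lee_fin.
- exact/measurable_EFinP.
- exact/measurable_EFinP.
- by move=> x _; rewrite lee_fin.
Qed.

End real_integrands.

(** * Gaussian averages of the gauges *)

Section weight.
Context {R : realType} {N : nat}.
Local Notation mu := (@lebesgue_measure R).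
Local Notation leb := (lebesgue_rV R N).
Implicit Types (O : set 'rV[R]_N) (x h : 'rV[R]_N).

Lemma integral_line_segment (c : R) : (0 < N)%N -> 0 < c ->
  (\int[mu]_t (N%:R * `|t| `^ (N%:R - 1) * \1_(`]0, c[%classic) t)%:E = (c ^+ N)%:E)%E.
Proof.
move=> N0 c0; have mX : measurable_fun [set: R] (fun t : R => (t ^+ N.-1)%:E).
  by apply/measurable_EFinP; exact: measurable_funX.
transitivity (\int[mu]_(t in `]0%R, c[) (N%:R%:E * (t ^+ N.-1)%:E))%E.
  rewrite [RHS]integral_mkcond; apply: eq_integral => t _; rewrite patchE indicE.
  rewrite mem_setE in_itv/=; case: ifPn => [/andP[t0 _]|_]; last by rewrite mulr0.
  rewrite mulr1 -EFinM gtr0_norm//; congr (_ * _)%:E.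
  by rewrite -[in LHS](prednK N0) -natr1 addrK powR_mulrn// ltW.
rewrite ge0_integralZl//; last 2 first.
- exact: measurable_funTS.
- by move=> t /=; rewrite in_itv/= => /andP[t0 _]; rewrite lee_fin exprn_ge0// ltW.
rewrite integral_itv_bndo_bndc; last exact: measurable_funTS.
rewrite integral_exprn// prednK// -EFinM; congr EFin; field.
by rewrite pnatr_eq0 -lt0n.
Qed.

(** The origin is excluded because [ge0_integral_gauss_radial] is stated for functions vanishing
    there. *)
Definition punctured O x (k : 'rV[R]_N) : R := \1_[set k | k != 0 /\ O (x + k)] k.

Lemma measurable_punctured O x : open O -> measurable [set k | k != 0 /\ O (x + k)].
Proof.
move=> oO; rewrite (_ : mkset _ = ~` [set 0] `&` (fun k => k + x) @^-1` O); last first.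
  apply/seteqP; split => k /=; rewrite [x + k]addrC => -[k0 Ok]; split => //; exact/eqP.
apply: measurableI; first by apply: measurableC; exact: measurable_rV_origin.
rewrite -[X in measurable X]setTI; apply: measurable_rV_add => //.
exact: open_rV_measurable.
Qed.

(** P^(- N) and Q^(- N) are the integrals of N |t|^(N - 1) over ]0, 1 / P[ and ]- 1 / Q, 0[, two
    disjoint pieces of the line within O. *)
Lemma line_volume_ge O x h : (0 < N)%N -> open O -> convex_set O -> O x -> h != 0 ->
  0 < gauge O x h -> 0 < gauge O x (- h) ->
  ((gauge O x h `^ (- N%:R) + gauge O x (- h) `^ (- N%:R))%:E <=
   \int[mu]_t (N%:R * `|t| `^ (N%:R - 1) * punctured O x (t *: h))%:E)%E.
Proof.
move=> N0 oO cO Ox h0 P0 Q0.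
pose F (c t : R) := N%:R * `|t| `^ (N%:R - 1) * \1_(`]0, c[%classic) t.
have mF c : measurable_fun [set: R] (F c).
  apply: measurable_funM; last exact: measurable_indic.
  apply: measurable_funM => //; apply: (measurableT_comp (measurable_powR _)); exact: normr_measurable.
have F0 c t : 0 <= F c t by rewrite !mulr_ge0// powR_ge0.
have mFE c : measurable_fun [set: R] (fun t => (F c t)%:E) by exact/measurable_EFinP.
have F0E c t : (0 <= (F c t)%:E)%E by rewrite lee_fin.
have n1 : (-1 : R) != 0 by rewrite oppr_eq0 oner_eq0.
have mN : measurable_fun [set: R] (fun t => (F (gauge O x (- h))^-1 (- 1 * t))%:E).
  by apply: (measurableT_comp (mFE _)); exact: measurable_funM.
have eN := ge0_integral_scale n1 (mFE (gauge O x (- h))^-1) (F0E _).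
have inv_pow (p : R) : 0 < p -> p `^ (- N%:R) = p^-1 ^+ N.
  by move=> p0; rewrite powRN powR_mulrn ?(ltW p0)// exprVn.
rewrite !inv_pow// EFinD -!integral_line_segment ?invr_gt0//.
rewrite -/(F _) normrN1 invr1 mul1e in eN *.
rewrite -[X in (_ + X)%E]eN -ge0_integralD//; last first.
  exact: mFE.
apply: ge0_le_integral => //.
- by move=> t _; rewrite adde_ge0// lee_fin.
- by apply: emeasurable_funD; [exact: mFE|exact: mN].
- apply/measurable_EFinP; apply: measurable_funM.
    by apply: measurable_funM => //; apply: (measurableT_comp (measurable_powR _)); exact: normr_measurable.
  have m1 : measurable_fun [set: 'rV[R]_N] (punctured O x).
    by apply: measurable_indic; exact: measurable_punctured.
  by apply: (measurableT_comp m1); apply: measurable_rV_scale_fun.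
move=> t _; rewrite -EFinD lee_fin /F mulN1r normrN -mulrDr.
rewrite ler_wpM2l ?mulr_ge0 ?powR_ge0// /punctured !indicE !mem_setE !in_itv/=.
have key : (0 < t < (gauge O x h)^-1) || (0 < - t < (gauge O x (- h))^-1) ->
    t *: h \in [set k | k != 0 /\ O (x + k)].
  move=> /orP[] /andP[t0 tP]; apply: mem_set; split.
  - by rewrite scaler_eq0 negb_or h0 andbT gt_eqF.
  - by apply/(gauge_lt1P h oO cO Ox t0); rewrite -(ltr_pM2l P0) mulfV ?gt_eqF// in tP.
  - by rewrite scaler_eq0 negb_or h0 andbT -oppr_eq0 gt_eqF.
  - rewrite -[t *: h]opprK -scaleNr -scalerN.
    by apply/(gauge_lt1P (- h) oO cO Ox t0); rewrite -(ltr_pM2l Q0) mulfV ?gt_eqF// in tP.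
case: (boolP (0 < t < _)) key => [/andP[t0 _]|_] key.
  rewrite oppr_gt0 (ltNge t 0) (ltW t0)/= addr0 key//.
case: (boolP (0 < - t < _)) key => [_|_] key; last by rewrite addr0.
by rewrite key// add0r.
Qed.

Variables (O : set 'rV[R]_N) (x : 'rV[R]_N) (M al : R).
Hypotheses (N0 : (0 < N)%N) (oO : open O) (cO : convex_set O) (Ox : O x) (al1 : 1 < al).
Hypothesis bO : forall y, O y -> forall i, `|y 0 i| < M.

Let P h := gauge O x h.
Let Q h := gauge O x (- h).

Let al0 : 0 < al. Proof. exact: lt_trans al1. Qed.

Let nN : 0 < N%:R :> R. Proof. by rewrite ltr0n. Qed.

Let P0 h : h != 0 -> 0 < P h.
Proof. exact: (gauge_gt0 oO cO Ox bO). Qed.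

Let Q0 h : h != 0 -> 0 < Q h.
Proof. by move=> h0; apply: (gauge_gt0 oO cO Ox bO); rewrite oppr_eq0. Qed.

Let mP : measurable_fun [set: 'rV[R]_N] P.
Proof.
have mg := measurable_gauge oO.
by apply: (measurableT_comp mg (g := fun h => (x, h))); exact: measurable_fun_pair.
Qed.

Let mQ : measurable_fun [set: 'rV[R]_N] Q.
Proof.
have mN : measurable_fun [set: 'rV[R]_N] (fun h : 'rV[R]_N => - h) by exact: measurable_rV_opp_fun.
exact: (measurableT_comp mP mN).
Qed.

Let men : measurable_fun [set: 'rV[R]_N] (@enorm R N) := @measurable_enorm R N.

Let mg : measurable_fun [set: 'rV[R]_N] (@gauss_rV R N) := @measurable_gauss_rV R N.

Let g0 h : 0 <= gauss_rV h := gauss_rV_ge0 h.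

(** The exponent N + al removes the weight from the radial formula, which then yields the volume. It
    also gives the integrand degree al in h, the degree of the powers of the gauges that it will be
    compared with. *)
Lemma integral_gauge_volume_le :
  (\int[leb]_h (gauss_rV h * enorm h `^ (N%:R + al) * (P h `^ (- N%:R) + Q h `^ (- N%:R)))%:E <=
   (N%:R * Gamma ((N%:R + al) / 2))%:E * leb O)%E.
Proof.
pose H k : \bar R := (punctured O x k)%:E.
have mA := measurable_punctured x oO.
have mH : measurable_fun [set: 'rV[R]_N] H by apply/measurable_EFinP; exact: measurable_indic.
have H0 k : (0 <= H k)%E by rewrite lee_fin.
have H00 : H 0 = 0%E.
  by rewrite /H /punctured indicE memNset//= => -[]; rewrite eqxx.
have b0 : 0 < N%:R + al by rewrite addr_gt0.
have bE : N%:R + al = N%:R + (N%:R + al) - (N%:R - 1) - 1 by ring.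
have E := ge0_integral_gauss_radial b0 bE H00 mH H0.
have G0 : 0 < Gamma ((N%:R + al) / 2) by rewrite Gamma_gt0// divr_gt0.
pose K (z : 'rV[R]_N * R) : \bar R :=
  ((gauss_rV z.1 * enorm z.1 `^ (N%:R + al) * `|z.2| `^ (N%:R - 1))%:E * H (z.2 *: z.1)%R)%E.
have mK : measurable_fun [set: 'rV[R]_N * R] K.
  apply: emeasurable_funM.
    apply/measurable_EFinP; apply: measurable_funM; last first.
      by apply: measurable_powR_fun; apply: measurableT_comp => //; exact: normr_measurable.
    apply: measurable_funM; last first.
      by apply: measurable_powR_fun; exact: (measurableT_comp men measurable_fst).
    exact: (measurableT_comp mg measurable_fst).
  by apply: (measurableT_comp mH); exact: measurable_rV_scale_fun.
have K0 z : (0 <= K z)%E.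
  by apply: mule_ge0 => //; rewrite lee_fin mulr_ge0 ?powR_ge0// mulr_ge0 ?powR_ge0//.
have mIK := measurable_fun_fubini_tonelli_F (m2 := mu) K mK K0.
have IK0 h : (0 <= \int[mu]_t K (h, t))%E by apply: integral_ge0 => t _; exact: K0.
apply: (@le_trans _ _ (\int[leb]_h (N%:R%:E * \int[mu]_t K (h, t)))%E).
  apply: ge0_le_integral => //.
  - move=> h _; rewrite lee_fin mulr_ge0 ?addr_ge0 ?powR_ge0// mulr_ge0 ?powR_ge0//.
  - apply/measurable_EFinP; apply: measurable_funM.
      by apply: measurable_funM => //; exact: measurable_powR_fun.
    by apply: measurable_funD; exact: measurable_powR_fun.
  - by apply: emeasurable_funM => //; exact: mIK.
  move=> h _; have [->|h0] := eqVneq h 0.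
    rewrite (_ : enorm 0 = 0); last by apply/eqP; rewrite enorm_eq0.
    by rewrite powR0 ?gt_eqF// mulr0 mul0r; apply: mule_ge0.
  have c0 : 0 <= gauss_rV h * enorm h `^ (N%:R + al) by rewrite mulr_ge0 ?powR_ge0.
  rewrite EFinM; apply: (le_trans (lee_wpmul2l _ (line_volume_ge N0 oO cO Ox h0 (P0 h0) (Q0 h0)))).
    by rewrite lee_fin.
  have mpn : measurable_fun [set: R] (fun t : R => punctured O x (t *: h)).
    have m1 : measurable_fun [set: 'rV[R]_N] (punctured O x) by exact: measurable_indic.
    by apply: (measurableT_comp m1); apply: measurable_rV_scale_fun.
  have mab : measurable_fun [set: R] (fun t : R => `|t| `^ (N%:R - 1)).
    by apply: measurable_powR_fun; exact: normr_measurable.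
  rewrite -ge0_integralZl//; last 2 first.
  - by apply/measurable_EFinP; apply: measurable_funM => //; exact: measurable_funM.
  - by move=> t _; rewrite lee_fin !mulr_ge0 ?powR_ge0.
  rewrite -ge0_integralZl//; last first.
    exact: (measurableT_comp mK (pair1_measurable h)).
  rewrite le_eqVlt; apply/orP; left; apply/eqP; apply: eq_integral => t _.
  by rewrite /K/= /H -!EFinM; congr EFin; ring.
rewrite ge0_integralZl//.
rewrite [X in (_ * X <= _)%E]E EFinM -muleA; apply: lee_wpmul2l; first by rewrite lee_fin ltW.
apply: lee_wpmul2l; first by rewrite lee_fin ltW.
under eq_integral do rewrite subrr powRr0 mul1e.
rewrite integral_indic// setIT.
have -> : leb O = (\int[leb]_k (\1_O (k + x))%:E)%E.
  have mO := open_rV_measurable oO.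
  have m1 : measurable_fun [set: 'rV[R]_N] (fun k => (\1_O k : R)%:E).
    by apply/measurable_EFinP; exact: measurable_indic.
  rewrite (ge0_integral_rV_shift x m1); last by move=> k; rewrite lee_fin.
  by rewrite integral_indic// setIT.
rewrite -[X in (leb X <= _)%E]setIT -integral_indic//.
apply: ge0_le_integral => //.
- apply/measurable_EFinP.
  have m1 : measurable_fun [set: 'rV[R]_N] (\1_O : _ -> R).
    by apply: measurable_indic; exact: open_rV_measurable.
  exact: (measurableT_comp m1 (measurable_rV_add x)).
move=> k _; rewrite lee_fin !indicE.
case: (boolP (k \in _)) => // /set_mem[_ Ok].
by rewrite mem_set// addrC.
Qed.

Lemma lebesgue_open_gt0 : (0 < leb O)%E.
Proof.
have [r r0 rO] := open_rVP oO Ox.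
have mI (i : 'I_N) : measurable (`](x 0 i - r), (x 0 i + r)[%classic : set (measurableTypeR R)).
  exact: measurable_itv.
have E := @lebesgue_rV_box R N (fun i => `](x 0 i - r), (x 0 i + r)[%classic) mI.
apply: (@lt_le_trans _ _ (\prod_(i < N) (2 * r)%:E)%E).
  by elim/big_ind : _ => // [a b|i _]; [exact: mule_gt0|rewrite lte_fin mulr_gt0].
rewrite (_ : (\prod_(i < N) _)%E = (\prod_(i < N)
    lebesgue_measure (`](x 0 i - r)%R, (x 0 i + r)%R[%classic : set (measurableTypeR R)))%E); last first.
  apply: eq_bigr => i _; rewrite lebesgue_measure_itv/= lte_fin ltrD2l gt0_cp// -EFinB.
  by congr EFin; ring.
rewrite -E; apply: le_measure; rewrite ?inE.
- exact: (@measurable_box R N (fun i => `](x 0 i - r), (x 0 i + r)[%classic)).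
- exact: open_rV_measurable.
move=> v /= vr; rewrite -[v](subrK x) addrC; apply: rO => i; rewrite !mxE.
by have := vr i; rewrite /= in_itv/= ltr_norml; lra.
Qed.

Let mn h := Num.min (P h) (Q h).

Let mmn : measurable_fun [set: 'rV[R]_N] mn.
Proof. exact: measurable_minr. Qed.

Let mn0 h : 0 <= mn h.
Proof. by rewrite le_min /P /Q !gauge_ge0. Qed.

Lemma integral_gauge_min_ge (v : R) : 0 < v -> (leb O <= v%:E)%E ->
  (((2 * N%:R * v / sphere_area N) `^ (- (al / N%:R)) * (Gamma ((N%:R + al) / 2) / 2 * sphere_area N))%:E <=
   \int[leb]_h (gauss_rV h * mn h `^ al)%:E)%E.
Proof.
move=> v0 Ov; set S := sphere_area N; have S0 : 0 < S by exact: sphere_area_gt0.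
set G := Gamma _; have G0 : 0 < G by rewrite Gamma_gt0// divr_gt0// addr_gt0.
set k := 2 * N%:R * v / S; have k0 : 0 < k by rewrite divr_gt0// !mulr_gt0.
(* The radius of a ball of volume 2 v. The 2 appears because min (P, Q)^(- N) is bounded by P^(- N)
   + Q^(- N), which counts both half-lines. *)
pose rho := k `^ N%:R^-1; have rho0 : 0 < rho by exact: powR_gt0.
have rhoa : k `^ (- (al / N%:R)) = rho `^ (- al).
  by rewrite /rho -powRrM; congr (_ `^ _); ring.
have rhoN : rho `^ N%:R = k by rewrite /rho -powRrM mulVf ?powRr1 ?(ltW k0)// gt_eqF.
rewrite rhoa.
have mI1 : measurable_fun [set: 'rV[R]_N] (fun h => gauss_rV h * mn h `^ al).
  by apply: measurable_funM => //; exact: measurable_powR_fun.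
have mI2 : measurable_fun [set: 'rV[R]_N]
    (fun h => gauss_rV h * enorm h `^ (N%:R + al) * (P h `^ (- N%:R) + Q h `^ (- N%:R))).
  apply: measurable_funM; first by apply: measurable_funM => //; exact: measurable_powR_fun.
  by apply: measurable_funD; exact: measurable_powR_fun.
have I10 h : 0 <= gauss_rV h * mn h `^ al by rewrite mulr_ge0 ?powR_ge0.
have I20 h : 0 <= gauss_rV h * enorm h `^ (N%:R + al) * (P h `^ (- N%:R) + Q h `^ (- N%:R)).
  by rewrite mulr_ge0 ?addr_ge0 ?powR_ge0// mulr_ge0 ?powR_ge0.
pose c := al / N%:R * rho `^ (- (al + N%:R)).
have c0 : 0 <= c by rewrite mulr_ge0 ?powR_ge0// divr_ge0// ltW.
(* [powR_volume_ge] for p = min (P, Q) and c = |h| / rho, averaged over h. With this rho the volume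
   term uses up exactly the summand al / N on the left. *)
have bound : (((1 + al / N%:R) * rho `^ (- al))%:E *
    \int[leb]_h (gauss_rV h * enorm h `^ (N%:R + al - N%:R))%:E <=
    \int[leb]_h (gauss_rV h * mn h `^ al)%:E + c%:E *
    \int[leb]_h (gauss_rV h * enorm h `^ (N%:R + al) * (P h `^ (- N%:R) + Q h `^ (- N%:R)))%:E)%E.
  have EA : N%:R + al - N%:R = al by rewrite addrC addrA addNr add0r.
  have mgp : measurable_fun [set: 'rV[R]_N] (fun h => gauss_rV h * enorm h `^ al).
    by apply: measurable_funM => //; exact: measurable_powR_fun.
  have gp0 h : 0 <= gauss_rV h * enorm h `^ al by rewrite mulr_ge0 ?powR_ge0.
  have k1 : 0 <= (1 + al / N%:R) * rho `^ (- al).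
    by rewrite mulr_ge0 ?powR_ge0// addr_ge0// divr_ge0// ltW.
  rewrite EA -(ge0_integral_realZ _ mgp gp0 k1) -(ge0_integral_realZ _ mI2 I20 c0).
  rewrite -ge0_integral_realD//; last 2 first.
  - exact: measurable_funM.
  - by move=> h; rewrite mulr_ge0.
  apply: ge0_le_integral_real.
  - exact: measurable_funM.
  - by apply: measurable_funD => //; exact: measurable_funM.
  - by move=> h; rewrite mulr_ge0.
  move=> h.
  have [->|h0] := eqVneq h 0.
    rewrite (_ : enorm 0 = 0); last by apply/eqP; rewrite enorm_eq0.
    rewrite [0 `^ al]powR0 ?gt_eqF// [0 `^ (N%:R + al)]powR0 ?gt_eqF ?addr_gt0// !mulr0 mul0r mulr0 addr0; exact: (I10 0).
  have e0 : 0 < enorm h by rewrite enorm_gt0.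
  have m0 : 0 < mn h by rewrite lt_min P0// Q0.
  have K := powR_volume_ge (ltW al0) nN (divr_gt0 e0 rho0) m0.
  have K2 : mn h `^ (- N%:R) <= P h `^ (- N%:R) + Q h `^ (- N%:R).
    by rewrite /mn; have [_|_] := leP (P h) (Q h); [rewrite lerDl|rewrite lerDr]; exact: powR_ge0.
  have quot p : (enorm h / rho) `^ p = enorm h `^ p * rho `^ (- p).
    by rewrite powRM ?invr_ge0 ?enorm_ge0 ?(ltW rho0)// (powRV _ rho0) -powRN.
  rewrite [X in X <= _](_ : _ = gauss_rV h * ((1 + al / N%:R) * (enorm h / rho) `^ al)); last first.
    by rewrite quot; ring.
  rewrite [X in _ <= X](_ : _ = gauss_rV h * (mn h `^ al + al / N%:R * ((enorm h / rho) `^ (al + N%:R) *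
     (P h `^ (- N%:R) + Q h `^ (- N%:R))))); last first.
    rewrite quot /c [N%:R + al]addrC; move: (P h `^ _ + Q h `^ _) (rho `^ _) (enorm h `^ _).
    by move: (gauss_rV h) (mn h `^ al) => a1 a2 a3 a4 a5; ring.
  rewrite ler_wpM2l//; apply: (le_trans K); rewrite lerD2l ler_wpM2l ?divr_ge0 ?(ltW al0)//.
  by rewrite ler_wpM2l ?powR_ge0.
have V := integral_gauge_volume_le.
have b0 : 0 < N%:R + al by rewrite addr_gt0.
rewrite (integral_gauss_moment N0 b0) surface_unit_sphere_fin// -/S -/G -!EFinM in bound.
have {}V : (\int[leb]_h (gauss_rV h * enorm h `^ (N%:R + al) * (P h `^ (- N%:R) + Q h `^ (- N%:R)))%:E <=
    (N%:R * G * v)%:E)%E.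
  apply: (le_trans V); rewrite [X in (_ <= X)%E]EFinM; apply: lee_wpmul2l => //.
  by rewrite lee_fin mulr_ge0// ltW.
have := le_trans bound (leeD2l _ (lee_wpmul2l _ V)); rewrite lee_fin => /(_ c0).
rewrite -EFinM -leeBlDr// -EFinB; apply: le_trans.
rewrite lee_fin le_eqVlt; apply/orP; left; apply/eqP.
rewrite /c opprD [rho `^ (- al - _)]powRD; last by rewrite (gt_eqF rho0) implybT.
rewrite [rho `^ (- N%:R)]powRN rhoN /k; field.
by rewrite !gt_eqF.
Qed.

Let k0 : 0 <= 2 `^ al - 1 :> R.
Proof. by rewrite subr_ge0 -[X in X <= _](powRr0 2) ler_powR ?ler1n// ltW. Qed.

Let mx h := Num.max (P h) (Q h).

Let mmx : measurable_fun [set: 'rV[R]_N] mx.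
Proof. exact: measurable_maxr. Qed.

Lemma exists_nearest_point : exists2 y, ~ O y & forall z, ~ O z -> enorm (x - y) <= enorm (x - z).
Proof.
apply: nearest_point => //; exists (const_mx M) => /bO /(_ (Ordinal N0)).
by rewrite mxE ltNge ler_norm.
Qed.

Lemma integral_gauge_max_ge (y : 'rV[R]_N) : ~ O y ->
  (forall z, ~ O z -> enorm (x - y) <= enorm (x - z)) ->
  ((pi `^ ((N%:R - 1) / 2) * Gamma ((1 + al) / 2) * enorm (x - y) `^ (- al))%:E <=
   \int[leb]_h (gauss_rV h * mx h `^ al)%:E)%E.
Proof.
move=> Oy ymin; set dd := enorm (x - y).
have d0 : 0 < dd by rewrite enorm_gt0 subr_eq0; apply/eqP => xy; apply: Oy; rewrite -xy.
pose e := dd^-1 *: (y - x).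
have e1 : enorm e = 1.
  by rewrite /e enormZ -[y - x]opprB enormN gtr0_norm ?invr_gt0// mulVf// gt_eqF.
rewrite mulrC EFinM -(integral_gauss_dot_powR N0 al0 e1).
have mf : measurable_fun [set: 'rV[R]_N] (fun h => gauss_rV h * `|dot h e| `^ al).
  apply: measurable_funM => //; apply: measurable_powR_fun; apply: measurableT_comp; first exact: normr_measurable.
  exact: measurable_dot.
have f0 h : 0 <= gauss_rV h * `|dot h e| `^ al by rewrite mulr_ge0 ?powR_ge0.
rewrite -(ge0_integral_realZ _ mf f0) ?powR_ge0//.
apply: ge0_le_integral_real.
- exact: measurable_funM.
- by apply: measurable_funM => //; exact: measurable_powR_fun.
- by move=> h; rewrite mulr_ge0 ?powR_ge0.
move=> h; rewrite mulrCA ler_wpM2l// powRN -powRV// -powRM ?invr_ge0 ?(ltW d0)//.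
apply: ge0_ler_powR; rewrite ?nnegrE ?(ltW al0) ?mulr_ge0 ?invr_ge0 ?(ltW d0)//.
  by rewrite le_max /P gauge_ge0.
by rewrite mulrC; exact: (gauge_max_ge_dot h oO cO Ox Oy ymin).
Qed.

Lemma integral_gauge_sum_ge : (\int[leb]_h (gauss_rV h * mx h `^ al)%:E +
    (2 `^ al - 1)%:E * \int[leb]_h (gauss_rV h * mn h `^ al)%:E <=
  \int[leb]_h (gauss_rV h * (P h + Q h) `^ al)%:E)%E.
Proof.
have mI1 : measurable_fun [set: 'rV[R]_N] (fun h => gauss_rV h * mx h `^ al).
  by apply: measurable_funM => //; exact: measurable_powR_fun.
have mI2 : measurable_fun [set: 'rV[R]_N] (fun h => gauss_rV h * mn h `^ al).
  by apply: measurable_funM => //; exact: measurable_powR_fun.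
have I1 h : 0 <= gauss_rV h * mx h `^ al by rewrite mulr_ge0 ?powR_ge0.
have I2 h : 0 <= gauss_rV h * mn h `^ al by rewrite mulr_ge0 ?powR_ge0.
have mI3 : measurable_fun [set: 'rV[R]_N] (fun h => (2 `^ al - 1) * (gauss_rV h * mn h `^ al)).
  by apply: measurable_funM => //; exact: measurable_cst.
have I3 h : 0 <= (2 `^ al - 1) * (gauss_rV h * mn h `^ al) by apply: mulr_ge0; [exact: k0|exact: I2].
rewrite -(ge0_integral_realZ _ mI2 I2 k0) -(ge0_integral_realD _ mI1 mI3 I1 I3).
apply: ge0_le_integral_real.
- by apply: measurable_funD; [exact: mI1|exact: mI3].
- by apply: measurable_funM; [exact: mg|apply: measurable_powR_fun; apply: measurable_funD; [exact: mP|exact: mQ]].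
- by move=> h; apply: addr_ge0; [exact: I1|exact: I3].
move=> h; rewrite mulrCA -mulrDr ler_wpM2l//.
rewrite /mx /mn; have [PQ|QP] := leP (P h) (Q h).
  by apply: powR_majorization => //; [exact: ltW|exact: gauge_ge0].
rewrite [P h + _]addrC.
by apply: powR_majorization => //; [exact: ltW|exact: gauge_ge0|exact: ltW].
Qed.

(** Boundary points of the open set [OO] are outside [OO], hence among the competitors z outside
    O. *)
Lemma delta_ge (OO : set 'rV[R]_N) y : open OO -> O `<=` OO ->
  (forall z, ~ O z -> enorm (x - y) <= enorm (x - z)) -> ((enorm (x - y))%:E <= delta OO x)%E.
Proof.
move=> oOO OOO ymin; apply: le_ereal_inf_tmp => _ [z [_ bz] <-].
rewrite lee_fin; apply: ymin => /OOO Oz; apply: bz.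
by rewrite (interior_id OO).1.
Qed.

Lemma integral_gauge_weight_ge (OO : set 'rV[R]_N) : open OO -> O `<=` OO ->
  ((pi `^ ((N%:R - 1) / 2) * Gamma ((1 + al) / 2))%:E * (delta OO x `^ al)^-1 +
   ((2 `^ al - 1) * 2 `^ (- al) * (Gamma ((N%:R + al) / 2) / 2 * sphere_area N) *
    (N%:R / sphere_area N) `^ (- (al / N%:R)))%:E * (leb OO `^ (al / N%:R))^-1 <=
  \int[leb]_h (gauss_rV h * (P h + Q h) `^ al)%:E)%E.
Proof.
move=> oOO OOO; apply: le_trans integral_gauge_sum_ge.
have S0 : 0 < sphere_area N :> R by exact: sphere_area_gt0.
have G0 : 0 < Gamma ((N%:R + al) / 2) by rewrite Gamma_gt0// divr_gt0// addr_gt0.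
have aN : 0 < al / N%:R by rewrite divr_gt0.
apply: leeD.
  have [y Oy ymin] := exists_nearest_point.
  have d0 : 0 < enorm (x - y).
    by rewrite enorm_gt0 subr_eq0; apply/eqP => xy; apply: Oy; rewrite -xy.
  apply: le_trans (integral_gauge_max_ge Oy ymin).
  rewrite [X in (_ <= X)%E]EFinM; apply: lee_wpmul2l.
    rewrite lee_fin; apply: mulr_ge0; first exact: powR_ge0.
    by apply: ltW; apply: Gamma_gt0; apply: divr_gt0 => //; apply: addr_gt0.
  (* If [OO] has no boundary, [delta] is +oo and this term is 0. *)
  have := delta_ge oOO OOO ymin; case: (delta OO x) => [r|_|//].
    rewrite lee_fin => dr; have r0 : 0 < r by exact: lt_le_trans dr.
    rewrite poweR_EFin inver gt_eqF ?powR_gt0// lee_fin powRN.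
    rewrite lef_pV2 ?posrE ?powR_gt0//; apply: ge0_ler_powR => //; rewrite ?nnegrE ?(ltW al0)//.
      exact: ltW.
    exact: ltW.
  by rewrite poweRyr ?gt_eqF// invey lee_fin powR_ge0.
have v0 : (0 < leb OO)%E.
  apply: (lt_le_trans lebesgue_open_gt0); apply: le_measure => //; rewrite ?inE.
  - exact: open_rV_measurable.
  - exact: open_rV_measurable.
have Ov : (leb O <= leb OO)%E.
  by apply: le_measure => //; rewrite ?inE; exact: open_rV_measurable.
(* For infinite volume the inverse power is 0 and nonnegativity is enough. *)
case: (leb OO) v0 Ov => [v| |//]; last first.
  move=> _ _; rewrite poweRyr ?gt_eqF// invey mule0; apply: mule_ge0; first by rewrite lee_fin.
  by apply: integral_ge0 => h _; rewrite lee_fin mulr_ge0 ?powR_ge0.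
rewrite lte_fin => v0 Ov.
rewrite poweR_EFin inver gt_eqF ?powR_gt0// -EFinM.
apply: le_trans (lee_wpmul2l _ (integral_gauge_min_ge v0 Ov)); last by rewrite lee_fin.
have c1 : 0 < N%:R / sphere_area N :> R by rewrite divr_gt0.
have E : (2 * N%:R * v / sphere_area N) `^ (- (al / N%:R)) =
    2 `^ (- (al / N%:R)) * (N%:R / sphere_area N) `^ (- (al / N%:R)) / v `^ (al / N%:R).
  have -> : 2 * N%:R * v / sphere_area N = 2 * (N%:R / sphere_area N) * v by ring.
  have c2 : 0 <= 2 * (N%:R / sphere_area N) :> R by rewrite mulr_ge0// ltW.
  rewrite powRM ?c2 ?(ltW v0)// [(2 * _) `^ _]powRM ?(ltW c1)//.
  by rewrite [v `^ (- _)]powRN.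
(* The averaged bound carries 2^(- al / N); since N >= 1 it dominates the 2^(- al) of the stated
   constant. *)
have h2 : 2 `^ (- al) <= 2 `^ (- (al / N%:R)) :> R.
  by rewrite ler_powR ?ler1n// lerN2 ler_pdivrMr// ler_peMr ?(ltW al0)// ler1n.
rewrite E -EFinM lee_fin; set c := _ `^ (- (al / N%:R)) in h2 *.
rewrite [X in X <= _](_ : _ = (2 `^ al - 1) * (Gamma ((N%:R + al) / 2) / 2 * sphere_area N) *
  (N%:R / sphere_area N) `^ (- (al / N%:R)) / v `^ (al / N%:R) * 2 `^ (- al)); last by ring.
rewrite [X in _ <= X](_ : _ = (2 `^ al - 1) * (Gamma ((N%:R + al) / 2) / 2 * sphere_area N) *
  (N%:R / sphere_area N) `^ (- (al / N%:R)) / v `^ (al / N%:R) * c); last by ring.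
apply: ler_wpM2l => //; rewrite divr_ge0 ?powR_ge0// mulr_ge0 ?powR_ge0// mulr_ge0//.
by rewrite mulr_ge0 ?(ltW S0)// divr_ge0// ltW.
Qed.

End weight.

(** * The Hardy inequality on bounded convex sets *)

Section delta_measurable.
Context {R : realType} {N : nat}.
Implicit Types (O : set 'rV[R]_N).

(** The infimum is over an uncountable set, but its strict sublevel sets are unions of open
    balls. *)
Lemma measurable_delta O : measurable_fun [set: 'rV[R]_N] (delta O).
Proof.
apply: (measurability _ (ErealGenInftyO.measurableE R)) => // _ [_ [r ->] <-].
rewrite setTI (_ : _ @^-1` _ = \bigcup_(y in boundary O) [set x | enorm (x - y) < r]).
  apply: open_rV_measurable; apply: bigcup_open => y _.
  rewrite (_ : mkset _ = (fun x => enorm (x - y)) @^-1` `]-oo, r[%classic); last first.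
    by apply/seteqP; split => x /=; rewrite in_itv.
  have /continuousP cf : continuous (fun x : 'rV[R]_N => enorm (x - y)).
    move=> x; apply: (@continuous_comp _ _ _ (fun x : 'rV[R]_N => x - y) (@enorm R N)).
      by apply: continuousB; [exact: cvg_id|exact: cst_continuous].
    exact: enorm_continuous.
  by apply: cf; exact: interval_open.
apply/seteqP; split => x /=; rewrite in_itv/=.
  by move=> /ereal_inf_lt[_ [y by_ <-]]; rewrite lte_fin => xy; exists y.
move=> [y by_ xy]; apply: (@le_lt_trans _ _ (enorm (x - y))%:E); last by rewrite lte_fin.
by apply: ereal_inf_lbound; exists y.
Qed.

Lemma measurable_delta_weight O (al : R) :
  measurable_fun [set: 'rV[R]_N] (fun x => (delta O x `^ al)^-1%E).
Proof.
apply: (measurability _ (ErealGenOInfty.measurableE R)) => // _ [_ [r ->] <-].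
rewrite setTI; have [r0|r0] := ltP r 0.
  rewrite (_ : _ @^-1` _ = setT)//; apply/seteqP; split => // x _ /=.
  rewrite in_itv/= andbT; apply: (@lt_le_trans _ _ 0%E); first by rewrite lte_fin.
  by rewrite inve_ge0 poweR_ge0.
rewrite (_ : _ @^-1` _ = setT `&` [set x | (delta O x `^ al < (r%:E)^-1)%E]).
  apply: emeasurable_fun_infty_o => //.
  exact: (measurableT_comp (measurable_poweR al) (measurable_delta O)).
apply/seteqP; split => x /=; rewrite in_itv/= andbT.
  by rewrite inve_pgt// ?inE ?lee_fin// ?poweR_ge0.
by move=> [_ h]; rewrite inve_pgt// ?inE ?lee_fin// ?poweR_ge0.
Qed.

End delta_measurable.

(** * Energy and weight on a bounded set *)

Section bounded_domain.
Context {R : realType} {N : nat}.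
Local Notation mu := (@lebesgue_measure R).
Local Notation leb := (lebesgue_rV R N).
Implicit Types (O : set 'rV[R]_N) (h x k : 'rV[R]_N).
Variables (O : set 'rV[R]_N) (phi : 'rV[R]_N -> R) (al : R).
Hypotheses (N0 : (0 < N)%N) (oO : open O) (mphi : measurable_fun [set: 'rV[R]_N] phi).
Hypotheses (al1 : 1 < al).

Let al0 : 0 < al. Proof. exact: lt_trans al1. Qed.
Let b := N%:R + al.
Let b0 : 0 < b. Proof. by rewrite addr_gt0// ltr0n. Qed.

Let mO1 : measurable_fun [set: 'rV[R]_N] (\1_O : _ -> R).
Proof. by apply: measurable_indic; exact: open_rV_measurable. Qed.

Let F (z : 'rV[R]_N * 'rV[R]_N) : R :=
  \1_O z.1 * \1_O (z.1 + z.2) * (phi z.1 - phi (z.1 + z.2)) ^+ 2.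

Let F0 z : 0 <= F z.
Proof. by rewrite mulr_ge0 ?sqr_ge0// mulr_ge0. Qed.

Let mF : measurable_fun [set: 'rV[R]_N * 'rV[R]_N] F.
Proof.
have ma : measurable_fun [set: 'rV[R]_N * 'rV[R]_N] (fun z => z.1 + z.2).
  exact: measurable_rV_add_fun.
apply: measurable_funM; first apply: measurable_funM.
- exact: (measurableT_comp mO1 measurable_fst).
- exact: (measurableT_comp mO1 ma).
apply: measurable_funX; apply: measurable_funB.
- exact: (measurableT_comp mphi measurable_fst).
- exact: (measurableT_comp mphi ma).
Qed.

Definition energy : \bar R := (\int[leb \x leb]_(z in O `*` O)
  ((phi z.1 - phi z.2) ^+ 2 / enorm (z.1 - z.2) `^ (N%:R + al))%:E)%E.

Let H k : \bar R := (\int[leb]_x (F (x, k))%:E)%E.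

Let mH : measurable_fun [set: 'rV[R]_N] H.
Proof.
apply: (measurable_fun_fubini_tonelli_G (m1 := leb) (EFin \o F)).
  exact/measurable_EFinP.
by move=> z; rewrite lee_fin.
Qed.

Let H0 k : (0 <= H k)%E.
Proof. by apply: integral_ge0 => x _; rewrite lee_fin. Qed.

Let energyE : energy = (\int[leb]_k ((enorm k `^ (- b))%:E * H k))%E.
Proof.
pose G (z : 'rV[R]_N * 'rV[R]_N) : \bar R := (enorm z.2 `^ (- b) * F z)%:E.
have mG : measurable_fun [set: 'rV[R]_N * 'rV[R]_N] G.
  apply/measurable_EFinP; apply: measurable_funM => //; apply: measurable_powR_fun.
  exact: (measurableT_comp (@measurable_enorm R N) measurable_snd).
have G0 z : (0 <= G z)%E by rewrite lee_fin mulr_ge0 ?powR_ge0.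
transitivity (\int[leb]_k \int[leb]_x G (x, k))%E; last first.
  apply: eq_integral => k _; rewrite -ge0_integral_realZ ?powR_ge0//.
  by exact: (measurableT_comp mF (pair2_measurable k)).
have T1 := @fubini_tonelli _ _ _ _ _ leb leb G mG G0; rewrite -[RHS]T1; clear T1.
pose E (z : 'rV[R]_N * 'rV[R]_N) : \bar R :=
  (enorm (z.1 - z.2) `^ (- b) * (\1_O z.1 * \1_O z.2 * (phi z.1 - phi z.2) ^+ 2))%:E.
have mE : measurable_fun [set: 'rV[R]_N * 'rV[R]_N] E.
  have mN : measurable_fun [set: 'rV[R]_N * 'rV[R]_N] (fun z => - z.2).
    exact: measurable_rV_opp_fun.
  have mB : measurable_fun [set: 'rV[R]_N * 'rV[R]_N] (fun z => z.1 - z.2).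
    exact: (measurable_rV_add_fun measurable_fst mN).
  apply/measurable_EFinP; apply: measurable_funM.
    by apply: measurable_powR_fun; exact: (measurableT_comp (@measurable_enorm R N) mB).
  apply: measurable_funM; first apply: measurable_funM.
  - exact: (measurableT_comp mO1 measurable_fst).
  - exact: (measurableT_comp mO1 measurable_snd).
  apply: measurable_funX; apply: measurable_funB.
  - exact: (measurableT_comp mphi measurable_fst).
  - exact: (measurableT_comp mphi measurable_snd).
have E0 z : (0 <= E z)%E.
  by rewrite lee_fin mulr_ge0 ?powR_ge0// mulr_ge0 ?sqr_ge0// mulr_ge0.
transitivity (\int[leb \x leb]_z E z)%E.
  rewrite /energy integral_mkcond; apply: eq_integral => -[x y] _.
  rewrite patchE /E !indicE/= in_setX; case: (x \in O); case: (y \in O) => /=;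
    rewrite ?(mulr0, mul0r, mulr1)//.
  by rewrite mul1r powRN mulrC.
rewrite (fubini_tonelli1 E mE E0); apply: eq_integral => x _.
rewrite /fubini_F.
have mEx : measurable_fun [set: 'rV[R]_N] (fun y => E (x, y)).
  exact: (measurableT_comp mE (pair1_measurable x)).
rewrite -(ge0_integral_rV_shift x mEx (fun y => E0 (x, y))).
apply: eq_integral => k _; rewrite /E /G /F/= [k + x]addrC opprD addrA subrr add0r enormN.
by [].
Qed.

(** The radial formula with m = 0 and g = - (1 + al), for which b = N + al. It applies because the
    differences, and so [H], vanish at k = 0. *)
Lemma energy_gauss : ((Gamma ((N%:R + al) / 2))%:E * energy =
  \int[leb]_h ((gauss_rV h)%:E * energy_dir O h phi al))%E.
Proof.
have H00 : H 0 = 0%E.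
  by apply: integral0_eq => x _; rewrite /F/= addr0 subrr expr0n mulr0.
have bE : b = N%:R + 0 - (- (1 + al)) - 1 by rewrite /b; ring.
have := ge0_integral_gauss_radial b0 bE H00 mH H0; rewrite -/b energyE sub0r => <-.
apply: eq_integral => h _.
pose L (z : 'rV[R]_N * R) : \bar R := (F (z.1, z.2 *: h) * `|z.2| `^ (- (1 + al)))%:E.
have mab : measurable_fun [set: R] (fun t : R => `|t| `^ (- (1 + al))).
  by apply: measurable_powR_fun; exact: normr_measurable.
have mL : measurable_fun [set: 'rV[R]_N * R] L.
  apply/measurable_EFinP; apply: measurable_funM.
    apply: (measurableT_comp mF (g := fun z : 'rV[R]_N * R => (z.1, z.2 *: h))).
    apply: measurable_fun_pair; first exact: measurable_fst.
    exact: measurable_rV_scale_fun.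
  exact: (measurableT_comp mab measurable_snd).
have L0 z : (0 <= L z)%E by rewrite lee_fin mulr_ge0 ?powR_ge0.
have T1 := @fubini_tonelli _ _ _ _ _ leb mu L mL L0.
rewrite -[energy_dir O h phi al]/(\int[leb]_x \int[mu]_t L (x, t))%E [in RHS]T1.
have mIL := measurable_fun_fubini_tonelli_G (m1 := leb) L mL L0.
have IL0 t : (0 <= \int[leb]_x L (x, t))%E by apply: integral_ge0 => x _; exact: L0.
have gE : (0 <= (gauss_rV h)%:E)%E by rewrite lee_fin gauss_rV_ge0.
rewrite -(ge0_integralZl mu measurableT mIL (fun t _ => IL0 t) gE).
apply: eq_integral => t _; rewrite powRr0 mulr1 EFinM -muleA; congr (_ * _)%E.
rewrite -ge0_integralZl//; last 2 first.
- by apply/measurable_EFinP; exact: (measurableT_comp mF (pair2_measurable (t *: h))).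
- by move=> x _; rewrite lee_fin.
by apply: eq_integral => x _; rewrite -EFinM mulrC.
Qed.

Definition hardy_volume_constant : R :=
  (2 `^ al - 1) * 2 `^ (- al) * (Gamma ((N%:R + al) / 2) / 2 * sphere_area N) *
  (N%:R / sphere_area N) `^ (- (al / N%:R)).

(** The left-hand side of [integral_gauge_weight_ge]; as a single weight it lets the approximation
    argument treat the distance and volume terms together. *)
Definition hardy_weight (OO : set 'rV[R]_N) x : \bar R :=
  ((pi `^ ((N%:R - 1) / 2) * Gamma ((1 + al) / 2))%:E * (delta OO x `^ al)^-1 +
   hardy_volume_constant%:E * (leb OO `^ (al / N%:R))^-1)%E.

Lemma hardy_volume_constant_ge0 : 0 <= hardy_volume_constant.
Proof.
apply: mulr_ge0; last exact: powR_ge0.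
apply: mulr_ge0.
  apply: mulr_ge0; last exact: powR_ge0.
  by rewrite subr_ge0 -[X in X <= _](powRr0 2) ler_powR ?ler1n// ltW.
apply: mulr_ge0; last by apply: ltW; exact: sphere_area_gt0.
by apply: divr_ge0; [apply: ltW; apply: Gamma_gt0; exact: divr_gt0|].
Qed.

Lemma hardy_weight_ge0 OO x : (0 <= hardy_weight OO x)%E.
Proof.
apply: adde_ge0; apply: mule_ge0; rewrite ?inve_ge0 ?poweR_ge0// lee_fin.
  apply: mulr_ge0; first exact: powR_ge0.
  by apply: ltW; apply: Gamma_gt0; apply: divr_gt0 => //; apply: addr_gt0.
exact: hardy_volume_constant_ge0.
Qed.

Lemma measurable_hardy_weight OO : measurable_fun [set: 'rV[R]_N] (hardy_weight OO).
Proof.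
apply: emeasurable_funD; last exact: measurable_cst.
apply: emeasurable_funM; first exact: measurable_cst.
exact: measurable_delta_weight.
Qed.

Section hardy.
Variables (M r : R) (OO : set 'rV[R]_N).
Hypotheses (cO : convex_set O) (bO : forall y, O y -> forall i, `|y 0 i| < M) (al2 : al < 2).
Hypotheses (r0 : 0 < r)
  (rO : forall x, O x -> phi x != 0 -> forall v : 'rV[R]_N, (forall i, `|v 0 i| < r) -> O (x + v)).
Hypotheses (phi2 : (\int[leb]_(x in O) (phi x ^+ 2)%:E < +oo)%E).
Hypotheses (oOO : open OO) (OOO : O `<=` OO).

Let S (z : 'rV[R]_N * 'rV[R]_N) : R := gauge O z.2 z.1 + gauge O z.2 (- z.1).

Let mS : measurable_fun [set: 'rV[R]_N * 'rV[R]_N] S.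
Proof.
have mN : measurable_fun [set: 'rV[R]_N * 'rV[R]_N] (fun z => - z.1).
  exact: measurable_rV_opp_fun.
have mg := measurable_gauge oO.
apply: measurable_funD.
  apply: (measurableT_comp mg (g := fun z : 'rV[R]_N * 'rV[R]_N => (z.2, z.1))).
  exact: measurable_fun_pair.
apply: (measurableT_comp mg (g := fun z : 'rV[R]_N * 'rV[R]_N => (z.2, - z.1))).
exact: measurable_fun_pair.
Qed.

Let S0 z : 0 <= S z. Proof. by rewrite addr_ge0 ?gauge_ge0. Qed.

Let m (z : 'rV[R]_N * 'rV[R]_N) : R := \1_O z.2 * (phi z.2 ^+ 2 * S z `^ al).

Let mm : measurable_fun [set: 'rV[R]_N * 'rV[R]_N] m.
Proof.
apply: measurable_funM; first exact: (measurableT_comp mO1 measurable_snd).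
apply: measurable_funM; last exact: measurable_powR_fun.
by apply: measurable_funX; exact: (measurableT_comp mphi measurable_snd).
Qed.

Let m0 z : 0 <= m z.
Proof. by rewrite mulr_ge0// mulr_ge0 ?sqr_ge0 ?powR_ge0. Qed.

Let mass_dirE h : mass_dir O h phi al = (\int[leb]_x (m (h, x))%:E)%E.
Proof. by []. Qed.

Let mmass : measurable_fun [set: 'rV[R]_N] (fun h => mass_dir O h phi al).
Proof.
apply: (measurable_fun_fubini_tonelli_F (m2 := leb) (EFin \o m)); first exact/measurable_EFinP.
by move=> z; rewrite lee_fin.
Qed.

Let mass_ge0 h : (0 <= mass_dir O h phi al)%E.
Proof. by rewrite mass_dirE; apply: integral_ge0 => x _; rewrite lee_fin. Qed.

Let menergy : measurable_fun [set: 'rV[R]_N] (fun h => energy_dir O h phi al).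
Proof.
pose L (z : ('rV[R]_N * 'rV[R]_N) * R) : \bar R :=
  (F (z.1.2, z.2 *: z.1.1) * `|z.2| `^ (- (1 + al)))%:E.
have mab : measurable_fun [set: R] (fun t : R => `|t| `^ (- (1 + al))).
  by apply: measurable_powR_fun; exact: normr_measurable.
have mL : measurable_fun [set: ('rV[R]_N * 'rV[R]_N) * R] L.
  apply/measurable_EFinP; apply: measurable_funM; last exact: (measurableT_comp mab measurable_snd).
  apply: (measurableT_comp mF (g := fun z : ('rV[R]_N * 'rV[R]_N) * R => (z.1.2, z.2 *: z.1.1))).
  apply: measurable_fun_pair; first exact: (measurableT_comp measurable_snd measurable_fst).
  apply: measurable_rV_scale_fun; first exact: measurable_snd.
  exact: (measurableT_comp measurable_fst measurable_fst).
have L0 z : (0 <= L z)%E by rewrite lee_fin mulr_ge0 ?powR_ge0.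
have m2 := measurable_fun_fubini_tonelli_F (m2 := mu) L mL L0.
apply: (measurable_fun_fubini_tonelli_F (m2 := leb) _ m2).
by move=> z; apply: integral_ge0 => t _; exact: L0.
Qed.

Let energy_ge0 h : (0 <= energy_dir O h phi al)%E.
Proof.
apply: integral_ge0 => x _; apply: integral_ge0 => t _.
by rewrite lee_fin mulr_ge0 ?powR_ge0//; exact: (F0 (x, t *: h)).
Qed.

(** The margin r bounds the gauges by |h| / r wherever phi is nonzero; [hardy_dir] requires finite
    mass. *)
Let mass_lty h : (mass_dir O h phi al < +oo)%E.
Proof.
pose c := (2 * (enorm h / r)) `^ al.
have c0 : 0 <= c by exact: powR_ge0.
have mp : measurable_fun [set: 'rV[R]_N] (fun x => \1_O x * phi x ^+ 2).
  by apply: measurable_funM => //; exact: measurable_funX.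
have p0 x : 0 <= \1_O x * phi x ^+ 2 by rewrite mulr_ge0 ?sqr_ge0.
apply: (@le_lt_trans _ _ (\int[leb]_x (c * (\1_O x * phi x ^+ 2))%:E)%E).
  rewrite mass_dirE; apply: ge0_le_integral_real.
  - exact: (measurableT_comp mm (pair1_measurable h)).
  - exact: measurable_funM.
  - by move=> x; exact: m0.
  move=> x; rewrite /m/= indicE; case: (boolP (x \in O)) => [/set_mem Ox|_]; last by rewrite !mul0r mulr0.
  rewrite !mul1r [leRHS]mulrC; have [->|px] := eqVneq (phi x) 0; first by rewrite expr0n !mul0r.
  rewrite ler_wpM2l ?sqr_ge0//.
  have h1 := gauge_le h oO cO r0 (rO Ox px).
  have := gauge_le (- h) oO cO r0 (rO Ox px); rewrite enormN => h2.
  apply: ge0_ler_powR; rewrite ?nnegrE ?(ltW al0)//.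
    by rewrite mulr_ge0// divr_ge0 ?enorm_ge0// ltW.
  by rewrite /S/= mulr_natl mulr2n lerD.
rewrite ge0_integral_realZ//; apply: lte_mul_pinfty => //.
apply: le_lt_trans phi2; rewrite [leRHS]integral_mkcond.
rewrite le_eqVlt; apply/orP; left; apply/eqP; apply: eq_integral => x _.
by rewrite patchE indicE; case: (x \in O); rewrite ?mul1r ?mul0r.
Qed.

(** [hardy_dir] is averaged over h; Tonelli then puts the average inside, where the weight bound
    holds for each x. *)
Lemma hardy_bounded : 0 <= hardy1 al ->
  ((2 * hardy1 al)%:E * \int[leb]_(x in O) ((phi x ^+ 2)%:E * hardy_weight OO x) <=
   (Gamma ((N%:R + al) / 2))%:E * energy)%E.
Proof.
move=> k0; rewrite energy_gauss.
have K0 : (0 <= (2 * hardy1 al)%:E)%E by rewrite lee_fin mulr_ge0.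
have mgE : measurable_fun [set: 'rV[R]_N] (fun h => (gauss_rV h : R)%:E).
  by apply/measurable_EFinP; exact: measurable_gauss_rV.
have gE h : (0 <= (gauss_rV (h : 'rV[R]_N))%:E)%E by rewrite lee_fin gauss_rV_ge0.
apply: (@le_trans _ _ (\int[leb]_h ((2 * hardy1 al)%:E * ((gauss_rV h)%:E * mass_dir O h phi al)))%E); last first.
  apply: ge0_le_integral => //.
  - by move=> h _; apply: mule_ge0 => //; apply: mule_ge0.
  - by apply: emeasurable_funM; [exact: measurable_cst|exact: emeasurable_funM].
  - exact: emeasurable_funM.
  move=> h _; rewrite muleCA; apply: lee_wpmul2l => //.
  (* [hardy_dir] assumes positive gauges; for h = 0 they vanish, and the mass with them. *)
  have [->|h0] := eqVneq h 0.
    have -> : mass_dir O 0 phi al = 0%E; last by rewrite mule0.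
    apply: integral0_eq => x _; rewrite indicE.
    case: (boolP (x \in O)) => [/set_mem Ox|_]; last by rewrite mul0r.
    have [r' r'0 r'O] := open_rVP oO Ox.
    have G00 : gauge O x 0 = 0.
      apply/eqP; rewrite eq_le gauge_ge0 andbT.
      apply: (le_trans (gauge_le 0 oO cO r'0 r'O)).
      by rewrite (_ : enorm 0 = 0) ?mul0r//; apply/eqP; rewrite enorm_eq0.
    by rewrite oppr0 G00 addr0 powR0 ?gt_eqF// !mulr0.
  apply: hardy_dir => //.
  - by move=> x Ox; exact: (gauge_gt0 oO cO Ox bO).
  - by move=> x Ox; apply: (gauge_gt0 oO cO Ox bO); rewrite oppr_eq0.
rewrite ge0_integralZl//; last 2 first.
- exact: emeasurable_funM.
- by move=> h _; exact: mule_ge0.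
apply: lee_wpmul2l => //.
pose D (z : 'rV[R]_N * 'rV[R]_N) : \bar R := (gauss_rV z.1 * m z)%:E.
have mD : measurable_fun [set: 'rV[R]_N * 'rV[R]_N] D.
  apply/measurable_EFinP; apply: measurable_funM => //.
  exact: (measurableT_comp (@measurable_gauss_rV R N) measurable_fst).
have D0 z : (0 <= D z)%E by rewrite lee_fin mulr_ge0 ?gauss_rV_ge0.
have T1 := @fubini_tonelli _ _ _ _ _ leb leb D mD D0.
rewrite [leRHS](_ : _ = \int[leb]_h \int[leb]_x D (h, x))%E; last first.
  apply: eq_integral => h _; rewrite mass_dirE.
  have mmh : measurable_fun [set: 'rV[R]_N] (fun x => m (h, x)).
    exact: (measurableT_comp mm (pair1_measurable h)).
  by rewrite -(ge0_integral_realZ _ mmh (fun x => m0 (h, x)) (gauss_rV_ge0 h)).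
rewrite [leRHS]T1 [leLHS](_ : _ = \int[leb]_x ((\1_O x * phi x ^+ 2)%:E * hardy_weight OO x))%E; last first.
  rewrite integral_mkcond; apply: eq_integral => x _; rewrite patchE indicE.
  by case: (x \in O); rewrite ?mul1r ?mul0r ?mul0e.
apply: ge0_le_integral; first exact: measurableT.
- move=> x _; apply: mule_ge0; last exact: hardy_weight_ge0.
  by rewrite lee_fin mulr_ge0 ?sqr_ge0.
- apply: emeasurable_funM; last exact: measurable_hardy_weight.
  apply/measurable_EFinP; apply: measurable_funM; first exact: mO1.
  by apply: measurable_funX; exact: mphi.
- exact: (measurable_fun_fubini_tonelli_G (m1 := leb) D mD D0).
move=> x _; rewrite indicE; case: (boolP (x \in O)) => [/set_mem Ox|_]; last first.
  by rewrite mul0r mul0e; apply: integral_ge0 => h _; exact: D0.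
rewrite mul1r.
have W := integral_gauge_weight_ge N0 oO cO Ox al1 bO oOO OOO.
apply: (le_trans (lee_wpmul2l _ W)); first by rewrite lee_fin sqr_ge0.
have mW : measurable_fun [set: 'rV[R]_N]
    (fun h => gauss_rV h * (gauge O x h + gauge O x (- h)) `^ al).
  apply: measurable_funM; first exact: measurable_gauss_rV.
  by apply: measurable_powR_fun; exact: (measurableT_comp mS (pair2_measurable x)).
have W0 h : 0 <= gauss_rV h * (gauge O x h + gauge O x (- h)) `^ al.
  by apply: mulr_ge0; [exact: gauss_rV_ge0|exact: powR_ge0].
rewrite -(ge0_integral_realZ _ mW W0 (sqr_ge0 _)).
rewrite le_eqVlt; apply/orP; left; apply/eqP; apply: eq_integral => h _.
congr EFin; rewrite /m indicE (mem_set Ox) mul1r mulrCA; reflexivity.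
Qed.

End hardy.
End bounded_domain.

(** * Approximation by smooth functions *)

Section compact_margin.
Context {R : realType} {N : nat}.
Implicit Types (K O : set 'rV[R]_N) (x v : 'rV[R]_N).

Lemma compact_rV_bounded K : compact K -> exists2 M : R, 0 < M & forall x, K x -> forall i, `|x 0 i| < M.
Proof.
move=> /compact_near_coveringP cK.
have [] := cK R (pinfty_nbhs R) (fun M x => forall i, `|x 0 i| < M) _.
  move=> x Kx; exists ([set y : 'rV[R]_N | forall i, `|(y - x) 0 i| < 1], [set M : R | enorm x + 1 < M]) => /=.
    split; last by apply: nbhs_pinfty_gt; rewrite num_real.
    apply: (nbhs_rV ltr01) => v vr i; rewrite !mxE addrAC subrr add0r; exact: vr.
  move=> [y M] /= [yx xM] i; apply: lt_trans xM.
  rewrite -[y](subrK x) addrC mxE (le_lt_trans (ler_normD _ _))// ler_ltD//.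
  exact: le_coord_enorm.
move=> M [_ MK]; exists (Num.max M 0 + 1).
  by rewrite ltr_wpDl// le_max lexx orbT.
move=> x Kx; apply: (MK _ _ x Kx) => /=.
by rewrite (@le_lt_trans _ _ (Num.max M 0)) ?ltrDl// le_max lexx.
Qed.

(** Compactness is used as a near-covering property: half of a local radius locates the nearby
    point, the other half is its margin. *)
Lemma compact_open_margin K O : compact K -> open O -> K `<=` O ->
  exists2 r : R, 0 < r & forall x, K x -> forall v, (forall i, `|v 0 i| < r) -> O (x + v).
Proof.
move=> /compact_near_coveringP cK oO KO.
have [] := cK R (at_right 0) (fun r x => forall v, (forall i, `|v 0 i| < r) -> O (x + v)) _.
  move=> x Kx; have [r r0 rO] := open_rVP oO (KO x Kx).
  have r2 : 0 < r / 2 by rewrite divr_gt0.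
  exists ([set y : 'rV[R]_N | forall i, `|(y - x) 0 i| < r / 2], [set t : R | t < r / 2]) => /=.
    split; last exact: nbhs_right_lt.
    apply: (nbhs_rV r2) => v vr i; rewrite !mxE addrAC subrr add0r; exact: vr.
  move=> [y t] /= [yx tr] v vt; rewrite -[y](subrK x) addrAC addrC; apply: rO => i.
  rewrite mxE (le_lt_trans (ler_normD _ _))// (splitr r) ltrD// (lt_trans (vt i))//.
move=> r /= r0 rK; exists (r / 2); first by rewrite divr_gt0.
move=> x Kx v vr; apply: (rK (r / 2) _ _ x Kx v vr).
  by rewrite /= sub0r normrN gtr0_norm ?divr_gt0// ltr_pdivrMr// mulr_natr mulr2n ltrDl.
by rewrite divr_gt0.
Qed.

End compact_margin.

Section density.
Context d (T : measurableType d) (R : realType) (m : {measure set T -> \bar R}).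
Variables (D : set T) (mD : measurable D).

(** A triangle inequality for squared norms, from Young's inequality, that tolerates infinite
    values. *)
Lemma ge0_integral_square_split (f g w : T -> R) (eta : R) :
  measurable_fun [set: T] f -> measurable_fun [set: T] g -> measurable_fun [set: T] w ->
  (forall x, 0 <= w x) -> 0 < eta ->
  (\int[m]_(x in D) (w x * f x ^+ 2)%:E <=
   (1 + eta)%:E * \int[m]_(x in D) (w x * g x ^+ 2)%:E +
   (1 + eta^-1)%:E * \int[m]_(x in D) (w x * (f x - g x) ^+ 2)%:E)%E.
Proof.
move=> mf mg mw w0 e0.
have mi (k : T -> R) : measurable_fun [set: T] k -> measurable_fun D (fun x => (w x * k x ^+ 2)%:E).
  move=> mk; apply: measurable_funTS; apply/measurable_EFinP; apply: measurable_funM => //.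
  exact: measurable_funX.
have i0 (k : T -> R) x : D x -> (0 <= (w x * k x ^+ 2)%:E)%E.
  by move=> _; rewrite lee_fin mulr_ge0 ?sqr_ge0.
have mfg : measurable_fun [set: T] (fun x => f x - g x) by exact: measurable_funB.
have c1 : (0 <= (1 + eta)%:E)%E by rewrite lee_fin addr_ge0// ltW.
have c2 : (0 <= (1 + eta^-1)%:E)%E by rewrite lee_fin addr_ge0// invr_ge0 ltW.
rewrite -(ge0_integralZl m mD (mi _ mg) (i0 _) c1) -(ge0_integralZl m mD (mi _ mfg) (i0 _) c2).
rewrite -ge0_integralD//; last 4 first.
- by move=> x Dx; apply: mule_ge0 => //; exact: (i0 g).
- by apply: emeasurable_funM; [exact: measurable_cst|exact: mi].
- by move=> x Dx; apply: mule_ge0 => //; exact: (i0 (fun x => f x - g x)).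
- by apply: emeasurable_funM; [exact: measurable_cst|exact: mi].
apply: ge0_le_integral => //.
- exact: i0.
- exact: mi.
- apply: emeasurable_funD; apply: emeasurable_funM; try exact: measurable_cst; exact: mi.
move=> x Dx; rewrite -!EFinM -EFinD lee_fin.
have -> : (1 + eta) * (w x * g x ^+ 2) + (1 + eta^-1) * (w x * (f x - g x) ^+ 2) =
   w x * (f x ^+ 2) + w x * ((eta * g x - (f x - g x)) ^+ 2 / eta) by field; rewrite gt_eqF.
by rewrite lerDl mulr_ge0// divr_ge0 ?sqr_ge0// ltW.
Qed.

Lemma cvg_mine_nat (v : \bar R) : (0 <= v)%E ->
  (Order.min v n%:R%:E @[n --> \oo] --> v)%E.
Proof.
case: v => [r| |//] r0.
  apply: cvg_near_cst; near=> n; apply: min_l.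
  by rewrite lee_fin; near: n; exact: nbhs_infty_ger.
rewrite (_ : (fun n => _) = (fun n : nat => (n%:R : R)%:E)); last first.
  by apply/funext => n; apply: min_r; rewrite leey.
by apply/cvgenyP; exact: cvg_id.
Unshelve. all: by end_near.
Qed.

(** Approximation in L^2 controls only bounded weights, while the Hardy weight is unbounded;
    monotone convergence removes the truncation afterwards. *)
Lemma ge0_integral_square_truncation (u : T -> R) (V : T -> \bar R) (a : \bar R) :
  measurable_fun [set: T] u -> measurable_fun [set: T] V -> (forall x, (0 <= V x)%E) ->
  (forall n : nat, (\int[m]_(x in D) (fine (Order.min (V x) n%:R%:E)%E * u x ^+ 2)%:E <= a)%E) ->
  (\int[m]_(x in D) ((u x ^+ 2)%:E * V x) <= a)%E.
Proof.
move=> mu mV V0 bd.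
pose g n x : \bar R := ((u x ^+ 2)%:E * Order.min (V x) n%:R%:E)%E.
have gE n x : g n x = (fine (Order.min (V x) n%:R%:E)%E * u x ^+ 2)%:E.
  rewrite /g EFinM muleC fineK// ge0_fin_numE; last by rewrite le_min V0 lee_fin/=.
  by rewrite (@le_lt_trans _ _ n%:R%:E) ?ltry// ge_min lexx orbT.
have cg x : (g n x @[n --> \oo] --> (u x ^+ 2)%:E * V x)%E.
  by apply: cvgeZl => //; exact: cvg_mine_nat.
have lg x : limn (g^~ x) = ((u x ^+ 2)%:E * V x)%E by apply/cvg_lim => //; exact: cg.
have mg n : measurable_fun D (g n).
  apply: measurable_funTS; apply: emeasurable_funM.
    by apply/measurable_EFinP; exact: measurable_funX.
  by apply: measurable_mine => //; exact: measurable_cst.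
have g0 n x : D x -> (0 <= g n x)%E.
  by move=> _; apply: mule_ge0; [rewrite lee_fin sqr_ge0|rewrite le_min V0 lee_fin/=].
have nd x : D x -> {homo g^~ x : n k / (n <= k)%N >-> (n <= k)%E}.
  move=> _ n k nk; apply: lee_wpmul2l; first by rewrite lee_fin sqr_ge0.
  rewrite le_min ge_min lexx/= ge_min; apply/orP; right.
  by rewrite lee_fin ler_nat.
have h := @cvg_monotone_convergence _ _ _ m D mD g mg g0 nd.
have E : (\int[m]_(x in D) limn (g^~ x) = \int[m]_(x in D) ((u x ^+ 2)%:E * V x))%E.
  by apply: eq_integral => x _; exact: lg.
rewrite -E; apply: (cvge_to_le h); apply: nearW => n.
by under eq_integral do rewrite gE; exact: bd.
Qed.

End density.

(** * Identification of the constants *)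

Section constants_identities.
Context {R : realType}.

(** The denominator Gamma (3 / 2) = sqrt pi / 2 of [hardy1] turns 2^(- 2 s) into 2^(1 - 2 s) / sqrt
    pi. *)
Lemma kappaE (N : nat) (s : R) : 0 < s ->
  kappa N s = hardy1 (2 * s) / Gamma ((N%:R + 2 * s) / 2) *
    (pi `^ ((N%:R - 1) / 2) * Gamma ((1 + 2 * s) / 2)).
Proof.
move=> s0; have sp : Num.sqrt pi != 0 :> R by rewrite gt_eqF// sqrtr_gt0 pi_gt0.
have G0 : Gamma ((N%:R + 2 * s) / 2) != 0.
  by rewrite gt_eqF// Gamma_gt0// divr_gt0// ltr_wpDl// mulr_gt0.
have s1 : s != 0 by rewrite gt_eqF.
rewrite /kappa /hardy1 Gamma_three_halves (_ : 2 * s / 2 = s); last by field.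
have -> : 2 `^ (1 - 2 * s) = 2 * 2 `^ (- (2 * s)) :> R.
  rewrite powRD ?powRr1//; by apply/implyP => _; rewrite pnatr_eq0.
move: (Gamma ((N%:R + 2 * s) / 2)) G0 (Gamma ((1 + 2 * s) / 2)) (Gamma (1 - s)) => g1 g10 g2 g3.
by field; rewrite s1 g10 sp.
Qed.

(** The factor Gamma ((1 + 2 s) / 2) of [kappa] cancels, and its power of pi combines with sqrt pi /
    Gamma (N / 2) into half the area of the sphere. *)
Lemma aNsE (N : nat) (s : R) : (0 < N)%N -> 0 < s ->
  aNs N s = cNs N s * hardy1 (2 * s) / Gamma ((N%:R + 2 * s) / 2) *
    @hardy_volume_constant R N (2 * s).
Proof.
move=> N0 s0; have p0 : 0 < pi :> R := pi_gt0 R.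
have N1 : 0 < N%:R :> R by rewrite ltr0n.
have G0 : Gamma ((N%:R + 2 * s) / 2) != 0.
  by rewrite gt_eqF// Gamma_gt0// divr_gt0// ltr_wpDl// mulr_gt0.
have G1 : Gamma ((1 + 2 * s) / 2) != 0.
  by rewrite gt_eqF// Gamma_gt0// divr_gt0// ltr_wpDl// mulr_gt0.
have G2 : Gamma (N%:R / 2) != 0 :> R by rewrite gt_eqF// Gamma_gt0// divr_gt0.
rewrite /aNs /hNs /hardy_volume_constant kappaE//.
move: (_ `^ (- (2 * s / N%:R))) => c.
rewrite sphere_areaE// (_ : pi `^ (N%:R / 2) = pi `^ ((N%:R - 1) / 2) * Num.sqrt pi); last first.
  rewrite -powR12_sqrt ?(ltW p0)// -powRD; last by rewrite (gt_eqF p0) implybT.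
  by congr (_ `^ _); field.
move: (Gamma ((N%:R + 2 * s) / 2)) G0 (Gamma ((1 + 2 * s) / 2)) G1 (Gamma (N%:R / 2)) G2 => g0 ? g1 ? g2 ?.
move: (hardy1 (2 * s)) (cNs N s) (pi `^ ((N%:R - 1) / 2)) => k1 k2 k3.
by field; apply/and3P.
Qed.

Lemma cNs_gt0 (N : nat) (s : R) : 0 < s -> s < 1 -> 0 < cNs N s.
Proof.
move=> s0 s1; rewrite /cNs divr_gt0 ?Gamma_gt0 ?subr_gt0//.
by rewrite !mulr_gt0 ?powR_gt0 ?pi_gt0// Gamma_gt0// divr_gt0// ltr_wpDl// mulr_gt0.
Qed.

(** The error e is multiplied by 1 + 1 / eta, so eta is fixed before e. *)
Lemma ereal_density (X : \bar R) (a n : R) : 0 <= a -> 0 <= n ->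
  (forall eta e, 0 < eta -> 0 < e ->
    (X <= ((1 + eta) * ((1 + eta) * a + (1 + eta^-1) * e) + (1 + eta^-1) * (n * e))%:E)%E) ->
  (X <= a%:E)%E.
Proof.
move=> a0 n0 H; apply/lee_addgt0Pr => eps eps0.
(* For eta <= 1 one has (1 + eta)^2 a <= a + 3 eta a, so the excess is at most eps / 2; the terms in
   e take the other half. *)
pose eta := Num.min 1 (eps / (6 * (a + 1))).
have a1 : 0 < 6 * (a + 1) by rewrite mulr_gt0// ltr_wpDl.
have eta0 : 0 < eta by rewrite lt_min ltr01 divr_gt0.
have eta1 : eta <= 1 by rewrite ge_min lexx.
have etae : eta * (6 * (a + 1)) <= eps by rewrite -ler_pdivlMr// ge_min lexx orbT.
pose C := (1 + eta) * (1 + eta^-1) + (1 + eta^-1) * n.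
have i0 : 0 < 1 + eta^-1 by rewrite addr_gt0// invr_gt0.
have C0 : 0 < C by rewrite ltr_wpDr ?mulr_ge0 ?(ltW i0)// mulr_gt0// addr_gt0.
have e0 : 0 < eps / (2 * C) by rewrite divr_gt0// mulr_gt0.
apply: (le_trans (H eta (eps / (2 * C)) eta0 e0)).
rewrite -EFinD lee_fin.
have -> : (1 + eta) * ((1 + eta) * a + (1 + eta^-1) * (eps / (2 * C))) +
    (1 + eta^-1) * (n * (eps / (2 * C))) = (1 + eta) ^+ 2 * a + C * (eps / (2 * C)).
  by rewrite /C; ring.
have -> : C * (eps / (2 * C)) = eps / 2 by field; rewrite gt_eqF.
have : eta * eta <= eta by rewrite ger_pMl.
nra.
Qed.

End constants_identities.

(** * From bounded to arbitrary convex sets *)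

Section gagliardo.
Context {R : realType} {N : nat}.
Local Notation leb := (lebesgue_rV R N).
Implicit Types (O : set 'rV[R]_N) (f : 'rV[R]_N -> R).

Lemma measurable_gagliardo_kernel (p : R) :
  measurable_fun [set: 'rV[R]_N * 'rV[R]_N] (fun z => enorm (z.1 - z.2) `^ p).
Proof.
have mN : measurable_fun [set: 'rV[R]_N * 'rV[R]_N] (fun z => - z.2) by exact: measurable_rV_opp_fun.
have mB : measurable_fun [set: 'rV[R]_N * 'rV[R]_N] (fun z => z.1 - z.2).
  exact: (measurable_rV_add_fun measurable_fst mN).
apply: (measurableT_comp (measurable_powR _)).
exact: (measurableT_comp (@measurable_enorm R N) mB).
Qed.

Lemma measurable_difference f : measurable_fun [set: 'rV[R]_N] f ->
  measurable_fun [set: 'rV[R]_N * 'rV[R]_N] (fun z => f z.1 - f z.2).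
Proof.
move=> mf; apply: measurable_funB.
- exact: (measurableT_comp mf measurable_fst).
- exact: (measurableT_comp mf measurable_snd).
Qed.

Lemma seminorm2E (s : R) O f : seminorm2 s O f =
  (\int[leb \x leb]_(z in O `*` O)
    (enorm (z.1 - z.2) `^ (- (N%:R + 2 * s)) * (f z.1 - f z.2) ^+ 2)%:E)%E.
Proof. by apply: eq_integral => z _; rewrite powRN mulrC. Qed.

Lemma seminorm2_split (s eta : R) O f g : measurable O -> 0 < eta ->
  measurable_fun [set: 'rV[R]_N] f -> measurable_fun [set: 'rV[R]_N] g ->
  (seminorm2 s O f <= (1 + eta)%:E * seminorm2 s O g +
   (1 + eta^-1)%:E * seminorm2 s O (fun x => (g x - f x)%R))%E.
Proof.
move=> mO eta0 mf mg; rewrite !seminorm2E.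
apply: (le_trans (ge0_integral_square_split _ (measurableX mO mO) (measurable_difference mf)
  (measurable_difference mg) (measurable_gagliardo_kernel _) (fun z => powR_ge0 _ _) eta0)).
rewrite leeD2l//; apply: lee_wpmul2l; first by rewrite lee_fin addr_ge0// invr_ge0 ltW.
rewrite le_eqVlt; apply/orP; left; apply/eqP; apply: eq_integral => z _; congr EFin; ring.
Qed.

Lemma seminorm2_subset (s : R) O O' f : measurable O -> measurable O' -> O' `<=` O ->
  measurable_fun [set: 'rV[R]_N] f -> (seminorm2 s O' f <= seminorm2 s O f)%E.
Proof.
move=> mO mO' OO mf; rewrite !seminorm2E; apply: ge0_subset_integral.
- exact: measurableX.
- exact: measurableX.
- apply: measurable_funTS; apply/measurable_EFinP; apply: measurable_funM.
    exact: measurable_gagliardo_kernel.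
  by apply: measurable_funX; exact: measurable_difference.
- by move=> z _; rewrite lee_fin mulr_ge0 ?sqr_ge0 ?powR_ge0.
- by move=> z [/= z1 z2]; split; exact: OO.
Qed.

Lemma seminorm2_ge0 (s : R) O f : (0 <= seminorm2 s O f)%E.
Proof. by rewrite seminorm2E; apply: integral_ge0 => z _; rewrite lee_fin mulr_ge0 ?sqr_ge0 ?powR_ge0. Qed.

Lemma smooth_measurable f : smooth f -> measurable_fun [set: 'rV[R]_N] f.
Proof. by move=> sf; apply: continuous_rV_measurable; exact: (sf [::]).1. Qed.

Lemma hardy_Cc (s : R) O f : (0 < N)%N -> 1 < 2 * s -> 2 * s < 2 -> open O -> convex_set O ->
  Cc_smooth O f -> (\int[leb]_(x in O) (f x ^+ 2)%:E < +oo)%E -> 0 <= hardy1 (2 * s) ->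
  ((2 * hardy1 (2 * s))%:E * \int[leb]_(x in O) ((f x ^+ 2)%:E * hardy_weight (2 * s) O x) <=
   (Gamma ((N%:R + 2 * s) / 2))%:E * seminorm2 s O f)%E.
Proof.
move=> N0 al1 al2 oO cO [sf cK KO] f2 k0; have mf := smooth_measurable sf.
have mO := open_rV_measurable oO.
have [M M0 KM] := compact_rV_bounded cK.
have [r r0 Kr] := compact_open_margin cK oO KO.
have fK x : f x != 0 -> Defs.support f x by move=> fx; exact: subset_closure.
(* A cube exceeding the support by 1 on every side. It makes the gauges positive, while the weight
   remains that of O. *)
pose C := [set x : 'rV[R]_N | forall i, `|x 0 i| < M + 1].
pose O' := O `&` C.
have oC : open C.
  have -> : C = ball (0 : 'rV[R]_N) (M + 1).
    apply/seteqP; split => x Cx.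
      split; first by rewrite addr_gt0.
      by move=> i j; rewrite ord1 /ball/= mxE sub0r normrN; exact: Cx.
    by move=> i; have [_ /(_ 0 i)] := Cx; rewrite /ball/= mxE sub0r normrN.
  exact: ball_open.
have oO' : open O' by exact: openI.
have O'O : O' `<=` O by move=> x [].
have cO' : convex_set O'.
  move=> x y l; rewrite !inE => -[Ox Cx] [Oy Cy]; split.
    by have := cO x y l (mem_set Ox) (mem_set Oy); rewrite inE.
  have xyE : conv l x y = (l%:num *: x + (1 - l%:num) *: y : 'rV[R]_N) by [].
  move=> i; rewrite xyE !mxE.
  have l0 : 0 <= l%:num by [].
  have l1 : 0 <= 1 - l%:num by rewrite subr_ge0.
  have := Cx i; have := Cy i; rewrite !ltr_norml => /andP[y1 y2] /andP[x1 x2].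
  move: (l%:num) l0 l1 (x 0 i) (y 0 i) x1 x2 y1 y2 => t t0 t1 a c a1 a2 c1 c2.
  have [->|tn] := eqVneq t 0; first by rewrite mul0r subr0 mul1r add0r c1 c2.
  have tp : 0 < t by rewrite lt_neqAle eq_sym tn.
  have p1 : 0 < (M + 1 - a) * t by rewrite mulr_gt0// subr_gt0.
  have p2 : 0 < (a + (M + 1)) * t by rewrite mulr_gt0// -ltrBlDr sub0r.
  have p3 : 0 <= (M + 1 - c) * (1 - t) by rewrite mulr_ge0// subr_ge0 ltW.
  have p4 : 0 <= (c + (M + 1)) * (1 - t) by rewrite mulr_ge0// -lerBlDr sub0r ltW.
  apply/andP; split; lra.
have bO' y : O' y -> forall i, `|y 0 i| < M + 1 by move=> [].
(* The margin in O is r, the margin in the cube is 1. *)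
have r1 : 0 < Num.min r 1 by rewrite lt_min r0 ltr01.
have rO' x : O' x -> f x != 0 -> forall v : 'rV[R]_N, (forall i, `|v 0 i| < Num.min r 1) -> O' (x + v).
  move=> _ /fK Kx v vr; split.
    by apply: Kr => // i; rewrite (lt_le_trans (vr i))// ge_min lexx.
  move=> i; rewrite mxE (le_lt_trans (ler_normD _ _))// ltrD ?KM//.
  by rewrite (lt_le_trans (vr i))// ge_min lexx orbT.
have mO' := open_rV_measurable oO'.
have f2' : (\int[leb]_(x in O') (f x ^+ 2)%:E < +oo)%E.
  apply: le_lt_trans f2; apply: ge0_subset_integral => //.
  - by apply: measurable_funTS; apply/measurable_EFinP; exact: measurable_funX.
  - by move=> x _; rewrite lee_fin sqr_ge0.
have := hardy_bounded N0 oO' mf al1 cO' bO' al2 r1 rO' f2' oO O'O k0.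
have -> : (\int[leb]_(x in O') ((f x ^+ 2)%:E * hardy_weight (2 * s) O x) =
    \int[leb]_(x in O) ((f x ^+ 2)%:E * hardy_weight (2 * s) O x))%E.
  rewrite integral_mkcond [RHS]integral_mkcond; apply: eq_integral => x _; rewrite !patchE.
  have [->|fx] := eqVneq (f x) 0; first by rewrite expr0n mul0e; case: ifP; case: ifP.
  have Kx := fK _ fx.
  by rewrite !mem_set//; [exact: KO|split; [exact: KO|move=> i; rewrite (lt_trans (KM _ Kx i))// ltrDl]].
move=> /le_trans; apply; apply: lee_wpmul2l.
  by rewrite lee_fin ltW// Gamma_gt0// divr_gt0// ltr_wpDl// (lt_trans _ al1).
exact: (@seminorm2_subset s O O' f).
Qed.

End gagliardo.

Opaque Gamma.

Lemma rescale_le {R : realType} (c h g : R) (x y : \bar R) : 0 < g -> 0 <= c ->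
  ((2 * h)%:E * x <= g%:E * y -> (c * h / g)%:E * x <= (c / 2)%:E * y)%E.
Proof.
move=> g0 c0; have g1 : g != 0 by rewrite gt_eqF.
have cg : (0 <= (c / 2 / g)%:E)%E by rewrite lee_fin divr_ge0 ?(ltW g0)// divr_ge0.
move/(lee_wpmul2l cg); rewrite !muleA -!EFinM.
have -> : c / 2 / g * (2 * h) = c * h / g by field.
by rewrite divfK.
Qed.

(** * Extension by density *)

Section hardy_density.
Context {R : realType} {N : nat}.
Local Notation leb := (lebesgue_rV R N).
Variables (s : R) (O : set 'rV[R]_N).
Hypotheses (N0 : (0 < N)%N) (s1 : 1 / 2 < s) (s2 : s < 1) (oO : open O) (cO : convex_set O).

Let s0 : 0 < s. Proof. by rewrite (lt_trans _ s1)// divr_gt0. Qed.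
Let al1 : 1 < 2 * s. Proof. by rewrite mulrC -ltr_pdivrMr. Qed.
Let al2 : 2 * s < 2. Proof. by rewrite gtr_pMr. Qed.
Let c0 : 0 < cNs N s. Proof. exact: cNs_gt0. Qed.
Let mO : measurable O := open_rV_measurable oO.
Let G0 : 0 < Gamma ((N%:R + 2 * s) / 2).
Proof. by rewrite Gamma_gt0// divr_gt0// ltr_wpDl// mulr_gt0. Qed.

Let k := cNs N s * hardy1 (2 * s) / Gamma ((N%:R + 2 * s) / 2).
Let V x : \bar R := (k%:E * hardy_weight (2 * s) O x)%E.
Let A f : \bar R := ((cNs N s / 2)%:E * seminorm2 s O f)%E.

Let mV : measurable_fun [set: 'rV[R]_N] V.
Proof. by apply: emeasurable_funM; [exact: measurable_cst|exact: measurable_hardy_weight]. Qed.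

Let c20 : (0 <= (cNs N s / 2)%:E)%E.
Proof. by rewrite lee_fin divr_ge0// ltW. Qed.

Let A_ge0 f : (0 <= A f)%E.
Proof. by apply: mule_ge0 => //; exact: seminorm2_ge0. Qed.

Hypothesis (h0 : 0 <= hardy1 (2 * s)).

Let k0 : 0 <= k.
Proof. by rewrite divr_ge0 ?(ltW G0)// mulr_ge0// ltW. Qed.

Let V0 x : (0 <= V x)%E.
Proof. by apply: mule_ge0; [rewrite lee_fin|exact: (hardy_weight_ge0 N0 al1)]. Qed.

Let hardy_smooth f : Cc_smooth O f -> (\int[leb]_(x in O) (f x ^+ 2)%:E < +oo)%E ->
  (\int[leb]_(x in O) ((f x ^+ 2)%:E * V x) <= A f)%E.
Proof.
move=> fC f2; have mf := smooth_measurable (let: And3 sf _ _ := fC in sf).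
have := hardy_Cc N0 al1 al2 oO cO fC f2 h0.
have -> : (\int[leb]_(x in O) ((f x ^+ 2)%:E * V x) =
    k%:E * \int[leb]_(x in O) ((f x ^+ 2)%:E * hardy_weight (2 * s) O x))%E.
  rewrite -ge0_integralZl//; last 2 first.
  - apply: measurable_funTS; apply: emeasurable_funM; last exact: measurable_hardy_weight.
    by apply/measurable_EFinP; exact: measurable_funX.
  - by move=> x _; apply: mule_ge0; [rewrite lee_fin sqr_ge0|exact: (hardy_weight_ge0 N0 al1)].
  by apply: eq_integral => x _; rewrite muleCA.
by move/(rescale_le G0 (ltW c0)).
Qed.

Lemma Hs_norm_lt (f : 'rV[R]_N -> R) (e : R) : 0 < e -> (Hs_norm s O f < (Num.sqrt e)%:E)%E ->
  (\int[leb]_(x in O) (f x ^+ 2)%:E + A f < e%:E)%E.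
Proof.
move=> e0; rewrite /Hs_norm -/(A f).
have : (0 <= \int[leb]_(x in O) (f x ^+ 2)%:E + A f)%E.
  by apply: adde_ge0 => //; apply: integral_ge0 => x _; rewrite lee_fin sqr_ge0.
case: (_ + _)%E => [r| |] // r0; last by rewrite poweRyr// invr_eq0 pnatr_eq0.
rewrite poweR_EFin !lte_fin; rewrite lee_fin in r0.
by rewrite powR12_sqrt// ltr_sqrt.
Qed.

Lemma hardy_closure (u : 'rV[R]_N -> R) : measurable_fun [set: 'rV[R]_N] u ->
  (\int[leb]_(x in O) (u x ^+ 2)%:E < +oo)%E -> (A u < +oo)%E ->
  (forall e : R, 0 < e -> exists2 f, Cc_smooth O f & (Hs_norm s O (fun x => (u x - f x)%R) < e%:E)%E) ->
  (\int[leb]_(x in O) ((u x ^+ 2)%:E * V x) <= A u)%E.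
Proof.
move=> mu u2 Au dense; apply: ge0_integral_square_truncation => // n.
have Afin : A u \is a fin_num by rewrite ge0_fin_numE.
rewrite -(fineK Afin).
apply: (@ereal_density _ _ _ n%:R) => //; first by rewrite fine_ge0.
move=> eta e eta0 e0.
have [|f fC fe] := dense (Num.sqrt e); first by rewrite sqrtr_gt0.
have mf := smooth_measurable (let: And3 sf _ _ := fC in sf).
have {fe} := Hs_norm_lt e0 fe; set I := (\int[leb]_(x in O) _)%E => Ie.
have I0 : (0 <= I)%E by apply: integral_ge0 => x _; rewrite lee_fin sqr_ge0.
have Ile : (I <= e%:E)%E by apply: le_trans (ltW Ie); rewrite leeDl.
have Ale : (A (fun x => (u x - f x)%R) <= e%:E)%E by apply: le_trans (ltW Ie); rewrite leeDr.
have m1 : measurable_fun [set: 'rV[R]_N] (fun=> 1 : R) by exact: measurable_cst.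
(* Square integrability of f comes from that of u and u - f, by the splitting with eta = 1. *)
have f2 : (\int[leb]_(x in O) (f x ^+ 2)%:E < +oo)%E.
  have := ge0_integral_square_split leb mO mf mu m1 (fun=> ler01) ltr01.
  under eq_integral do rewrite mul1r.
  move=> /le_lt_trans; apply; apply: lte_add_pinfty; apply: lte_mul_pinfty => //.
    by under eq_integral do rewrite mul1r.
  apply: le_lt_trans (ltry e); apply: le_trans Ile.
  rewrite le_eqVlt; apply/orP; left; apply/eqP; apply: eq_integral => x _; congr EFin; ring.
pose w x : R := fine (Order.min (V x) n%:R%:E).
have wE x : (w x)%:E = Order.min (V x) n%:R%:E.
  rewrite fineK// ge0_fin_numE; last by rewrite le_min V0 lee_fin/=.
  by rewrite (@le_lt_trans _ _ n%:R%:E) ?ltry// ge_min lexx orbT.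
have w0 x : 0 <= w x by rewrite -lee_fin wE le_min V0 lee_fin/=.
have wV x : ((w x)%:E <= V x)%E by rewrite wE ge_min lexx.
have wn x : w x <= n%:R by rewrite -lee_fin wE ge_min lexx orbT.
have mw : measurable_fun [set: 'rV[R]_N] w.
  apply/measurable_EFinP; rewrite (_ : EFin \o w = fun x => Order.min (V x) n%:R%:E).
    by apply: measurable_mine => //; exact: measurable_cst.
  by apply/funext => x; rewrite /= wE.
apply: (le_trans (ge0_integral_square_split leb mO mu mf mw w0 eta0)).
have i1 : (0 <= (1 + eta)%:E)%E by rewrite lee_fin addr_ge0// ltW.
have i2 : (0 <= (1 + eta^-1)%:E)%E by rewrite lee_fin addr_ge0// invr_ge0 ltW.
(* The weighted integral of f^2 is at most A f, which a second splitting compares with A u; the one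
   of (u - f)^2 costs the bound n of the truncated weight. *)
rewrite [X in (_ <= X)%E]EFinD; apply: leeD.
  rewrite [X in (_ <= X)%E]EFinM; apply: lee_wpmul2l => //.
  apply: (@le_trans _ _ (A f)).
    apply: le_trans (hardy_smooth fC f2); apply: ge0_le_integral => //.
    - by move=> x _; rewrite lee_fin mulr_ge0 ?sqr_ge0.
    - by apply: measurable_funTS; apply/measurable_EFinP; apply: measurable_funM => //; exact: measurable_funX.
    - apply: measurable_funTS; apply: emeasurable_funM => //.
      by apply/measurable_EFinP; exact: measurable_funX.
    - by move=> x _; rewrite mulrC EFinM; apply: lee_wpmul2l; [rewrite lee_fin sqr_ge0|exact: wV].
  have := lee_wpmul2l c20 (seminorm2_split s mO eta0 mf mu).
  have q1 := mule_ge0 i1 (seminorm2_ge0 s O u).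
  have q2 := mule_ge0 i2 (seminorm2_ge0 s O (fun x => u x - f x)).
  rewrite (ge0_muleDr _ q1 q2).
  move=> /le_trans; apply; rewrite [X in (_ <= X)%E]EFinD; apply: leeD.
    by rewrite muleCA [X in (_ <= X)%E]EFinM fineK.
  by rewrite muleCA [X in (_ <= X)%E]EFinM; apply: lee_wpmul2l.
rewrite [X in (_ <= X)%E]EFinM; apply: lee_wpmul2l => //.
apply: (@le_trans _ _ (n%:R%:E * I)%E); last by rewrite EFinM; apply: lee_wpmul2l => //.
have muf : measurable_fun [set: 'rV[R]_N] (fun x => u x - f x) by exact: measurable_funB.
rewrite -ge0_integralZl//; last 2 first.
- by apply: measurable_funTS; apply/measurable_EFinP; exact: measurable_funX.
- by move=> x _; rewrite lee_fin sqr_ge0.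
apply: ge0_le_integral => //.
- by move=> x _; rewrite lee_fin mulr_ge0 ?sqr_ge0.
- by apply: measurable_funTS; apply/measurable_EFinP; apply: measurable_funM => //; exact: measurable_funX.
- apply: measurable_funTS; apply: emeasurable_funM; first exact: measurable_cst.
  by apply/measurable_EFinP; exact: measurable_funX.
- by move=> x _; rewrite -EFinM lee_fin ler_wpM2r ?sqr_ge0.
Qed.

Lemma hardy_weight_split (u : 'rV[R]_N -> R) : measurable_fun [set: 'rV[R]_N] u ->
  (\int[leb]_(x in O) ((u x ^+ 2)%:E * V x) =
   (hNs N s)%:E * (\int[leb]_(x in O) ((u x ^+ 2)%:E / delta O x `^ (2 * s))) +
   (aNs N s)%:E * (leb O `^ (2 * s / N%:R))^-1 * (\int[leb]_(x in O) (u x ^+ 2)%:E))%E.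
Proof.
move=> mu; have hE : hNs N s = k * (pi `^ ((N%:R - 1) / 2) * Gamma ((1 + 2 * s) / 2)).
  have E (a b c d : R) : a * (b / c * d) = a * b / c * d by rewrite !mulrA.
  by rewrite /hNs (kappaE _ s0) E.
have C1 : 0 <= pi `^ ((N%:R - 1) / 2) * Gamma ((1 + 2 * s) / 2).
  apply: mulr_ge0; first exact: powR_ge0.
  have q0 : 0 < (1 + 2 * s) / 2 by rewrite divr_gt0// addr_gt0// mulr_gt0.
  exact: ltW (Gamma_gt0 q0).
pose C2 := @hardy_volume_constant R N (2 * s).
have aE : aNs N s = k * C2 by rewrite aNsE.
have C20 : 0 <= C2 := hardy_volume_constant_ge0 N0 al1.
have l0 : (0 <= (leb O `^ (2 * s / N%:R))^-1)%E by rewrite inve_ge0 poweR_ge0.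
have md : measurable_fun O (fun x => (u x ^+ 2)%:E / delta O x `^ (2 * s))%E.
  apply: measurable_funTS; apply: emeasurable_funM; last exact: measurable_delta_weight.
  by apply/measurable_EFinP; exact: measurable_funX.
have d0 x : (0 <= (u x ^+ 2)%:E / delta O x `^ (2 * s))%E.
  by apply: mule_ge0; [rewrite lee_fin sqr_ge0|rewrite inve_ge0 poweR_ge0].
have m2 : measurable_fun O (fun x => (u x ^+ 2)%:E).
  by apply: measurable_funTS; apply/measurable_EFinP; exact: measurable_funX.
have u0 x : (0 <= (u x ^+ 2)%:E)%E by rewrite lee_fin sqr_ge0.
have h1 : (0 <= (hNs N s)%:E)%E by rewrite lee_fin hE mulr_ge0.
have a1 : (0 <= (aNs N s)%:E * (leb O `^ (2 * s / N%:R))^-1)%E.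
  by apply: mule_ge0 => //; rewrite lee_fin aE mulr_ge0.
rewrite -(ge0_integralZl leb mO md (fun x _ => d0 x) h1).
rewrite -(ge0_integralZl leb mO m2 (fun x _ => u0 x) a1).
rewrite -ge0_integralD//; last 4 first.
- by move=> x _; exact: mule_ge0.
- by apply: emeasurable_funM => //; exact: measurable_cst.
- by move=> x _; exact: mule_ge0.
- by apply: emeasurable_funM => //; exact: measurable_cst.
apply: eq_integral => x _; rewrite /V /hardy_weight -/C2.
have D0 : (0 <= (delta O x `^ (2 * s))^-1)%E by rewrite inve_ge0 poweR_ge0.
have p1 : (0 <= (pi `^ ((N%:R - 1) / 2) * Gamma ((1 + 2 * s) / 2))%:E * (delta O x `^ (2 * s))^-1)%E.
  by apply: mule_ge0 => //; rewrite lee_fin.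
have p2 : (0 <= C2%:E * (leb O `^ (2 * s / N%:R))^-1)%E by apply: mule_ge0 => //; rewrite lee_fin.
have kE : (0 <= k%:E)%E by rewrite lee_fin.
rewrite (ge0_muleDr _ p1 p2) (ge0_muleDr _ (mule_ge0 kE p1) (mule_ge0 kE p2)) hE aE; congr (_ + _)%E.
  by rewrite [RHS]muleCA [(k * _)%:E]EFinM -!muleA.
by rewrite [RHS]muleC [(k * _)%:E]EFinM -!muleA.
Qed.

End hardy_density.

Unset Implicit Arguments.
(* |Omega|^(-2s/N) is written as an inverse in \bar R, so that it is 0 when
   |Omega| = +oo; likewise for 1 / delta^(2s). *)
Theorem theorem1p4 (R : realType) (N : nat) (s : R) (Omega : set 'rV[R]_N)
    (hN : (0 < N)%N) (hs : 1 / 2 < s < 1)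
    (openO : open Omega) (convexO : convex_set Omega)
    (u : 'rV[R]_N -> R) (hu : Hs0 s Omega u) :
  ((cNs N s / 2)%:E *
     (\int[lebesgue_rV R N \x lebesgue_rV R N]_(z in Omega `*` Omega)
        ((u z.1 - u z.2) ^+ 2 / enorm (z.1 - z.2) `^ (N%:R + 2 * s))%:E)
   >=
   (hNs N s)%:E *
     (\int[lebesgue_rV R N]_(x in Omega)
        ((u x ^+ 2)%:E / delta Omega x `^ (2 * s)))
   + (aNs N s)%:E * (lebesgue_rV R N Omega `^ (2 * s / N%:R))^-1 *
     (\int[lebesgue_rV R N]_(x in Omega) (u x ^+ 2)%:E))%E.
Proof.
have /andP[s1 s2] := hs; have s0 : 0 < s by rewrite (lt_trans _ s1)// divr_gt0.
have c0 : 0 < cNs N s by exact: cNs_gt0.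
have mO := open_rV_measurable openO.
have [[[mu u2] [mE E2]] dense] := hu.
rewrite -/(seminorm2 s Omega u).
(* [Hs0] gives measurability of u on Omega only; extending by 0 makes it global and changes none of
   the integrals. *)
pose u1 := u \_ Omega.
have u1E x : Omega x -> u1 x = u x by move=> Ox; rewrite /u1 patchE mem_set.
have mu1 : measurable_fun [set: 'rV[R]_N] u1 by apply/(measurable_restrictT _ mO).
have e1 : (\int[lebesgue_rV R N]_(x in Omega) ((u x ^+ 2)%:E / delta Omega x `^ (2 * s)) =
    \int[lebesgue_rV R N]_(x in Omega) ((u1 x ^+ 2)%:E / delta Omega x `^ (2 * s)))%E.
  by apply: eq_integral => x; rewrite inE => Ox; rewrite u1E.
have e2 : (\int[lebesgue_rV R N]_(x in Omega) (u x ^+ 2)%:E =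
    \int[lebesgue_rV R N]_(x in Omega) (u1 x ^+ 2)%:E)%E.
  by apply: eq_integral => x; rewrite inE => Ox; rewrite u1E.
have e3 : seminorm2 s Omega u = seminorm2 s Omega u1.
  by apply: eq_integral => z; rewrite inE => -[z1 z2]; rewrite !u1E.
rewrite e1 e2 e3.
have G0 : 0 < Gamma ((N%:R + 2 * s) / 2).
  by rewrite Gamma_gt0// divr_gt0// ltr_wpDl// mulr_gt0.
(* The sign of [hardy1] is not computed: if it is negative, so are the factors it contributes to
   [hNs] and [aNs], and the right-hand side of the inequality is at most 0. *)
have [h0|h0] := leP 0 (hardy1 (2 * s)); last first.
  apply: (@le_trans _ _ 0%E); last first.
    by apply: mule_ge0; [rewrite lee_fin divr_ge0// ltW|exact: seminorm2_ge0].
  have n0 : 0 < N%:R :> R by rewrite ltr0n.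
  apply: adde_le0.
    apply: mule_le0_ge0.
      rewrite lee_fin /hNs kappaE//; apply: mulr_ge0_le0; first exact: ltW.
      apply: mulr_le0_ge0; last first.
        apply: mulr_ge0; [exact: powR_ge0|apply: ltW; apply: Gamma_gt0].
        by rewrite divr_gt0// addr_gt0// mulr_gt0.
      by apply: mulr_le0_ge0; [exact: ltW|rewrite invr_ge0; exact: ltW].
    apply: integral_ge0 => x _.
    by apply: mule_ge0; [rewrite lee_fin sqr_ge0|rewrite inve_ge0 poweR_ge0].
  apply: mule_le0_ge0; last by apply: integral_ge0 => x _; rewrite lee_fin sqr_ge0.
  apply: mule_le0_ge0; last by rewrite inve_ge0 poweR_ge0.
  rewrite lee_fin aNsE//; apply: mulr_le0_ge0.
    apply: mulr_le0_ge0; last by rewrite invr_ge0; exact: ltW.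
    by apply: mulr_ge0_le0; exact: ltW.
  by apply: hardy_volume_constant_ge0 => //; rewrite mulrC -ltr_pdivrMr.
rewrite -(hardy_weight_split hN s1 s2 openO h0 mu1).
apply: (hardy_closure hN s1 s2 openO convexO h0 mu1).
- by rewrite -e2.
- apply: lte_mul_pinfty; [by rewrite lee_fin divr_ge0// ltW|by []|].
  rewrite -e3; apply: le_lt_trans E2; rewrite seminorm2E.
  rewrite le_eqVlt; apply/orP; left; apply/eqP; apply: eq_integral => z _.
  congr EFin; rewrite exprMn mulrC; congr (_ * _).
  by rewrite -powR_mulrn ?powR_ge0// -powRrM; congr (_ `^ _); field.
move=> e e0; have [f [fC fe]] := dense e e0; exists f => //.
suff -> : Hs_norm s Omega (fun x => u1 x - f x) = Hs_norm s Omega (fun x => u x - f x) by [].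
rewrite /Hs_norm; congr ((_ + _ * _) `^ _)%E.
  by apply: eq_integral => x; rewrite inE => Ox; rewrite u1E.
by apply: eq_integral => z; rewrite inE => -[z1 z2]; rewrite !u1E.
Qed.
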